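(* For a peak composition $\alpha$ of $n$, $$\widetilde{Q}_\alpha=\sum_{\beta}c_{\alpha,\beta}\,\widetilde{\mathcal S}_\beta,$$ where $\beta$ runs over all peak compositions of $n$ and $c_{\alpha,\beta}=|\mathrm{DIRT}(\beta,\alpha^{\rm r})|$.
   Context: A composition $\alpha=(\alpha_1,\dots,\alpha_k)$ of $n$ is a finite list of positive integers with sum $n$; $\ell(\alpha)=k$; $\alpha^{\rm r}=(\alpha_k,\dots,\alpha_1)$. Its diagram $D(\alpha)$ is the left-justified array with $\alpha_i$ boxes in row $i$, rows numbered from bottom to top; box $(i,j)$ lies in column $i$ and row $j$, and $T_{i,j}$ is the entry of $T$ there. A peak composition is a composition all of whose parts, except possibly the last, are greater than $1$. A filling of $D(\alpha)$ with $1,\dots,n$ satisfies the peak-tableau condition if for every $1\le k\le n$ the boxes with entries $\le k$ form the diagram of a peak composition. SPIT: for a peak composition $\alpha$, $\mathrm{SPIT}(\alpha)$ is the set of fillings of $D(\alpha)$ with $1,\dots,n$ (each once), rows increasing from left to right, first column increasing from bottom to top, satisfying the peak-tableau condition. SYCT: a standard Young composition tableau of shape $\alpha$ is a filling of $D(\alpha)$ with $1,\dots,n$ (each once), rows increasing from left to right, first column increasing from bottom to top, such that whenever $i<j$, $(k,j),(k+1,i)\in D(\alpha)$ and $T_{k,j}\le T_{k+1,i}$, then $(k+1,j)\in D(\alpha)$ and $T_{k+1,j}<T_{k+1,i}$. SPYCT: for a peak composition $\alpha$, $\mathrm{SPYCT}(\alpha)$ is the set of SYCTs of shape $\alpha$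 satisfying the peak-tableau condition. Readings: $\mathrm{w}_{\rm c}(T)$ reads column by column starting from the leftmost column, each from bottom to top. $\mathrm{w}_{\rm Y}(T)$ reads the first column from top to bottom, then the subsequent columns from left to right, each from bottom to top. $\mathrm{Des}(\sigma)=\{i\in[n-1]\mid i$ is to the right of $i+1$ in $\sigma\}$; $\mathrm{Peak}(X)=\{i\in X\mid i>1,\ i-1\notin X\}$. For a composition $\gamma$ of $n$, $\mathrm{set}(\gamma)=\{\gamma_1,\gamma_1+\gamma_2,\dots,\gamma_1+\cdots+\gamma_{\ell(\gamma)-1}\}$; for $I=\{i_1<\cdots<i_p\}\subseteq[n-1]$, $\mathrm{comp}(I)=(i_1,i_2-i_1,\dots,n-i_p)$. $F_\gamma=\sum x_{i_1}\cdots x_{i_n}$ over $1\le i_1\le\cdots\le i_n$ with $i_j<i_{j+1}$ if $j\in\mathrm{set}(\gamma)$. For a peak composition $\gamma$ of $n$ with $I=\mathrm{set}(\gamma)$, $K_\gamma=2^{|I|+1}\sum F_\beta$ over compositions $\beta$ of $n$ with $I\subseteq\mathrm{set}(\beta)\triangle(\mathrm{set}(\beta)+1)$ ($\triangle$ symmetric difference, $\mathrm{set}(\beta)+1=\{i+1\mid i\in\mathrm{set}(\beta)\}$). Quasisymmetric Schur $Q$-function: $\widetilde{Q}_\alpha=\sum_{T\in\mathrm{SPIT}(\alpha)}K_{\mathrm{comp}(\mathrm{Peak}(\mathrm{Des}(\mathrm{w}_{\rm c}(T))))}$. Peak Young quasisymmetric Schur function: $\widetilde{\mathcal S}_\alpha=\sum_{T\in\mathrm{SPYCT}(\alpha)}K_{\mathrm{comp}(\mathrm{Peak}(\mathrm{Des}(\mathrm{w}_{\rm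 Y}(T))))}$. DIRT: let $\beta$ be a composition of $n$ and $Q$ a filling of $D(\beta)$ with $1,\dots,n$, each once. A row strip of $Q$ is a maximal sequence $a_1,\dots,a_m$ of consecutive integers such that for $1\le i<m$ the entry $a_{i}+1$ lies in a column strictly to the right of the column of $a_i$ in $Q$. The row strip shape of $Q$ is the composition of $n$ whose $i$th part is the length of the $i$th row strip (row strips ordered by increasing entries). $Q$ is a dual immaculate recording tableau (DIRT) of shape $\beta$ if: (1) rows increase from left to right; (2) every row strip starts in the first (leftmost) column; (3) the first column strictly increases from top to bottom; (4) whenever $i<j$, $(k,j)\in D(\beta)$ and $Q_{k,j}>Q_{k,i}$, then $Q_{k,j}>Q_{k+1,i}$, where an empty box in row $i$ (i.e. a box not in $D(\beta)$) is regarded as containing $\infty$. $\mathrm{DIRT}(\beta,\alpha)$ is the set of DIRTs of shape $\beta$ with row strip shape $\alpha$. *)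

(* Defs.v *)
From mathcomp Require Import all_boot all_order all_algebra.
From mathcomp Require Import finmap multiset.

Set Implicit Arguments.
Unset Strict Implicit.
Unset Printing Implicit Defensive.

Local Open Scope nat_scope.

Definition is_composition (n : nat) (a : seq nat) : bool :=
  all (leq 1) a && (sumn a == n).

(* All parts, except possibly the last, exceed 1; this is combined with
   [is_composition] or with enumeration in [compositions n]. *)
Definition is_peak (a : seq nat) : bool := all (leq 2) (take (size a).-1 a).

(* A composition of m.+1 either starts with a part 1 followed by a composition
   of m, or is a composition of m > 0 with its first part increased by 1. *)
Fixpoint compositions (n : nat) : seq (seq nat) :=
  match n with
  | 0 => [:: [::]]
  | m.+1 => [seq 1 :: a | a <- compositions m] ++
            [seq (head 0 a).+1 :: behead a | a <- compositions m & a != [::]]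
  end.

Lemma mem_compositions (n : nat) (a : seq nat) :
  (a \in compositions n) = is_composition n a.
Proof.
rewrite /is_composition; elim: n a => [|n IHn] a.
  by rewrite /= inE; case: a => [|[|p] a] //=; rewrite addSn andbF.
rewrite /= mem_cat; apply/orP/andP => [[]|].
- case/mapP=> b; rewrite IHn => /andP[posb /eqP sumb] ->; split=> //=.
  by rewrite sumb.
- case/mapP=> -[|p b]; rewrite mem_filter //= IHn.
  by move=> /andP[/= /andP[_ posb] sumb] ->; split.
case: a => [|[|[|p]] a] [] //= posa suma.
- left; apply/mapP; exists a => //; rewrite IHn; apply/andP; split=> //.
right; apply/mapP; exists (p.+1 :: a) => //.
by rewrite mem_filter /= IHn; apply/andP; split.
Qed.

Lemma compositions_uniq n : uniq (compositions n).
Proof.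
elim: n => //= n IHn; rewrite cat_uniq; apply/and3P; split.
- by rewrite map_inj_uniq // => a b [].
- apply/hasPn=> _ /mapP[b + ->]; rewrite mem_filter mem_compositions.
  case: b => [|p b] //= /andP[/= /andP[pos_p _] _].
  by apply/mapP=> -[c _ [p0 _]]; rewrite p0 in pos_p.
rewrite map_inj_in_uniq ?filter_uniq // => -[|p a] [|q b];
  by rewrite !mem_filter //= => _ _ [-> ->].
Qed.

Definition comp_set (g : seq nat) : seq nat :=
  [seq sumn (take i g) | i <- iota 1 (size g).-1].

(* I is meant to be an increasing list of elements of {1, ..., n - 1}. For n = 0
   this is [:: 0], which [comp_set] and [sumn] do not distinguish from [::]. *)
Definition set_comp (n : nat) (I : seq nat) : seq nat :=
  pairmap (fun a b => b - a) 0 (rcons I n).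

(* A monomial in x_1, x_2, ... is the finite multiset of the indices of its
   variables; a formal power series is the family of its coefficients. *)
Definition monomial : Type := {mset nat}%mset.
Definition power_series : Type := monomial -> int.

(* The sequences i_1, ..., i_n such that x_{i_1} ... x_{i_n} = m are the
   rearrangements of m, listed without repetition by [permutations]. *)
Definition fundamental_qsym (g : seq nat) : power_series := fun m =>
  Posz (count (fun s => [&& size s == sumn g, all (leq 1) s, sorted leq s
                          & all (fun j => nth 0 s j.-1 < nth 0 s j) (comp_set g)])
              (permutations (enum_mset m))).

Definition peak_function (g : seq nat) : power_series := fun m =>
  let I := comp_set g in
  let shift_diff b i :=
    (i \in comp_set b) (+) (i \in [seq j.+1 | j <- comp_set b]) in
  (2 ^+ (size I).+1 *
    \sum_(b <- compositions (sumn g) | all (shift_diff b) I)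
       fundamental_qsym b m)%R.

(* A box (i, j) lies in column i and row j, both numbered from 1, rows being
   numbered from bottom to top. *)
Definition diagram (a : seq nat) : seq (nat * nat) :=
  [seq (i, j) | j <- iota 1 (size a), i <- iota 1 (nth 0 a j.-1)].

(* A filling is the list of its rows, from bottom to top. *)
Definition filling : Type := seq (seq nat).

Definition fillings (a : seq nat) : seq filling :=
  [seq reshape a w | w <- permutations (iota 1 (sumn a))].

Lemma mem_fillings (a : seq nat) (T : filling) :
  (T \in fillings a) = (shape T == a) && perm_eq (flatten T) (iota 1 (sumn a)).
Proof.
apply/mapP/andP => [[w]|[/eqP <- pT]].
  rewrite mem_permutations => pw ->.
  have sw : size w = sumn a by rewrite (perm_size pw) size_iota.
  by rewrite reshapeKl ?sw // reshapeKr ?sw.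
by exists (flatten T); rewrite ?flattenK ?mem_permutations.
Qed.

Lemma fillings_uniq a : uniq (fillings a).
Proof.
rewrite map_inj_in_uniq ?permutations_uniq // => v w.
rewrite !mem_permutations => pv pw eq_vw.
have sv : size v = sumn a by rewrite (perm_size pv) size_iota.
have sw : size w = sumn a by rewrite (perm_size pw) size_iota.
by rewrite -(@reshapeKr _ a v) ?sv // -(@reshapeKr _ a w) ?sw // eq_vw.
Qed.

(* Only meaningful for a box c of the diagram of T. *)
Definition entry (T : filling) (c : nat * nat) : nat :=
  nth 0 (nth [::] T c.2.-1) c.1.-1.

Definition box_of (T : filling) (e : nat) : nat * nat :=
  let D := diagram (shape T) in
  nth (0, 0) D (find (fun c => entry T c == e) D).

(* The entries of column i >= 1, from bottom to top. *)
Definition column (T : filling) (i : nat) : seq nat :=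
  [seq nth 0 r i.-1 | r <- T & i <= size r].

Definition num_columns (T : filling) : nat := \max_(r <- T) size r.

Definition rows_increasing (T : filling) : bool := all (sorted ltn) T.

Definition column1_increasing (T : filling) : bool := sorted ltn (column T 1).

(* Boxes with entries <= k are k in number, so it is enough to look for their
   shape g among the compositions of k. *)
Definition peak_tableau_condition (T : filling) : bool :=
  let D := diagram (shape T) in
  all (fun k =>
         has (fun g => is_peak g &&
                perm_eq [seq c <- D | entry T c <= k] (diagram g))
             (compositions k))
      (iota 1 (sumn (shape T))).

Definition SPIT (a : seq nat) : seq filling :=
  [seq T <- fillings a | [&& rows_increasing T, column1_increasing T
                           & peak_tableau_condition T]].

(* c = (k, j) and d = (k + 1, i). *)
Definition composition_tableau_condition (T : filling) : bool :=
  let D := diagram (shape T) in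
  all (fun c => all (fun d =>
         [&& d.1 == c.1.+1, d.2 < c.2 & entry T c <= entry T d] ==>
         ((c.1.+1, c.2) \in D) && (entry T (c.1.+1, c.2) < entry T d)) D) D.

Definition SYCT (a : seq nat) : seq filling :=
  [seq T <- fillings a | [&& rows_increasing T, column1_increasing T
                           & composition_tableau_condition T]].

Definition SPYCT (a : seq nat) : seq filling :=
  [seq T <- SYCT a | peak_tableau_condition T].

Definition word_c (T : filling) : seq nat :=
  flatten [seq column T i | i <- iota 1 (num_columns T)].

Definition word_Y (T : filling) : seq nat :=
  rev (column T 1) ++
  flatten [seq column T i | i <- iota 2 (num_columns T).-1].

Definition descents (w : seq nat) : seq nat :=
  [seq i <- iota 1 (size w).-1 | index i.+1 w < index i w].

Definition peaks (X : seq nat) : seq nat :=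
  [seq i <- X | (1 < i) && (i.-1 \notin X)].

Definition quasi_schur_Q (a : seq nat) : power_series := fun m =>
  (\sum_(T <- SPIT a)
     peak_function (set_comp (sumn a) (peaks (descents (word_c T)))) m)%R.

Definition peak_Young_quasi_schur (a : seq nat) : power_series := fun m =>
  (\sum_(T <- SPYCT a)
     peak_function (set_comp (sumn a) (peaks (descents (word_Y T)))) m)%R.

(* The integers a, ..., b are entries of Q, and for a <= e < b the entry e + 1
   lies in a column strictly to the right of that of e. *)
Definition row_run (Q : filling) (a b : nat) : bool :=
  [&& 1 <= a, a <= b, b <= sumn (shape Q)
    & all (fun e => (box_of Q e).1 < (box_of Q e.+1).1) (iota a (b - a))].

(* Runs are closed under subintervals, so a run is maximal when it cannot be
   extended by one entry at either end. *)
Definition is_row_strip (Q : filling) (a b : nat) : bool :=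
  [&& row_run Q a b, ~~ row_run Q a.-1 b & ~~ row_run Q a b.+1].

(* The pairs (first entry, last entry), by increasing entries. *)
Definition row_strips (Q : filling) : seq (nat * nat) :=
  let E := iota 1 (sumn (shape Q)) in
  [seq s <- [seq (a, b) | a <- E, b <- E] | is_row_strip Q s.1 s.2].

Definition row_strip_shape (Q : filling) : seq nat :=
  [seq (s.2 - s.1).+1 | s <- row_strips Q].

Definition strips_start_in_column1 (Q : filling) : bool :=
  all (fun s => (box_of Q s.1).1 == 1) (row_strips Q).

Definition column1_decreasing (Q : filling) : bool := sorted gtn (column Q 1).

(* c = (k, j). As an empty box (k, i) or (k + 1, i) contains infinity, the
   hypothesis Q_{k,j} > Q_{k,i} forces (k, i) to be a box of Q, and likewise
   the conclusion Q_{k,j} > Q_{k+1,i} forces (k + 1, i) to be one. *)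
Definition recording_condition (Q : filling) : bool :=
  let D := diagram (shape Q) in
  let gt_box x d := (d \in D) && (entry Q d < x) in
  all (fun c => all (fun i =>
         gt_box (entry Q c) (c.1, i) ==> gt_box (entry Q c) (c.1.+1, i))
       (iota 1 c.2.-1)) D.

Definition is_DIRT (Q : filling) : bool :=
  [&& rows_increasing Q, strips_start_in_column1 Q, column1_decreasing Q
    & recording_condition Q].

Definition DIRT (b a : seq nat) : seq filling :=
  [seq Q <- fillings b | is_DIRT Q && (row_strip_shape Q == a)].

(* Main.v *)
(* A peak immaculate tableau is a word in its row indices.  A Young composition
   tableau is a word in column indices, its rows being forced: an entry of
   column l is added to the topmost row of length l - 1.  A row strip of a
   recording tableau is a set of columns: removing an entry of column k takes
   it from the lowest row of length k.  The operators [up l] and [down k] on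
   compositions commute, except when one of the two composites is undefined,
   where the other one is the identity.  These exceptions occur at the ends of
   the runs of consecutive row lengths, and pairing the end of a run with the
   beginning of the next one gives a local rule that moves an added box through
   a row strip.  Applying it to the entries of T in increasing order, one row
   of T after the other, is a growth diagram version of the insertion of Allen,
   Hallam and Mason; it maps T to a composition tableau and a recording tableau
   and turns the descents of the reading of T by rows, from top to bottom, into
   descents of w_Y.  It also respects the peak condition: as soon as the bottom
   row has length 2, the strip only changes lengths of rows that are at least 2
   and stay so.
   The reading by rows and w_c have equidistributed descents on SPIT: sorting
   the entries inside blocks for one order instead of the other only exchanges
   consecutive entries in columns >= 3, on which the tableau conditions only
   prescribe the order along rows. *)

Require Import Defs.
From mathcomp Require Import all_boot all_order all_algebra.
From mathcomp Require Import zify.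

Set Implicit Arguments.
Unset Strict Implicit.
Unset Printing Implicit Defensive.

Import GRing.Theory.
Local Open Scope nat_scope.

(** * Adding and removing boxes *)

(* [lia] is very slow in the presence of boolean hypotheses. *)
Ltac nlia :=
  repeat match goal with
  | H : ?P |- _ =>
      lazymatch P with
      | is_true (leq _ _) => fail
      | @eq ?T _ _ => first [unify T nat; fail 1 | clear H]
      | not (@eq ?T _ _) => first [unify T nat; fail 1 | clear H]
      | is_true (eq_op _ _) => fail
      | is_true (negb (eq_op _ _)) => fail
      | _ => clear H
      end
  end; lia.

(** The induction removes the bottom row, of length [a], from the shape alpha. The induction
    hypothesis replaces the upper rows by a column word; the entries of the bottom row are kept as
    moves [None] shuffled into it, and the growth pushes the result through a strip that is empty at
    the start. At the end the strip and the bottom row of the new shape have [a] boxes together.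
    They form the last row strip of the recording tableau, which explains the reversal in
    [rev alpha]. The identity [sits_upaths] obtained in this way concerns an arbitrary function [g]
    of the truth value of the peak condition and of the list of descent bits. The induction asks for
    this generality: its hypothesis is applied to the sum of [g] over all patterns of interleaving,
    and the peak condition for all rows is the one for the upper rows together with one bit of the
    pattern. Bijectivity comes one step at a time: over a fixed shape, the local rule is injective
    and surjective from pairs (strip, move) to pairs (output, next strip). *)

Fixpoint cnt (j : nat) (s : seq nat) : nat :=
  if s is x :: s' then (x == j) + cnt j s' else 0.

(** A box in column 1 opens a new top row and is always allowed; this is why [up 1] runs to the end
    of the list. *)
Definition can_up (l : nat) (s : seq nat) := (l == 1) || (1 < l) && (l.-1 \in s).

(* Adds a box in column l; meaningful only if [can_up l s]. *)
Fixpoint up (l : nat) (s : seq nat) : seq nat :=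
  if s is r :: s' then if can_up l s' then r :: up l s' else l :: s' else [:: 1].

(* Removes the last box of the lowest row of length k; meaningful only if
   [k \in s]. *)
Fixpoint down (k : nat) (s : seq nat) : seq nat :=
  if s is r :: s' then if r == k then k.-1 :: s' else r :: down k s' else [::].

Notation downs S s := (foldr down s S).

Lemma cntE j s : cnt j s = count_mem j s.
Proof. by elim: s => //= x s ->. Qed.

Lemma mem_count (x : nat) s : (x \in s) = (0 < cnt x s).
Proof. by rewrite cntE -has_pred1 has_count. Qed.

Lemma can_up_gt0 l s : can_up l s -> 0 < l.
Proof. by case: l. Qed.

(** Membership in modified shapes is decided throughout by counting rows of a given length, which
    leaves linear arithmetic. A new row comes from length 0, hence the restriction to [0 < j]. *)
Lemma count_up (l : nat) s (j : nat) : can_up l s -> 0 < j ->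
  cnt j (up l s) + (l.-1 == j) = cnt j s + (l == j).
Proof.
move=> + j0; elim: s => [|r s IHs] /=.
  rewrite /can_up in_nil andbF orbF => /eqP-> /=. nlia.
case: ifP => [cu _ | ncu cu] /=; first by move: (IHs cu); nlia.
move: ncu cu; rewrite /can_up inE; case: (l == 1) => //=.
case: (leqP l 1) => //= l1 -> /=; rewrite orbF => /eqP ->; nlia.
Qed.

Lemma count_down (k : nat) s (j : nat) : k \in s ->
  cnt j (down k s) + (k == j) = cnt j s + (k.-1 == j).
Proof.
elim: s => //= r s IHs; rewrite inE; case: (eqVneq r k) => [-> _ | rk] /=.
  nlia.
by move=> /= /IHs; nlia.
Qed.

(* For k = l both sides exchange the lowest row of length l with the topmost
   row of length l - 1 if the former is below the latter, and else change
   nothing. *)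
Lemma down_up k l s : 1 < k -> k \in s -> can_up l s -> can_up l (down k s) ->
  down k (up l s) = up l (down k s).
Proof.
move=> k1; elim: s => //= r s IHs; rewrite inE.
have cuc t x : can_up l (x :: t) = can_up l t || (1 < l) && (x == l.-1).
  by rewrite /can_up inE; case: (l == 1) => //=; case: (1 < l); rewrite //= orbC eq_sym.
case: (boolP (can_up l s)) => [cus | ncus] /=.
  case: (eqVneq r k) => [-> _ _ _ | rk] /=; first by rewrite cus.
  move=> /= ks _; rewrite cuc.
  case: (boolP (can_up l (down k s))) => /= [cud _ | ncud /andP[l1 rl]].
    by rewrite IHs.
  have k_l : k = l.-1.
    move: cus ncud (count_down l.-1 ks); rewrite /can_up; case: (l == 1) => //=.
    by rewrite l1 /= !mem_count; nlia.
  by case/eqP: rk; rewrite k_l; apply/eqP.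
rewrite cuc (negPf ncus) /=; case: (eqVneq r k) => [-> _ | rk] /=.
  case/andP=> l1 /eqP kl; rewrite cuc (negPf ncus) l1 /= kl => /eqP; nlia.
move=> ks /andP[l1 /eqP rl]; rewrite cuc => _; case: eqP => [lk | lk].
  move: {IHs} k1 ks rk; rewrite -{k}lk => _ ks rk.
  have -> : can_up l (down l s).
    by rewrite /can_up l1 mem_count; move: (count_down l.-1 ks); nlia.
  rewrite rl; congr (_ :: _); move: ncus ks; rewrite {rl rk}.
  elim: s => //= x s IHs; rewrite cuc negb_or inE => /andP[ncs].
  case: (eqVneq x l) => [-> /= _ _ | xk /= xk1 ks].
    by rewrite (negPf ncs).
  suff -> : can_up l (down l s) by rewrite -IHs.
  by rewrite /can_up l1 mem_count; move: (count_down l.-1 ks); nlia.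
suff -> : can_up l (down k s) = false by [].
move: ncus (count_down l.-1 ks); rewrite /can_up l1 !mem_count.
by case: (l == 1) => //=; nlia.
Qed.

(** Here [up k s] is undefined: the row just shortened is the only one that [up k] can lengthen. *)
Lemma up_down k s : 1 < k -> k \in s -> k.-1 \notin s -> up k (down k s) = s.
Proof.
move=> k1; elim: s => //= r s IHs; rewrite !inE negb_or.
have cu t : can_up k t = (k.-1 \in t).
  by rewrite /can_up k1; case: eqP => //; nlia.
case: (eqVneq r k) => [-> _ /andP[_ ks] | rk] /=.
  by rewrite cu (negPf ks).
move=> /= ks /andP[_ k's]; rewrite cu.
by rewrite mem_count; move: (count_down k.-1 ks); rewrite eqxx; case: ltnP; [rewrite IHs | nlia].
Qed.

(** Here [down l s] is undefined: the row just lengthened is the only one of length [l]. *)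
Lemma down_upK l s : 1 < l -> l.-1 \in s -> l \notin s -> down l (up l s) = s.
Proof.
move=> l1; elim: s => //= r s IHs; rewrite !inE negb_or.
have cu t : can_up l t = (l.-1 \in t).
  by rewrite /can_up l1; case: eqP => //; nlia.
rewrite cu; case: (boolP (l.-1 \in s)) => /= [l's _ | l's].
  by case/andP=> lr ls; rewrite eq_sym (negPf lr) IHs.
by rewrite orbF eqxx => /eqP->.
Qed.

(* S lists the columns of the entries of the last row strip outside of the
   bottom row, which has length b; s is the shape of the other rows.  The
   removal of the box of column k, after those in the columns > k of S, is
   possible if there is a row of length k in s or one shortened to k. *)
Definition strip (b : nat) (S : seq nat) (s : seq nat) :=
  sorted ltn S && all (fun k => (b < k) && ((k \in s) || (k.+1 \in S))) S.

Lemma stripP b S s : reflect (sorted ltn S /\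
    forall k, k \in S -> b < k /\ ((k \in s) || (k.+1 \in S))) (strip b S s).
Proof.
apply: (iffP andP) => -[sS hS]; split=> //.
  by move=> k /(allP hS) /andP[].
by apply/allP=> k /hS [-> ->].
Qed.

Lemma strip_cons b k S s : strip b (k :: S) s ->
  [/\ strip k S s, b < k, k \notin S & (k \in s) || (k.+1 \in S)].
Proof.
case/stripP=> /= pS hS; have /= aS := order_path_min ltn_trans pS.
split.
- apply/stripP; split=> [|j jS]; first exact: path_sorted pS.
  have kj : k < j := allP aS j jS.
  have := hS j; rewrite !inE jS orbT => /(_ isT) [_ b0].
  split=> //; case: (j.+1 =P k) b0 => //= jk; nlia.
- by case: (hS k); rewrite ?mem_head.
- by apply/negP=> /(allP aS) /=; rewrite ltnn.
by case: (hS k); rewrite ?mem_head // inE; case: (k.+1 =P k) => //=; nlia.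
Qed.

Lemma strip_weaken b b' S s : b' <= b -> strip b S s -> strip b' S s.
Proof.
move=> bb' /stripP[sS hS]; apply/stripP; split=> // k /hS[bk ->].
by split=> //; apply: leq_ltn_trans bk.
Qed.

(** Each column [k] of the strip turns a row of length [k] into one of length [k.-1]; the changes
    telescope. *)
Lemma count_downs (b : nat) (S : seq nat) s (j : nat) : 0 < b -> strip b S s ->
  cnt j (downs S s) + (j \in S) = cnt j s + (j.+1 \in S).
Proof.
move=> b0; elim: S b b0 j => //= k S IHS b b0 j /strip_cons[sS bk kS ks].
have k0 : 0 < k by nlia.
have IH i := IHS _ k0 i sS.
have kD : k \in downs S s.
  by move: ks (IH k); rewrite (negPf kS) (mem_count k s) (mem_count k (downs S s)); case: (k.+1 \in S); nlia.
move: (count_down j kD) (IH j); rewrite !inE.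
case: (j =P k) => [-> | jk] /=.
  by rewrite (negPf kS) eqxx; case: (k.+1 =P k) => /=; nlia.
case: (j.+1 =P k) => [jk1 | jk1] /=; last by case: eqP; case: eqP; nlia.
have -> : (j.+1 \in S) = false by rewrite jk1 (negPf kS).
by rewrite -jk1 /= eqxx; case: (j.+1 =P j) => /=; nlia.
Qed.

Lemma mem_downs_hd b k S s : 0 < b -> strip b (k :: S) s -> k \in downs S s.
Proof.
move=> b0 /strip_cons[sS bk kS ks]; have k0 : 0 < k by nlia.
by move: ks (count_downs k k0 sS); rewrite (negPf kS) (mem_count k s) (mem_count k (downs S s)); case: (k.+1 \in S); nlia.
Qed.

Lemma can_upE l s : 1 < l -> can_up l s = (0 < cnt l.-1 s).
Proof. by move=> l1; rewrite /can_up l1 mem_count; case: eqP l1 => // ->. Qed.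

(** Iterates [down_up] along the strip. The two hypotheses on [l] exclude the exceptional cases;
    that the box can be added at every intermediate shape follows by counting rows of length
    [l.-1]. *)
Lemma downs_up b S s l : 0 < b -> strip b S s -> (l \in S -> can_up l s) ->
  can_up l (downs S s) -> can_up l s /\ downs S (up l s) = up l (downs S s).
Proof.
move=> b0; elim: S b b0 => //= k S IHS b b0 bS lS cu.
have kD := mem_downs_hd b0 bS; have [sS bk kS _] := strip_cons bS.
have k0 : 0 < k by nlia.
have cuS : can_up l (downs S s).
  case: (leqP l 1) => l1; first by move: cu; rewrite /can_up; case: ltnP l1 => // _ _ /orP[->|].
  move: cu (count_down l.-1 kD) lS; rewrite !can_upE // inE.
  case: (l =P k) => [lk /= _ _ /(_ isT) ls | lk]; last by case: eqP; nlia.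
  have := count_downs l.-1 k0 sS; suff -> : (l.-1 \in S) = false by nlia.
  by apply/negP=> /(proj2 (stripP _ _ _ sS)); nlia.
have [cus eqS] := IHS k k0 sS (fun h => lS (@mem_behead _ (k :: S) _ h)) cuS.
by split; rewrite // eqS down_up //; nlia.
Qed.

(** A strip column [k] that is not a row length of [s] needs a row shortened from [k.+1], so the
    strip continues upwards until it meets a row of [s]. *)
Lemma strip_chain b S s y z : strip b S s -> y \in S -> y <= z ->
  (forall r, r \in s -> y <= r -> z <= r) -> z \in S.
Proof.
move=> /stripP[_ hS] yS yz hz; rewrite -(subnKC yz).
have: z - y <= z - y by [].
move: {-2}(z - y) => d; elim: d => [|d IHd] dz; first by rewrite addn0.
have /hS[_ /orP[]] := IHd (ltnW dz); last by rewrite addnS.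
by move=> /hz; nlia.
Qed.

Fixpoint below (l : nat) (s : seq nat) : nat :=
  if s is r :: s' then if r < l then maxn r (below l s') else below l s' else 0.

Lemma below_lt l s : 0 < l -> below l s < l.
Proof. by move=> l0; elim: s => //= r s IHs; case: ifP => //; rewrite gtn_max IHs => ->. Qed.

Lemma le_below l s r : r \in s -> r < l -> r <= below l s.
Proof.
elim: s => //= x s IHs; rewrite inE => /orP[/eqP <- rl | rs rl].
  by rewrite rl leq_maxl.
by case: ifP => _; rewrite ?leq_max IHs ?orbT.
Qed.

Lemma mem_below l s b : b \in s -> b < l -> below l s \in s.
Proof.
elim: s b => //= x s IHs b; rewrite inE.
have [xl | lx] := ltnP x l; last first.
  by case: (b =P x) => [-> | _ /=]; [nlia | move=> bs /(IHs _ bs); rewrite inE => ->; rewrite orbT].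
case: (boolP (has (fun c => c < l) s)) => [/hasP[c cs cl] _ _ | /hasPn nh _ _].
  by have := IHs _ cs cl; rewrite /maxn inE; case: ifP; rewrite ?eqxx // => _ ->; rewrite orbT.
suff -> : below l s = 0 by rewrite maxn0 mem_head.
elim: s {IHs} nh => //= c s IHs nh; rewrite ifN ?nh ?mem_head // IHs // => d ds.
by rewrite nh // inE ds orbT.
Qed.

Arguments below : simpl never.

(* A move [None] stands for an entry of the bottom row of the immaculate
   tableau, [Some l] for a box added in column l of the shape given by its upper
   rows.  [None] behaves like a box added in the column following all others. *)
Definition move_bound (s : seq nat) (m : option nat) : nat :=
  if m is Some l then l else (foldr maxn 0 s).+1.

Lemma lim_None s r : r \in s -> r < move_bound s None.
Proof.
rewrite /= ltnS; elim: s => //= x s IHs; rewrite inE leq_max.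
by case/orP=> [/eqP-> | /IHs ->]; rewrite ?leqnn ?orbT.
Qed.

(* The box of column l cannot be exchanged with the removal of a box of column l
   when s has no row of length l - 1.  It is then added to the longest row
   shorter than l instead and, unless this is the bottom row, its new column
   replaces l in the strip. *)
Definition special_move (S s : seq nat) (m : option nat) : bool :=
  if m is Some l then (l \in S) && (l.-1 \notin s) else true.

Definition valid_move (S s : seq nat) (m : option nat) : bool :=
  if m is Some l then can_up l (downs S s) else true.

Definition output (b : nat) (S s : seq nat) (m : option nat) : nat :=
  if special_move S s m then (below (move_bound (b :: s) m) (b :: s)).+1 else odflt 0 m.

Definition next_strip (b : nat) (S s : seq nat) (m : option nat) : seq nat :=
  if special_move S s m then
    let l := output b S s m in
    [seq k <- S | k < l] ++
      (if l.-1 \in s then [:: l] else [::]) ++ [seq k <- S | move_bound (b :: s) m < k]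
  else S.

(** * Moving a box through a strip *)

Lemma sorted_split (l : nat) S : sorted ltn S -> l \in S ->
  S = [seq k <- S | k < l] ++ l :: [seq k <- S | l < k].
Proof.
move=> sS lS; apply: (@irr_sorted_eq _ ltn) => //; [exact: ltn_trans|exact: ltnn| |].
  rewrite sorted_pairwise; last exact: ltn_trans.
  rewrite pairwise_cat pairwise_cons; move: sS; rewrite sorted_pairwise; last exact: ltn_trans.
  move=> sS; rewrite !pairwise_filter // !andbT; apply/andP; split.
    apply/allrelP => x y; rewrite mem_filter inE mem_filter => /andP[xl _].
    by case/orP=> [/eqP->|/andP[ly _]] //=; apply: ltn_trans ly.
  by apply/allP=> y; rewrite mem_filter => /andP[].
move=> k; rewrite mem_cat inE !mem_filter.
by case: (ltngtP k l) => [||->]; rewrite ?orbF.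
Qed.

(** By [strip_chain], a strip column beyond all rows would be followed by infinitely many others. *)
Lemma strip_lim b S s k : strip b S s -> k \in S -> k < move_bound (b :: s) None.
Proof.
move=> bS kS; rewrite ltnNge; apply/negP=> Lk.
have := @strip_chain b S s k (maxn k (move_bound S None)) bS kS (leq_maxl _ _).
have -> : (maxn k (move_bound S None) \in S) = false.
  by apply/negP=> /lim_None; nlia.
suff nr r : r \in s -> k <= r -> maxn k (move_bound S None) <= r by move=> /(_ nr).
by move=> rs; have := @lim_None (b :: s) r; rewrite inE rs orbT => /(_ isT); nlia.
Qed.

Lemma strip_catl b S1 S2 s : 0 < b -> strip b (S1 ++ S2) s -> strip b S2 s ->
  strip b S1 (downs S2 s).
Proof.
move=> b0 /stripP[]; rewrite sorted_pairwise ?pairwise_cat; last exact: ltn_trans.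
case/and3P=> /allrelP lt12 p1 p2 h1 b2; apply/stripP.
rewrite sorted_pairwise; last exact: ltn_trans.
split=> // k k1; have := h1 k; rewrite !mem_cat k1 => /(_ isT) [-> hk]; split=> //.
have /negbTE k2 : k \notin S2 by apply/negP=> /(lt12 _ _ k1) /=; rewrite ltnn.
move: hk (count_downs k b0 b2); rewrite k2 (mem_count k s) (mem_count k (downs S2 s)).
by case: (_ \in S1); case: (_ \in S2); rewrite ?orbT // !orbF; nlia.
Qed.

Lemma strip_catr b S1 S2 s : strip b (S1 ++ S2) s -> strip b S2 s.
Proof.
case/stripP; rewrite sorted_pairwise ?pairwise_cat; last exact: ltn_trans.
case/and3P=> /allrelP lt12 p1 p2 h1; apply/stripP.
rewrite sorted_pairwise; last exact: ltn_trans.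
split=> // k k2; have := h1 k; rewrite !mem_cat k2 orbT => /(_ isT) [-> hk]; split=> //.
by move: hk; case: (boolP (k.+1 \in S1)) => //= /lt12 /(_ k2) /=; nlia.
Qed.

(** * Special moves: the box cannot pass through the strip *)

Section SpecialMove.

Variables (b : nat) (S s : seq nat) (m : option nat).
Hypotheses (b0 : 0 < b) (bS : strip b S s) (vm : valid_move S s m) (spm : special_move S s m).

Let L := move_bound (b :: s) m.
Let x := below L (b :: s).

Lemma special_lt_lim : b < L.
Proof.
rewrite /L; move: spm vm; case: m => [l|] /=; last by rewrite ltnS leq_maxl.
by case/andP=> lS _ _; case/stripP: bS => _ /(_ _ lS) [].
Qed.

Lemma special_below : b <= x < L.
Proof.
have bL := special_lt_lim.
by rewrite le_below ?mem_head //= below_lt //; nlia.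
Qed.

Lemma special_max r : r \in b :: s -> r < L -> r <= x.
Proof. exact: le_below. Qed.

Lemma special_mem : x \in b :: s.
Proof. by apply: mem_below special_lt_lim; apply: mem_head. Qed.

(** A strip column strictly between [x] and [L] would continue up to [L]. For [None] this
    contradicts [strip_lim]; for [Some l] the strip would contain [l.-1] and [l] while [s] has no
    row of length [l.-1], so its removal would leave no row for the box. *)
Lemma special_strip k : k \in S -> k < L -> k <= x.
Proof.
move=> kS kL; rewrite leqNgt; apply/negP=> xk.
have nr r : r \in s -> k <= r -> L <= r.
  move=> rs kr; rewrite leqNgt; apply/negP=> rL.
  by have := @special_max r; rewrite inE rs orbT => /(_ isT rL); nlia.
move: (spm) (vm) kL nr; rewrite /L; case: m => [l|] spl vl kL nr; last first.
  by have := strip_lim bS (strip_chain bS kS (ltnW kL) nr); rewrite ltnn.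
rewrite /= in spl vl kL nr; move: spl vl.
case/andP=> lS ls; rewrite can_upE; last by nlia.
have l'S : l.-1 \in S.
  apply: (strip_chain bS kS); first by nlia.
  by move=> r rs /(nr _ rs); nlia.
by move: ls (count_downs l.-1 b0 bS); rewrite mem_count l'S prednK ?lS; nlia.
Qed.

Let S1 := [seq k <- S | k < x.+1].
Let S2 := [seq k <- S | L < k].

Lemma special_split : S = S1 ++ (if m is Some l then [:: l] else [::]) ++ S2.
Proof.
have eqS1 : S1 = [seq k <- S | k < L].
  apply: eq_in_filter => k kS; have := special_strip kS; have := special_below.
  by rewrite ltnS; nlia.
rewrite eqS1 /S2; move: spm; rewrite /L; case: m => [l /andP[lS _] | _].
  by apply: sorted_split lS; case/stripP: bS.
have -> : [seq k <- S | move_bound (b :: s) None < k] = [::].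
  by apply/eqP; rewrite -(negbK (_ == _)) -has_filter; apply/hasPn=> k /(strip_lim bS); nlia.
by rewrite !cats0; apply/esym/all_filterP/allP => k /(strip_lim bS).
Qed.

Lemma special_stripr : strip b S2 s.
Proof. by move: bS; rewrite {1}special_split => /strip_catr /strip_catr. Qed.

(** The added box in column [l] moves past the columns in [S1] and then cancels the removal in
    column [l], by [up_down]. *)
Lemma special_target :
  (if m is Some l then up l (downs S s) else downs S s) = downs S1 (downs S2 s).
Proof.
have eqS := special_split; move: spm vm eqS; case: m => [l|] /= spl vl eqS; last first.
  by rewrite {1}eqS foldr_cat.
case/andP: spl => lS ls.
have b2 : strip b (l :: S2) s by apply: (@strip_catr _ S1); rewrite -eqS.
have b1 : strip b S1 (downs (l :: S2) s) by apply: strip_catl; rewrite -?eqS.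
have [_ bl lS2 _] := strip_cons b2.
rewrite {1}eqS foldr_cat; case: (@downs_up b S1 (downs (l :: S2) s) l) => //.
- move=> l1; move: bS => /stripP[]; rewrite {1}eqS.
  rewrite sorted_pairwise ?pairwise_cat; last exact: ltn_trans.
  by case/andP=> /allrelP/(_ l l l1 (mem_head _ _)) /=; rewrite ltnn.
- by rewrite -foldr_cat -eqS.
move=> _ <- /=; rewrite up_down //; first by nlia.
  exact: mem_downs_hd b2.
rewrite mem_count; move: ls (count_downs l.-1 b0 special_stripr).
by rewrite mem_count prednK ?(negPf lS2); nlia.
Qed.

Let S' := S1 ++ (if x \in s then [:: x.+1] else [::]) ++ S2.

(** These are the conditions for [down_upK] in column [x.+1] once the columns in [S2] have been
    removed. *)
Lemma special_fresh : x \in s -> x.+1 \notin s /\ x.+2 \notin S2.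
Proof.
move=> xs; have [box_at xL] := andP special_below.
have x's : x.+1 < L -> x.+1 \notin s.
  move=> x'L; apply/negP=> x's.
  by have := @special_max x.+1; rewrite inE x's orbT => /(_ isT x'L); nlia.
have [x'L | Lx'] := ltnP x.+1 L.
  by split; [exact: x's | rewrite mem_filter; nlia].
(* If [L = x.+1], a move [Some L] would be special only without a row of length [L.-1 = x] in
   [s]. *)
have mN : m = None.
  case em: m => [l|] //; have Ll : L = l by rewrite /L em.
  by move: spm; rewrite em /= (_ : l.-1 = x) ?xs ?andbF //; nlia.
have LN : L = move_bound (b :: s) None by rewrite /L mN.
split.
  apply/negP=> x's'; have := @lim_None (b :: s) x.+1.
  by rewrite inE x's' orbT -LN => /(_ isT); nlia.
by rewrite mem_filter; apply/negP=> /andP[_ /(strip_lim bS)]; rewrite -LN; nlia.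
Qed.

(** If [x] is a row of [s], the box added in column [x.+1] is taken away again by the new strip
    column [x.+1]. Otherwise [x] is the bottom row, which absorbs the box, and [S1] is empty. *)
Lemma special_next :
  let s' := if x \in s then up x.+1 s else s in
  let b' := if x \in s then b else b.+1 in
  [/\ up x.+1 (b :: s) = b' :: s', can_up x.+1 (b :: s), strip b' S' s'
    & downs S' s' = downs S1 (downs S2 s)].
Proof.
have [box_at xL] := andP special_below; have x'1 : 1 < x.+1 by nlia.
have b2 := special_stripr.
have cu t : can_up x.+1 t = (x \in t) by rewrite can_upE // mem_count.
have sS : sorted ltn S by case/stripP: bS.
have sub2 k : k \in S2 -> x.+1 < k by rewrite mem_filter; nlia.
move: special_fresh; rewrite /= !cu special_mem /S'; case: ifP => [xs /(_ isT) [x's x2]|xs _].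
  have h1 : x.+1 \in S2 -> can_up x.+1 s by move/sub2; rewrite ltnn.
  have xD : x \in downs S2 s.
    rewrite mem_count; have := count_downs x b0 b2.
    have -> : x \in S2 = false by apply/negP=> /sub2; nlia.
    by move: xs; rewrite mem_count; nlia.
  have h2 : can_up x.+1 (downs S2 s) by rewrite cu.
  have [_ eq2] := downs_up b0 b2 h1 h2; split=> //; last first.
    rewrite foldr_cat /= eq2 down_upK //=.
    by rewrite mem_count; have := count_downs x.+1 b0 b2; move: x's; rewrite mem_count (negPf x2); nlia.
  have cux : can_up x.+1 s by rewrite cu.
  have cup k : 0 < k -> k != x -> k \in s -> k \in up x.+1 s.
    by move=> k0 kx; rewrite !mem_count; have := count_up cux k0; nlia.
  apply/stripP; split.
    rewrite sorted_pairwise; last exact: ltn_trans.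
    have pS : pairwise ltn S by rewrite -sorted_pairwise //; apply: ltn_trans.
    rewrite !pairwise_cat !(pairwise_filter _ pS) allrel_catr /= !andbT -!andbA.
    apply/and3P; split; apply/allrelP => y z.
    - by rewrite mem_filter inE => /andP[yx _] /eqP->.
    - by rewrite mem_filter => /andP[yx _] /sub2; apply: ltn_trans.
    - by rewrite inE => /eqP-> /sub2.
  have [_ hS] := stripP _ _ _ bS.
  move=> k; rewrite !mem_cat !inE !mem_filter.
  case/or3P=> [/andP[kx kS] | /eqP-> | /andP[Lk kS]].
  - have [bk hk] := hS k kS; split=> //; rewrite ltnS in kx.
    case: (k =P x) => [-> | /eqP kx']; first by rewrite eqxx !orbT.
    case/orP: hk => [/cup -> // | kS1]; first by nlia.
    by rewrite kS1 ltnS; apply/orP; right; apply/orP; left; nlia.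
  - split; first by nlia.
    by rewrite mem_count; have := count_up cux (ltn0Sn x); move: x's; rewrite mem_count /=; nlia.
  have [bk hk] := hS k kS; split=> //.
  case/orP: hk => [/cup -> // | ->]; first by nlia.
    by nlia.
  by apply/orP; right; apply/or3P; apply: Or33; nlia.
have xb : x = b by move: special_mem; rewrite inE xs orbF => /eqP.
have S1e : S1 = [::].
  apply/eqP; rewrite -(negbK (_ == _)) -has_filter; apply/hasPn=> k kS.
  by have [_ hS] := stripP _ _ _ bS; have [] := hS k kS; nlia.
rewrite S1e cat0s /=; split=> //; first by rewrite xb.
have [_ hS] := stripP _ _ _ b2; apply/stripP; split; first by case/stripP: b2.
by move=> k kS; have [_ ->] := hS k kS; split=> //; move/sub2: kS; nlia.
Qed.

End SpecialMove.

(** * One step of the growth and its effect on descents *)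

Lemma strip_up b S s l : 0 < b -> strip b S s -> (l \in S -> can_up l s) ->
  can_up l (downs S s) -> strip b S (up l s).
Proof.
move=> b0 bS lS cu; have [cus _] := downs_up b0 bS lS cu.
have [sS hS] := stripP _ _ _ bS; apply/stripP; split=> // k kS.
have [bk hk] := hS k kS; split=> //; case/orP: hk => [ks | ->]; last by rewrite orbT.
case: (boolP (k.+1 \in S)) => [_ | k'S]; first by rewrite orbT.
rewrite orbF; have k0 : 0 < k by nlia.
move: (ks) (count_up cus k0); rewrite !mem_count; case: (l.-1 =P k) => [lk | _]; last by nlia.
move: cu; have -> : l = k.+1 by nlia.
rewrite can_upE //=.
by have := count_downs k b0 bS; rewrite kS (negPf k'S); case: eqP; nlia.
Qed.

(** The invariant of the growth. The last equation says that the bottom row and the strip together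
    gain one box exactly for a move [None]; it yields the length of the row strip at the end. *)
Lemma step_ok b S s m : 0 < b -> strip b S s -> valid_move S s m ->
  let l := output b S s m in
  exists b' s', [/\ up l (b :: s) = b' :: s', can_up l (b :: s), b <= b',
    strip b' (next_strip b S s m) s' &
    downs (next_strip b S s m) s' = (if m is Some l then up l (downs S s) else downs S s)
    /\ b' + size (next_strip b S s m) = b + size S + (~~ isSome m)].
Proof.
move=> b0 bS vm; rewrite /next_strip /output.
case: (boolP (special_move S s m)) => spm /=.
  have [] := special_next b0 bS vm spm; set x := below _ _ => /= eup cu st dn.
  exists (if x \in s then b else b.+1), (if x \in s then up x.+1 s else s).
  rewrite eup; split=> //; first by case: (x \in s).
  rewrite dn -(special_target b0 bS vm spm); split=> //.
  rewrite {3}(special_split b0 bS vm spm) -/x !size_cat.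
  have xs := special_mem bS vm spm; rewrite -/x inE in xs.
  by case: m {vm spm eup cu st dn} @x xs => [l|] x xs /=; case: (x \in s) xs => /=; rewrite ?orbF; nlia.
case: m vm spm => // l vm; rewrite /= negb_and negbK => spm.
have lS : l \in S -> can_up l s.
  move=> lS; move: spm; rewrite lS /= can_upE ?mem_count //.
  by have [_ hS] := stripP _ _ _ bS; have := hS l lS; nlia.
have [cus eqd] := downs_up b0 bS lS vm; rewrite cus.
exists b, (up l s); split=> //; last by rewrite eqd; split=> //; nlia.
  by move: cus; rewrite /can_up inE; case: (l == 1) => //= /andP[-> ->]; rewrite orbT.
exact: strip_up.
Qed.

Definition move_descent (m1 m2 : option nat) : bool :=
  match m1, m2 with
  | Some k, Some l => l <= k
  | None, Some _ => true
  | _, None => false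
  end.

Lemma letter_le b S s m : 0 < b -> strip b S s -> valid_move S s m ->
  output b S s m <= move_bound (b :: s) m.
Proof.
move=> b0 bS vm; rewrite /output; case: ifP => spm.
  by have := special_below b0 bS vm spm; nlia.
by case: m spm vm.
Qed.

Lemma mem_up l s : 0 < l -> can_up l s -> l \in up l s.
Proof. by move=> l0 cu; rewrite mem_count; have := count_up cu l0; rewrite eqxx; case: eqP; nlia. Qed.

(** Without a descent, the row of length [l1] just created is shorter than the bound of [m2], so the
    output of [m2] exceeds [l1]. With a descent, the output of [m2 = Some c] is at most [c], and [c]
    can exceed [l1] only if [m1] is special; then validity would require a row of length [c.-1]
    between [x] and the bound of [m1], where [s] has none. *)
Lemma letter_des b S s m1 m2 b' s' : 0 < b -> strip b S s -> valid_move S s m1 ->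
  let l1 := output b S s m1 in let S' := next_strip b S s m1 in
  up l1 (b :: s) = b' :: s' -> valid_move S' s' m2 ->
  (output b' S' s' m2 <= l1) = move_descent m1 m2.
Proof.
move=> b0 bS v1 l1 S' eup v2.
have [b1 [s1 []]] := step_ok b0 bS v1; rewrite -/l1 -/S' eup => -[<- <-] {b1 s1}.
move=> cu1 bb' bS' [dS' _]; have b'0 : 0 < b' by nlia.
have l1s : l1 \in b' :: s' by rewrite -eup mem_up // (can_up_gt0 cu1).
have l1L := letter_le b0 bS v1; rewrite -/l1 in l1L.
have l2L := letter_le b'0 bS' v2.
case: (boolP (move_descent m1 m2)) => d12; last first.
  apply/negbTE; rewrite -ltnNge {1}/output; case: ifP => [_ | n2].
    rewrite ltnS le_below //; case: (m2) d12 => [c | _]; last exact: lim_None.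
    by case: (m1) l1L => //= a l1L; nlia.
  case: (m2) d12 n2 => //= c; case: (m1) l1L => //= a.
  by nlia.
case: m2 d12 v2 l2L => [c | ]; last by case: (m1).
move=> d12 v2 /= l2L; case: (boolP (special_move S s m1)) => sp1; last first.
  have -> : l1 = odflt 0 m1 by rewrite /l1 /output (negPf sp1).
  by case: (m1) sp1 d12 => //= a _; nlia.
have [box_at xL] := andP (special_below b0 bS v1 sp1).
have xmax := @special_max b s m1.
have [] := special_next b0 bS v1 sp1; have fr := special_fresh b0 bS v1 sp1.
set x := below _ _ in box_at xL xmax fr *; set L := move_bound _ _ in xL xmax fr *.
have el1 : l1 = x.+1 by rewrite /l1 /output sp1.
have eS' : S' = [seq k <- S | k < x.+1] ++ (if x \in s then [:: x.+1] else [::]) ++ [seq k <- S | L < k].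
  by rewrite /S' /next_strip sp1 -/l1 el1.
move: (eup); rewrite {1}el1 => -> [_ es'] _ _ _.
have cL : c \in S -> c <= L.
  move=> cS; move: d12; rewrite /L; case: (m1) => //= _.
  by have := strip_lim bS cS; rewrite /=; nlia.
case: (leqP c x.+1) => [|xc]; first by move: l2L; rewrite el1 /=; nlia.
have csL : c.-1 \in s -> c.-1 < L.
  move=> cs; move: d12; rewrite /L; case: (m1) => //=.
    by move=> a; nlia.
  by move=> _; apply: (@lim_None (b :: s)); rewrite inE cs orbT.
have cS' : c \notin S'.
  rewrite eS' !mem_cat !mem_filter; apply/negP=> /or3P[/andP[] | | /andP[Lc /cL]]; try by nlia.
  by case: ifP => //; rewrite inE; nlia.
have [cus' _] := downs_up b'0 bS' (fun h => False_ind _ (negP cS' h)) v2.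
exfalso; move: cus'; rewrite can_upE -?mem_count; last by nlia.
(* The new row of length [x.+1] does not help for [c = x.+2]: the strip contains column [x.+1] and
   shortens it again. *)
case: (c =P x.+2) => [ec | nc].
  case: ifP es' => [xs | xs] es'; last first.
    rewrite es' => cs; have := @xmax c.-1; rewrite inE cs orbT => /(_ isT (csL cs)); nlia.
  have [x's x2] := fr xs; rewrite ec /= => _.
  have := count_downs x.+1 b'0 bS'; move: v2; rewrite /= ec can_upE //=.
  have x'S : x.+1 \in S' by rewrite eS' xs !mem_cat inE eqxx !orbT.
  rewrite x'S -{1}ec (negPf cS').
  have cux : can_up x.+1 s by rewrite can_upE -?mem_count //; nlia.
  have := count_up cux (ltn0Sn x); rewrite -es' eqxx; move: x's; rewrite mem_count.
  by case: eqP; nlia.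
move=> cs'; have cs : c.-1 \in s.
  move: cs'; rewrite es'; case: ifP => // xs; rewrite !mem_count.
  have cux : can_up x.+1 s by rewrite can_upE -?mem_count //; nlia.
  have c0 : 0 < c.-1 by nlia.
  by have := count_up cux c0; nlia.
by have := @xmax c.-1; rewrite inE cs orbT => /(_ isT (csL cs)); nlia.
Qed.

(** * Invertibility of the local rule *)

Lemma special_stripE b S s m : special_move S s m -> let x := below (move_bound (b :: s) m) (b :: s) in
  output b S s m = x.+1 /\ next_strip b S s m =
  [seq k <- S | k < x.+1] ++ (if x \in s then [:: x.+1] else [::]) ++
    [seq k <- S | move_bound (b :: s) m < k].
Proof. by move=> sp /=; rewrite /next_strip /output sp. Qed.

(** A smaller bound [L] of [m] would lie in [S] and start a chain up to the bound [K] of [n]. Then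
    [K] survives in the next strip of [S], but it never occurs in that of [T]. *)
Lemma step_inj_special b S T s m n : 0 < b -> strip b S s -> valid_move S s m ->
    strip b T s -> valid_move T s n -> special_move S s m -> special_move T s n ->
  output b S s m = output b T s n -> next_strip b S s m = next_strip b T s n ->
  ~ move_bound (b :: s) m < move_bound (b :: s) n.
Proof.
move=> b0 bS vm bT vn sm sn.
have [-> ->] := special_stripE b sm; have [-> ->] := special_stripE b sn.
have [box_at xL] := andP (special_below b0 bS vm sm).
have [_ yL] := andP (special_below b0 bT vn sn).
have ymax := @special_max b s n.
set x := below _ _ in box_at xL *; set y := below _ _ in yL ymax *.
set L := move_bound _ _ in xL *; set K := move_bound _ _ in yL ymax *.
move=> [xy]; rewrite {}xy in xL *; move=> eqS LK.
have LS : L \in S.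
  move: LK; rewrite /L /K; case: (m) sm => [l /andP[]//|_].
  case: (n) sn => [l /andP[lT _]|_]; last by rewrite ltnn.
  by move=> LK; have := strip_lim bT lT; rewrite /= in LK *; nlia.
have KS : K \in S.
  apply: (strip_chain bS LS (ltnW LK)) => r rs Lr; rewrite leqNgt; apply/negP=> rK.
  by have := @ymax r; rewrite inE rs orbT => /(_ isT rK); nlia.
have : K \in [seq k <- T | K < k].
  have KE : K \in [seq k <- S | L < k] by rewrite mem_filter LK.
  have : K \in [seq k <- T | k < y.+1] ++
    (if y \in s then [:: y.+1] else [::]) ++ [seq k <- T | K < k].
    by rewrite -eqS !mem_cat KE !orbT.
  rewrite !mem_cat mem_filter => /or3P[/andP[] | | //]; first by nlia.
  by case: ifP => // _; rewrite inE => /eqP K1; move: LK; rewrite K1; nlia.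
by rewrite mem_filter ltnn.
Qed.

(** A special step on a row of [s] leaves a strip that contains [x.+1] but not [x.+2], while [s] has
    no row of length [x.+1]. A non-special step would have had this strip on [s] before the box was
    added, which is impossible. *)
Lemma step_inj_mixed b S T s m n : 0 < b -> strip b S s -> valid_move S s m ->
    strip b T s -> valid_move T s n -> ~~ special_move S s m -> special_move T s n ->
  output b S s m = output b T s n -> next_strip b S s m = next_strip b T s n -> False.
Proof.
move=> b0 bS vm bT vn sm sn; have [-> ->] := special_stripE b sn.
have fr := special_fresh b0 bT vn sn.
have [box_at xL] := andP (special_below b0 bT vn sn).
set x := below _ _ in box_at xL fr *; set L := move_bound _ _ in xL fr *.
rewrite /output /next_strip (negPf sm); case: m vm sm => //= l cu sm lx eS.
have lS : l \in S -> can_up l s.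
  move=> lS; move: sm; rewrite lS negbK can_upE ?mem_count //.
  by have [_ hS] := stripP _ _ _ bS; have := hS l lS; nlia.
have [] := downs_up b0 bS lS cu; rewrite lx => cus _.
have xs : x \in s by rewrite mem_count -[x]/(x.+1.-1) -can_upE //; nlia.
have [x's x2] := fr xs; rewrite xs /= in eS.
have x'S : x.+1 \in S by rewrite eS mem_cat inE eqxx orbT.
have [_ hS] := stripP _ _ _ bS; have [_] := hS _ x'S.
rewrite (negPf x's) /= eS mem_cat inE (negPf x2) mem_filter.
by case: eqP => [|_]; nlia.
Qed.

Lemma step_inj b S T s m n : 0 < b -> strip b S s -> valid_move S s m ->
    strip b T s -> valid_move T s n ->
  output b S s m = output b T s n -> next_strip b S s m = next_strip b T s n ->
  S = T /\ m = n.
Proof.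
move=> b0 bS vm bT vn el es.
case: (boolP (special_move S s m)) (boolP (special_move T s n)) => sm [] sn.
- have ltL : move_bound (b :: s) m = move_bound (b :: s) n.
    have h1 := step_inj_special b0 bS vm bT vn sm sn el es.
    have h2 := step_inj_special b0 bT vn bS vm sn sm (esym el) (esym es).
    by case: (ltngtP (move_bound (b :: s) m) (move_bound (b :: s) n)) => // [/h1|/h2].
  have emn : m = n.
    move: ltL sm sn; case: (m) => [k|]; case: (n) => [l|] //.
    - by move=> /= ->.
    - by move=> /= kL /andP[kS _] _; have := strip_lim bS kS; rewrite kL ltnn.
    - by move=> /= lL _ /andP[lT _]; have := strip_lim bT lT; rewrite -lL ltnn.
  split=> //; rewrite (special_split b0 bS vm sm) (special_split b0 bT vn sn).
  have [e1 e2] := special_stripE b sm; have [e3 e4] := special_stripE b sn.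
  move: es; rewrite e2 e4 -!emn; have [_ xL] := andP (special_below b0 bS vm sm); set x := below _ _ in xL * => eqS.
  (* The next strip determines the old one below [x.+1] and above the bound; what lies in between is
     fixed by the move, by [special_split]. *)
  have lowE (U : seq nat) : 
     [seq k <- [seq k <- U | k < x.+1] ++ (if x \in s then [:: x.+1] else [::]) ++
        [seq k <- U | move_bound (b :: s) m < k] | k < x.+1] = [seq k <- U | k < x.+1].
    rewrite !filter_cat filter_id -[RHS]cats0; congr (_ ++ _).
    have -> : [seq k <- [seq k <- U | move_bound (b :: s) m < k] | k < x.+1] = [::].
      by rewrite -filter_predI -(filter_pred0 U); apply: eq_filter => k /=; nlia.
    by case: ifP => // _ /=; rewrite ltnn.
  have highE (U : seq nat) : 
     [seq k <- [seq k <- U | k < x.+1] ++ (if x \in s then [:: x.+1] else [::]) ++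
        [seq k <- U | move_bound (b :: s) m < k] | move_bound (b :: s) m < k] =
     [seq k <- U | move_bound (b :: s) m < k].
    rewrite !filter_cat filter_id.
    have -> : [seq k <- [seq k <- U | k < x.+1] | move_bound (b :: s) m < k] = [::].
      by rewrite -filter_predI -(filter_pred0 U); apply: eq_filter => k /=; nlia.
    by case: ifP => //= _; case: ltnP => //; nlia.
  have eqlow := lowE T; rewrite -eqS lowE in eqlow.
  have eqhigh := highE T; rewrite -eqS highE in eqhigh.
  by rewrite eqlow eqhigh.
- by case: (step_inj_mixed b0 bT vn bS vm sn sm).
- by case: (step_inj_mixed b0 bS vm bT vn sm sn).
move: el es; rewrite /output /next_strip (negPf sm) (negPf sn).
by case: m sm {vm} => // k _; case: n sn {vn} => //= l _ -> ->.
Qed.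

Lemma step_surj_special b s l (S1 S2 : seq nat) : 0 < b -> 1 < l -> l.-1 \in b :: s ->
    b < l -> 
    strip b (S1 ++ (if l.-1 \in s then [:: l] else [::]) ++ S2) (if l.-1 \in s then up l s else s) ->
    all (fun k => k < l) S1 -> all (ltn l) S2 ->
    (if l.-1 \in s then (l.+1 \notin S2) && (l \notin s) else S1 == [::]) ->
  exists S m, [/\ strip b S s, valid_move S s m, output b S s m = l &
    next_strip b S s m = S1 ++ (if l.-1 \in s then [:: l] else [::]) ++ S2].
Proof.
move=> b0 l1 ls bl; set S' := _ ++ _ ++ _; set s' := (if _ then up _ _ else _).
move=> bS' /allP lt1 /allP lt2 hl.
have [sS' hS'] := stripP _ _ _ bS'.
have pS' : pairwise ltn S' by rewrite -sorted_pairwise //; apply: ltn_trans.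
have [p12 p1 p2] : [/\ allrel ltn S1 S2, pairwise ltn S1 & pairwise ltn S2].
  move: pS'; rewrite !pairwise_cat allrel_catr -!andbA.
  by case/and5P=> _ -> -> _ /andP[_ ->].
have low : [seq k <- S1 | k < l] = S1 by apply/all_filterP/allP.
have low2 : [seq k <- S2 | k < l] = [::].
  by apply/eqP; rewrite -(negbK (_ == _)) -has_filter; apply/hasPn=> k /lt2 /=; nlia.
have cups k : l != k -> k \in s' -> k \in s.
  rewrite /s'; case: ifP => // l's lk.
  have: can_up l s by rewrite can_upE -?mem_count.
  elim: (s) => [|r t IHt] /=; first by rewrite /can_up in_nil andbF orbF => /eqP el; exfalso; nlia.
  rewrite !inE; case: ifP => [cu _ | _ _]; rewrite inE.
    by case/orP=> [-> // | /IHt -> //]; rewrite orbT.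
  by rewrite eq_sym (negPf lk) /= => ->; rewrite orbT.
have val1 k : k \in S1 -> (k \in s) || (k.+1 \in S1).
  move=> k1; have := hS' k; rewrite mem_cat k1 => /(_ isT) [bk hk].
  have kl := lt1 k k1; have nlk : l != k by nlia.
  case/orP: hk => [/(cups _ nlk) -> // | ].
  rewrite !mem_cat => /or3P[->|| /lt2 /=]; rewrite ?orbT //; last by nlia.
  by case: ifP => // l's; rewrite inE => /eqP kl'; move: l's; rewrite -kl' /= => ->.
have val2 k : k \in S2 -> (k \in s) || (k.+1 \in S2).
  move=> k2; have := hS' k; rewrite !mem_cat k2 !orbT => /(_ isT) [bk hk].
  have kl := lt2 k k2; rewrite /= in kl; have nlk : l != k by nlia.
  case/orP: hk => [/(cups _ nlk) -> // | ].
  case/or3P => [/lt1 || ->]; rewrite ?orbT //; first by nlia.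
  by case: ifP => // l's; rewrite inE => /eqP kl'; nlia.
have bk1 k : k \in S1 -> b < k by move=> k1; have [] := hS' k; rewrite ?mem_cat ?k1.
have bk2 k : k \in S2 -> b < k by move=> /lt2 /=; nlia.
(* Without rows of length at least [l] the step comes from [None], and [S2] is empty because its
   chains would have no row to end at. *)
case: (boolP (has (leq l) s)) => [|/hasPn nr]; last first.
  have nr' r : r \in s -> r < l by move/nr; rewrite -ltnNge.
  have e2 : S2 = [::].
    case: S2 {p12 p2 S' bS' sS' hS' pS' low2 hl bk2} lt2 val2 => // k S2 lt2 val2.
    have ch d : k + d \in k :: S2.
      elim: d => [|d IHd]; first by rewrite addn0 mem_head.
      case/orP: (val2 _ IHd); last by rewrite addnS.
      by move=> /nr'; have /= := lt2 _ IHd; nlia.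
    by have := lim_None (ch (move_bound (k :: S2) None)); nlia.
  have bS1 : strip b S1 s.
    apply/stripP; split=> [|k k1]; first by rewrite sorted_pairwise //; apply: ltn_trans.
    by split; [exact: bk1 | exact: val1].
  have xE : below (move_bound (b :: s) None) (b :: s) = l.-1.
    apply/eqP; rewrite eqn_leq le_below ?lim_None // andbT.
    have := mem_below (mem_head b s) (lim_None (mem_head b s)).
    by rewrite inE => /orP[/eqP -> | /nr'] ; [nlia | rewrite -[X in X < l -> _]/(below (move_bound (b :: s) None) (b :: s)); move: (below _ _) => z; nlia].
  exists S1, None; split=> //.
    by rewrite /output /special_move xE prednK //; nlia.
  rewrite /next_strip /output /special_move xE prednK; last by nlia.
  rewrite low /S' e2; congr (_ ++ (_ ++ _)).
  by rewrite -(filter_pred0 S1); apply: eq_in_filter => k /(strip_lim bS1) kL /=; rewrite ltnNge ltnW.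
move=> hr; have exr : exists r, (r \in s) && (l <= r).
  by case/hasP: hr => r rs lr; exists r; rewrite rs.
(* Let [r] be the shortest row length that is at least [l]. The move to recover is the largest
   column [L] from [l] to [r] outside [S2]: it is [r] itself or lies just below the chain of [S2]
   that ends at [r]. *)
case: (ex_minnP exr) => r /andP[rs lr] minr {hr exr}.
have exL : exists y, [&& l <= y, y <= r & y \notin S2].
  by exists l; rewrite leqnn lr; apply/negP=> /lt2 /=; rewrite ltnn.
have ubL y : [&& l <= y, y <= r & y \notin S2] -> y <= r by case/and3P.
case: (ex_maxnP exL ubL) => L /and3P[lL Lr LS2] maxL {exL ubL}.
have gap k : k \in s -> l <= k -> L <= k.
  by move=> ks lk; apply: leq_trans (minr k _); rewrite ?ks.
have S2L k : k \in S2 -> L < k.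
  move=> k2; rewrite ltnNge; apply/negP=> kL.
  have ch d : d <= L - k -> k + d \in S2.
    elim: d => [|d IHd] dL; first by rewrite addn0.
    case/orP: (val2 _ (IHd (ltnW dL))) => [|]; last by rewrite addnS.
    by move/gap; have /= := lt2 _ k2; nlia.
  by have := ch _ (leqnn _); rewrite subnKC // (negPf LS2).
have valL : (L \in s) || (L.+1 \in S2).
  case: (L =P r) => [-> | nLr]; first by rewrite rs.
  apply/orP; right; apply/negPn/negP=> L'; have := maxL L.+1; rewrite L' andbT.
  by nlia.
have ll : l.-1 \in s -> l < L.
  move=> l's; move: hl; rewrite l's => /andP[l'2 nls]; apply: maxL; rewrite l'2 leqnSn andbT.
  by rewrite ltn_neqAle lr andbT; apply: contraNneq nls => ->.
pose S := S1 ++ L :: S2.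
have sS : sorted ltn S.
  rewrite sorted_pairwise; last exact: ltn_trans.
  rewrite pairwise_cat allrel_consr p12 p1 /= p2 !andbT; apply/andP; split.
    by apply/allP=> k /lt1 kl; apply: leq_trans lL.
  by apply/allP=> k /S2L.
have bS : strip b S s.
  apply/stripP; split=> // k; rewrite !mem_cat !inE.
  case/or3P=> [k1 | /eqP -> | k2].
  - by split; [apply: bk1 | case/orP: (val1 k k1) => ->; rewrite ?orbT].
  - by split; [nlia | case/orP: valL => ->; rewrite ?orbT].
  by split; [apply: bk2 | case/orP: (val2 k k2) => ->; rewrite ?orbT].
have LS : L \in S by rewrite mem_cat mem_head orbT.
have L'S : L.-1 \notin S.
  rewrite mem_cat inE !negb_or; apply/and3P; split; last by apply/negP=> /S2L; nlia.
    case: (boolP (l.-1 \in s)) hl => [/ll lL' _ | _ /eqP -> //].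
    by apply/negP=> /lt1; nlia.
  by nlia.
have L's : L.-1 \notin s.
  case: (boolP (l.-1 \in s)) => [/ll lL' | l's].
    by apply/negP=> /gap; nlia.
  case: (L =P l) => [-> // | nLl]; apply/negP=> /gap; nlia.
have sp : special_move S s (Some L) by rewrite /special_move LS L's.
have xE : below (move_bound (b :: s) (Some L)) (b :: s) = l.-1.
  apply/eqP; rewrite eqn_leq; apply/andP; split; last by apply: le_below => //=; nlia.
  have bL : b < L by nlia.
  have h1 : below L (b :: s) < L by apply: below_lt; nlia.
  rewrite -[move_bound _ _]/L; have := mem_below (mem_head b s) bL.
  move: (below L (b :: s)) h1 => z h1; rewrite inE => /orP[/eqP -> | /gap]; first by nlia.
  by case: (leqP l z) => [? /(_ isT) | ]; nlia.
exists S, (Some L); split=> //.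
- rewrite /valid_move can_upE; last by nlia.
  have := count_downs L.-1 b0 bS; rewrite (negPf L'S) prednK ?LS; last by nlia.
  by nlia.
- by rewrite /output sp xE prednK //; nlia.
rewrite /next_strip sp /output sp xE prednK; last by nlia.
rewrite /S' /S !filter_cat /= ltnn low low2.
have -> : [seq k <- S1 | L < k] = [::].
  by rewrite -(filter_pred0 S1); apply: eq_in_filter => k /lt1 kl /=; rewrite ltnNge ltnW // (leq_trans kl).
have -> : [seq k <- S2 | L < k] = S2 by apply/all_filterP/allP=> k /S2L.
by rewrite ltnNge lL /= cats0.
Qed.

Lemma step_surj b s l b' s' S' : 0 < b -> can_up l (b :: s) ->
    up l (b :: s) = b' :: s' -> strip b' S' s' ->
  exists S m, [/\ strip b S s, valid_move S s m, output b S s m = l & next_strip b S s m = S'].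
Proof.
(* A box that falls on the bottom row has [l = b.+1] and comes from a special move, with no strip
   column below [l]. *)
move=> b0 cu; rewrite /=; case: ifP => cus [<- <-] bS'; last first.
  have l1 : 1 < l by move: cu cus; rewrite /can_up; case: eqP => //= _ /andP[].
  have bl : b = l.-1.
    by move: cu cus; rewrite !can_upE //=; case: (b =P l.-1) => //=; nlia.
  have ls : (l.-1 \in s) = false by move: cus; rewrite can_upE // -mem_count.
  have [_ hS] := stripP _ _ _ bS'.
  have := @step_surj_special b s l [::] S' b0 l1; rewrite ls /= inE -bl eqxx => H.
  apply: H => //; first by nlia.
    by apply: strip_weaken bS'; nlia.
  by apply/allP=> k /hS[].
have [sS hS] := stripP _ _ _ bS'.
(* By [special_fresh] these three conditions are the trace of a special move that lengthened a row
   of [s]. *)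
case: (boolP [&& l \in S', l \notin s & l.+1 \notin S']) => [/and3P[lS ls l'S]|].
  have [bl _] := hS _ lS; have l1 : 1 < l by nlia.
  have l's : l.-1 \in s by move: cus; rewrite can_upE // -mem_count.
  rewrite (sorted_split sS lS); have := @step_surj_special b s l _ _ b0 l1.
  rewrite inE l's orbT => H; apply: (H _ _ isT) => //.
  - by rewrite -sorted_split.
  - by apply/allP=> k; rewrite mem_filter => /andP[].
  - by apply/allP=> k; rewrite mem_filter => /andP[].
  by rewrite ls andbT mem_filter negb_and l'S orbT.
rewrite !negb_and !negbK => nsp; exists S', (Some l).
have l0 := can_up_gt0 cus.
have nspl : special_move S' s (Some l) = false.
  rewrite /special_move; case: (boolP (l \in S')) => //= lS; apply/negbTE; rewrite negbK.
  by have [bl _] := hS _ lS; move: cus; rewrite can_upE -?mem_count //; nlia.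
have cu_cnt j : 0 < j -> _ := @count_up l s j cus.
have bS : strip b S' s.
  apply/stripP; split=> // k kS; have [bk hk] := hS k kS; split=> //.
  case/orP: hk => [|->]; last by rewrite orbT.
  have k0 : 0 < k by nlia.
  case: (l =P k) => [lk | lk]; last first.
    move=> ks'; have -> // : k \in s; move: ks' (cu_cnt k k0); rewrite !mem_count.
    by move/eqP/negbTE: lk => ->; nlia.
  by move: nsp; rewrite lk kS.
split; rewrite /output /next_strip ?nspl //.
rewrite /valid_move; case: (leqP l 1) => l1; first by have -> : l = 1 by nlia.
rewrite can_upE //; have := count_downs l.-1 b0 bS; have := cu_cnt l.-1.
have := hS l.-1; move: cus; rewrite can_upE // prednK //.
case: (boolP (l.-1 \in S')) => [_ c1 /(_ isT) [bl h] | _ c1 _]; last by nlia.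
case: (boolP (l \in S')) h => [_ _ | lS]; first by nlia.
by rewrite orbF mem_count => h /(_ _); rewrite eqxx; case: eqP; nlia.
Qed.

(** * Growth along a word *)

Fixpoint column_path (s u : seq nat) : bool :=
  if u is l :: u' then can_up l s && column_path (up l s) u' else true.

Definition add_columns (s u : seq nat) : seq nat := foldl (fun t l => up l t) s u.

Fixpoint peak_columns (s u : seq nat) : bool :=
  is_peak s && (if u is l :: u' then peak_columns (up l s) u' else true).

(* The list s is the shape of the whole composition tableau, S the strip by which
   its upper rows exceed the composition tableau of the upper rows of T. *)
Fixpoint grow (s S : seq nat) (ms : seq (option nat)) : seq nat * seq nat :=
  if ms is m :: ms' then
    let b := head 0 s in let t := behead s in
    let r := grow (up (output b S t m) s) (next_strip b S t m) ms' in
    (output b S t m :: r.1, r.2)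
  else ([::], S).

Definition ins (m : option nat) : bool := ~~ isSome m.

Definition descent_bits (T : Type) (r : rel T) (w : seq T) : seq bool :=
  if w is x :: w' then pairmap r x w' else [::].

Lemma valid_pmap S s m ms : column_path (downs S s) (pmap id (m :: ms)) ->
  valid_move S s m /\ column_path (if m is Some l then up l (downs S s) else downs S s) (pmap id ms).
Proof. by case: m => [l|] //= /andP[]. Qed.

Lemma grow_ok b S s ms : 0 < b -> strip b S s -> column_path (downs S s) (pmap id ms) ->
  let r := grow (b :: s) S ms in
  column_path (b :: s) r.1 /\
  exists b' s', [/\ add_columns (b :: s) r.1 = b' :: s', 0 < b', strip b' r.2 s',
    downs r.2 s' = add_columns (downs S s) (pmap id ms)
    & b' + size r.2 = b + size S + count ins ms].
Proof.
move=> b0; elim: ms b s S b0 => [|m ms IHms] b s S b0 bS.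
  by move=> _; split=> //; exists b, s; split=> //=; rewrite addn0.
move=> /valid_pmap[vm ups'] /=.
have [b' [s' [eup cu bb' bS' [dS' sz]]]] := step_ok b0 bS vm.
rewrite -/(up (output b S s m) (b :: s)) eup cu.
have b'0 : 0 < b' by nlia.
have [|-> [b1 [s1 [e1 b10 bS1 d1 sz1]]]] := IHms b' s' _ b'0 bS'; first by rewrite dS'.
split=> //; exists b1, s1; split=> //.
- by rewrite d1 dS'; case: (m).
- by rewrite sz1 sz /ins; nlia.
Qed.

Lemma grow_des b S s m ms : 0 < b -> strip b S s ->
    column_path (downs S s) (pmap id (m :: ms)) ->
  descent_bits (fun x y => y <= x) (grow (b :: s) S (m :: ms)).1 = descent_bits move_descent (m :: ms).
Proof.
elim: ms b s S m => [|n ms IHms] b s S m b0 bS /valid_pmap[vm ums].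
  by [].
have [b' [s' [eup cu bb' bS' [dS' sz]]]] := step_ok b0 bS vm.
have b'0 : 0 < b' by nlia.
rewrite -dS' in ums; have := IHms b' s' _ n b'0 bS' ums.
have [vn _] := valid_pmap ums; have := letter_des b0 bS vm eup vn.
by rewrite /= -/(up (output b S s m) (b :: s)) eup /= => -> ->.
Qed.

Lemma grow_inj b S T s ms ns : 0 < b -> strip b S s -> strip b T s ->
    column_path (downs S s) (pmap id ms) -> column_path (downs T s) (pmap id ns) ->
  grow (b :: s) S ms = grow (b :: s) T ns -> S = T /\ ms = ns.
Proof.
elim: ms b s S T ns => [|m ms IHms] b s S T [|n ns] //= b0 bS bT.
  by move=> _ _ [].
move=> /valid_pmap[vm um] /valid_pmap[vn un].
have [b' [s' [eup cu bb' bS' [dS' sz]]]] := step_ok b0 bS vm.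
have [b1 [s1 [eup1 cu1 bb1 bT1 [dT1 sz1]]]] := step_ok b0 bT vn.
rewrite -!/(up _ (b :: s)) eup eup1 => -[el e1 e2].
move: eup1; rewrite -el eup => -[eb es]; rewrite -eb -es in e1 e2 bT1 dT1.
have b'0 : 0 < b' by nlia.
have [|||eS ->] := IHms b' s' _ _ ns b'0 bS' bT1.
- by rewrite dS'.
- by rewrite dT1.
- by rewrite (surjective_pairing (grow _ _ ms)) e1 e2 -surjective_pairing.
by have [-> ->] := step_inj b0 bS vm bT vn el eS.
Qed.

(** The strip is given at the end of the word, so the steps are undone from the last letter to the
    first. *)
Lemma grow_surj b s u b' s' S' : 0 < b -> column_path (b :: s) u ->
    add_columns (b :: s) u = b' :: s' -> strip b' S' s' ->
  exists S ms, [/\ strip b S s, column_path (downs S s) (pmap id ms)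
    & grow (b :: s) S ms = (u, S')].
Proof.
elim: u b s => [|l u IHu] b s b0.
  by move=> _ [<- <-] bS'; exists S', [::].
move=> /=; rewrite -/(up l (b :: s)) -/(can_up l (b :: s)) => /andP[cu uu].
case eup: (up l (b :: s)) uu => [|b1 s1] uu.
  by move: eup; rewrite /=; case: ifP.
have b10 : 0 < b1.
  by move: eup (can_up_gt0 cu); rewrite /=; case: ifP => _ [<- _].
move=> eups bS'; have [S1 [ms [bS1 u1 g1]]] := IHu _ _ b10 uu eups bS'.
have [S [m [bS vm lm sm]]] := step_surj b0 cu eup bS1.
have [b2 [s2 [eup2 _ _ _ [dS2 _]]]] := step_ok b0 bS vm.
exists S, (m :: ms); split=> //; last first.
  by rewrite [LHS]/= -/(up _ (b :: s)) lm sm eup g1.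
move: eup2 dS2; rewrite lm eup sm => -[_ <-] dS2.
by case: (m) vm dS2 => [k|] /= vm dS2; rewrite ?vm -dS2.
Qed.

Lemma is_peakE a : is_peak a = all id (take (size a).-1 (map (leq 2) a)).
Proof. by rewrite /is_peak -map_take all_map. Qed.

Lemma downs_ge2 b S s : 1 < b -> strip b S s -> map (leq 2) (downs S s) = map (leq 2) s.
Proof.
elim: S b => //= k S IHS b b1 /strip_cons[kS bk _ _].
rewrite -(IHS k _ kS); last by nlia.
have : 2 < k by nlia.
elim: (downs S s) => //= r t IHt k2; case: eqP => [-> | _] /=; last by rewrite IHt.
by congr (_ :: _); nlia.
Qed.

Lemma grow_pk b S s ms : 1 < b -> strip b S s -> column_path (downs S s) (pmap id ms) ->
  peak_columns (b :: s) (grow (b :: s) S ms).1 = peak_columns (downs S s) (pmap id ms).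
Proof.
have pk1 c t T : 1 < c -> strip c T t -> is_peak (c :: t) = is_peak (downs T t).
  move=> c1 cT; rewrite !is_peakE -!(size_map (leq 2)) (downs_ge2 c1 cT) /= c1.
  by case: t {cT} => //= r t; rewrite c1.
elim: ms b s S => [|m ms IHms] b s S b1 bS.
  by move=> _; rewrite /= (pk1 _ _ _ b1 bS).
have b0 : 0 < b by nlia.
move=> /valid_pmap[vm um].
have [b' [s' [eup cu bb' bS' [dS' sz]]]] := step_ok b0 bS vm.
have b'1 : 1 < b' by nlia.
rewrite [LHS]/= -/(up _ (b :: s)) eup IHms // ?dS' // (pk1 _ _ _ b1 bS).
case: (m) => [l|] //=; case: (pmap id ms) => [|l u] /=; first by rewrite andbT andbb.
by rewrite andbA andbb.
Qed.

(** * Words and shuffles *)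

Fixpoint words (T : Type) (A : seq T) (n : nat) : seq (seq T) :=
  if n is n'.+1 then [seq x :: w | x <- A, w <- words A n'] else [:: [::]].

Lemma mem_words (T : eqType) (A : seq T) n w :
  (w \in words A n) = (size w == n) && all (mem A) w.
Proof.
elim: n w => [|n IHn] [|x w] //=.
  by apply/allpairsP=> -[[y v] [_ _]].
rewrite eqSS andbCA; apply/allpairsP/andP => [[[y v] /= [yA vW [-> ->]]]|[xA]].
  by rewrite yA -IHn.
by rewrite -IHn => wW; exists (x, w).
Qed.

Lemma words_uniq (T : eqType) (A : seq T) n : uniq A -> uniq (words A n).
Proof.
move=> uA; elim: n => //= n IHn; apply: allpairs_uniq => // -[x w] [y v] _ _ [-> ->] //.
Qed.

(** Row words of standard immaculate tableaux: the letter [size s] opens a new top row. *)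
Fixpoint sit_path (s v : seq nat) : bool :=
  if v is j :: v' then (j <= size s) && sit_path (incr_nth s j) v' else true.

Definition shape_from (s v : seq nat) : seq nat := foldl incr_nth s v.

Fixpoint peak_rows (s v : seq nat) : bool :=
  is_peak s && (if v is j :: v' then peak_rows (incr_nth s j) v' else true).

Definition sit_words (a : seq nat) : seq (seq nat) :=
  [seq v <- words (iota 0 (size a)) (sumn a) | sit_path [::] v && (shape_from [::] v == a)].

Definition column_words (b : seq nat) : seq (seq nat) :=
  [seq u <- words (iota 0 (sumn b).+1) (sumn b) | column_path [::] u && (add_columns [::] u == b)].

Lemma sumn_up l s : can_up l s -> sumn (up l s) = (sumn s).+1.
Proof.
elim: s => [|r s IHs] /=.
  by [].
case: ifP => [cu _ /= | ncu]; first by rewrite IHs // addnS.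
move: ncu; rewrite /can_up inE; case: (l == 1) => //=; case: (ltnP 1 l) => //= l1 ->.
by rewrite orbF => /eqP <-; nlia.
Qed.

Lemma sumn_ups s u : column_path s u -> sumn (add_columns s u) = sumn s + size u.
Proof.
elim: u s => [|l u IHu] s /=; first by rewrite addn0.
by move=> /andP[cu /IHu ->]; rewrite sumn_up // addSnnS.
Qed.

Lemma leq_sumn x s : x \in s -> x <= sumn s.
Proof. by elim: s => //= y s IHs; rewrite inE => /orP[/eqP ->|/IHs]; nlia. Qed.

Lemma upath_le s u : column_path s u -> all (fun l => l <= sumn (add_columns s u)) u.
Proof.
elim: u s => //= l u IHu s /andP[cu uu]; rewrite IHu // andbT.
rewrite sumn_ups // sumn_up //; move: cu; rewrite /can_up => /orP[/eqP ->|/andP[_ /leq_sumn]]; nlia.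
Qed.

Lemma mem_upaths b u : (u \in column_words b) = column_path [::] u && (add_columns [::] u == b).
Proof.
rewrite mem_filter mem_words; case: (boolP (column_path [::] u && (add_columns [::] u == b))) => //.
move=> /andP[uu /eqP ub]; have := sumn_ups uu; have := upath_le uu.
rewrite ub => ul bE; rewrite {1}bE eqxx !andTb.
by apply/allP=> x /(allP ul) xl; suff : x \in iota 0 (sumn b).+1 by []; rewrite mem_iota.
Qed.

Lemma upaths_uniq b : uniq (column_words b).
Proof. by rewrite filter_uniq // words_uniq // iota_uniq. Qed.

Lemma sumn_incr s j : sumn (incr_nth s j) = (sumn s).+1.
Proof.
elim: s j => [|x s IHs] [|j] //=; last by rewrite IHs addnS.
by elim: j => //= j ->.
Qed.

Lemma sumn_sh s v : sumn (shape_from s v) = sumn s + size v.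
Proof. by elim: v s => [|j v IHv] s /=; rewrite ?addn0 // IHv sumn_incr addSnnS. Qed.

Lemma size_sh s v : all (fun j => j < size (shape_from s v)) v /\ size s <= size (shape_from s v).
Proof.
elim: v s => //= j v IHv s; have [-> le] := IHv (incr_nth s j).
by move: le; rewrite andbT size_incr_nth; case: ifP; nlia.
Qed.

Lemma mem_sits a v : (v \in sit_words a) = sit_path [::] v && (shape_from [::] v == a).
Proof.
rewrite mem_filter mem_words; case: (boolP (sit_path [::] v && (shape_from [::] v == a))) => //.
move=> /andP[uv /eqP va]; have := sumn_sh [::] v; have [] := size_sh [::] v.
rewrite va => vl _ aE; rewrite {1}aE eqxx !andTb.
by apply/allP=> x /(allP vl) xl; suff : x \in iota 0 (size a) by []; rewrite mem_iota.
Qed.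

Lemma sits_uniq a : uniq (sit_words a).
Proof. by rewrite filter_uniq // words_uniq // iota_uniq. Qed.

(** The bound on the letters makes the enumeration finite; it is harmless by [strip_lim]. *)
Definition strips (s : seq nat) (a : nat) : seq (seq nat) :=
  if s is b :: t then
    [seq S <- words (iota 0 (move_bound s None)) (a - b) | (b <= a) && strip b S t]
  else [::].

Lemma mem_strips b t a S : (S \in strips (b :: t) a) = strip b S t && (b + size S == a).
Proof.
rewrite mem_filter mem_words; case: (boolP (strip b S t)) => [bS | _]; last by rewrite andbF.
have -> : all (mem (iota 0 (move_bound (b :: t) None))) S.
  by apply/allP=> k /(strip_lim bS) kl; suff : k \in iota 0 (move_bound (b :: t) None) by []; rewrite mem_iota.
by rewrite !andbT /=; case: eqP; case: eqP; nlia.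
Qed.

Lemma strips_uniq s a : uniq (strips s a).
Proof. by case: s => // b t; rewrite filter_uniq // words_uniq // iota_uniq. Qed.

(* The number of recording tableaux of shape b and row strip shape [rev a],
   computed by removing the last row strip. *)
Fixpoint dirt_count (a b : seq nat) : nat :=
  if a is p :: a' then \sum_(S <- strips b p) dirt_count a' (downs S (behead b))
  else (b == [::]).

Fixpoint interleave (pi : seq bool) (w : seq nat) : seq (option nat) :=
  match pi with
  | [::] => [::]
  | true :: pi' => None :: interleave pi' w
  | false :: pi' => Some (head 0 w) :: interleave pi' (behead w)
  end.

(* The descents of an interleaving are determined by the pattern of interleaving
   and the descents of the word; this is what makes the induction on the rows of
   the immaculate tableau work. *)
Fixpoint mix (D pi : seq bool) : seq bool :=
  match pi with
  | p :: ((q :: _) as pi') =>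
      (if p then ~~ q else if q then false else head false D)
        :: mix (if p then D else behead D) pi'
  | _ => [::]
  end.

Lemma pmap_interleave pi w : size w = count negb pi -> pmap id (interleave pi w) = w.
Proof.
elim: pi w => [|[] pi IHpi] w /=; first by case: w.
  by move=> sw; rewrite IHpi.
by case: w => // x w /= [sw]; rewrite IHpi.
Qed.

Lemma ins_interleave pi w : map ins (interleave pi w) = pi.
Proof. by elim: pi w => [|[] pi IHpi] w //=; rewrite IHpi. Qed.

Lemma interleave_ins m : interleave (map ins m) (pmap id m) = m.
Proof. by elim: m => [|[x|] m IHm] //=; rewrite IHm. Qed.

(** One extension serves both kinds of words: [None] is a row below all others for row words and a
    column beyond all others for column words. In both cases it makes a descent before [Some], and
    no descent leads to it. *)
Definition lift_descent (r : rel nat) (x y : option nat) : bool :=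
  match x, y with
  | Some x, Some y => r x y
  | None, Some _ => true
  | _, None => false
  end.

Lemma des_interleave r pi w : size w = count negb pi ->
  descent_bits (lift_descent r) (interleave pi w) = mix (descent_bits r w) pi.
Proof.
elim: pi w => [|p [|q pi] IHpi] w //; first by case: p.
case: p => sw.
  have -> D : mix D [:: true, q & pi] = ~~ q :: mix D (q :: pi) by [].
  by rewrite -(IHpi w sw); case: (q).
case: w sw => [|x w] //; rewrite [count _ _]/= => -[sw].
have -> D : mix D [:: false, q & pi] =
  (if q then false else head false D) :: mix (behead D) (q :: pi) by [].
have -> : behead (descent_bits r (x :: w)) = descent_bits r w by case: (w).
rewrite -(IHpi w sw); case: q {IHpi} sw => // sw.
by case: w sw => [|y w].
Qed.

Lemma big_bij (T1 T2 : eqType) (f : T1 -> T2) (X : seq T1) (Y : seq T2)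
    (F : T1 -> int) (G : T2 -> int) : uniq X -> uniq Y ->
    {in X &, injective f} -> (forall x, x \in X -> f x \in Y) ->
    (forall y, y \in Y -> exists2 x, x \in X & f x = y) ->
    (forall x, x \in X -> F x = G (f x)) ->
  (\sum_(x <- X) F x = \sum_(y <- Y) G y)%R.
Proof.
move=> uX uY injf fXY surj FG.
rewrite (@perm_big _ _ _ _ Y (map f X)).
  by rewrite big_map; apply: eq_big_seq.
apply: uniq_perm => //; first by rewrite map_inj_in_uniq.
move=> y; apply/idP/mapP => [/surj[x xX <-]|[x xX ->]]; [by exists x | exact: fXY].
Qed.

(** The entry 1 always lies in the bottom row, so a pattern begins with [true]. *)
Definition patterns (a n : nat) : seq (seq bool) :=
  [seq true :: p | p <- [seq p <- words [:: true; false] (a.-1 + n) | count id p == a.-1]].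

Lemma mem_pats a n p : 0 < a ->
  (p \in patterns a n) = [&& head false p, count id p == a & count negb p == n].
Proof.
move=> a0; apply/mapP/and3P => [[q]|].
  rewrite mem_filter mem_words => /and3P[/eqP cq /eqP sq _] ->.
  have h : count id q + count negb q = size q := count_predC id q.
  by move: h; rewrite cq sq /= cq => h; split=> //; apply/eqP; nlia.
case: p => [|[] q] [] //= _ /eqP cq /eqP nq; exists q => //.
rewrite mem_filter mem_words; apply/and3P; split; last by apply/allP=> -[].
  by apply/eqP; nlia.
have h : count id q + count negb q = size q := count_predC id q.
by apply/eqP; rewrite -h -nq -cq.
Qed.

Lemma pats_uniq a n : uniq (patterns a n).
Proof. by rewrite map_inj_uniq => [|p q []] //; rewrite filter_uniq // words_uniq. Qed.

Definition shuffles (a n : nat) (W : seq (seq nat)) : seq (seq (option nat)) :=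
  [seq interleave p w | w <- W, p <- patterns a n].

Lemma mem_shuf a n W m : 0 < a -> {in W, forall w, size w = n} ->
  (m \in shuffles a n W) = [&& ins (head (Some 0) m), count ins m == a & pmap id m \in W].
Proof.
move=> a0 sW; apply/allpairsP/and3P => [[[w p] /= [wW]]|[hm cm mW]].
  rewrite mem_pats // => /and3P[hp cp /eqP np] ->.
  rewrite pmap_interleave ?sW // wW; split=> //.
    by case: p {cp np} hp => // -[].
  by rewrite -(count_map ins id) ins_interleave.
exists (pmap id m, map ins m) => /=; rewrite interleave_ins mem_pats // count_map.
split=> //; apply/and3P; split; [by case: (m) hm | exact: cm | ].
rewrite count_map -(sW _ mW) size_pmap; apply/eqP; apply: eq_count => -[x|] //.
Qed.

Lemma shuf_uniq a n W : 0 < a -> {in W, forall w, size w = n} -> uniq W -> uniq (shuffles a n W).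
Proof.
move=> a0 sW uW; apply: allpairs_uniq => //; first exact: pats_uniq.
move=> [w p] [w' p'] /allpairsP[[x q] /= [xW qp [-> ->]]] /allpairsP[[x' q'] /= [xW' qp' [-> ->]]] /= e.
move: qp qp'; rewrite !mem_pats // => /and3P[_ _ /eqP cq] /and3P[_ _ /eqP cq'].
congr (_, _); last by rewrite -(ins_interleave q x) e ins_interleave.
by rewrite -(@pmap_interleave q x) ?e ?pmap_interleave // sW.
Qed.

(** The part of the peak condition that the upper rows do not see: entry 2, if there is one, extends
    the bottom row. *)
Definition second_ins (m : seq (option nat)) : bool := if m is _ :: x :: _ then ins x else true.

Definition second_true (p : seq bool) : bool := if p is _ :: q :: _ then q else true.

Lemma sec_interleave p w : second_ins (interleave p w) = second_true p.
Proof. by case: p => [|[] [|[] p]]. Qed.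

Lemma big_shuf a n W r (K : seq nat -> bool) (g : bool -> seq bool -> int) :
    0 < a -> {in W, forall w, size w = n} ->
  (\sum_(m <- shuffles a n W) g (K (pmap id m) && second_ins m) (descent_bits (lift_descent r) m) =
   \sum_(w <- W) \sum_(p <- patterns a n) g (K w && second_true p) (mix (descent_bits r w) p))%R.
Proof.
move=> a0 sW; rewrite big_allpairs_dep; apply: eq_big_seq => w /sW sw.
apply: eq_big_seq => p; rewrite mem_pats // => /and3P[_ _ /eqP np].
by rewrite pmap_interleave ?sw // sec_interleave des_interleave ?sw.
Qed.

(** * Removing the bottom row of an immaculate tableau *)

Definition code (x : option nat) : nat := if x is Some j then j.+1 else 0.

Lemma sitp_code a s m : sit_path (a :: s) (map code m) = sit_path s (pmap id m).
Proof. by elim: m a s => [|[j|] m IHm] a s //=; rewrite IHm. Qed.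

Lemma sh_code a s m : shape_from (a :: s) (map code m) = a + count ins m :: shape_from s (pmap id m).
Proof. by elim: m a s => [|[j|] m IHm] a s //=; rewrite ?addn0 ?IHm // addSnnS. Qed.

Lemma pkv_code a s m : 1 < a -> peak_rows (a :: s) (map code m) = peak_rows s (pmap id m).
Proof.
have pk1 b t : 1 < b -> is_peak (b :: t) = is_peak t by rewrite /is_peak; case: t => //= c t ->.
have pkk t v : is_peak t && peak_rows t v = peak_rows t v by case: v => [|j v] /=; rewrite ?andbT ?andbA andbb.
elim: m a s => [|[j|] m IHm] a s a1; rewrite [LHS]/= pk1 //= IHm //; last by rewrite ltnW.
Qed.

Lemma code_inj : injective (map code).
Proof. by apply: inj_map => -[x|] [y|] //= [->]. Qed.

Lemma code_surj (v : seq nat) : exists m, map code m = v.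
Proof.
exists [seq if j is j'.+1 then Some j' else None | j <- v]; rewrite -map_comp.
by apply: map_id_in => -[|j].
Qed.

Lemma size_sits a v : v \in sit_words a -> size v = sumn a.
Proof. by rewrite mem_sits => /andP[_ /eqP <-]; rewrite sumn_sh. Qed.

Lemma size_upaths b u : u \in column_words b -> size u = sumn b.
Proof. by rewrite mem_upaths => /andP[uu /eqP <-]; rewrite sumn_ups. Qed.

Lemma sits_cons a s (g : bool -> seq bool -> int) : 0 < a ->
  (\sum_(v <- sit_words (a :: s)) g (peak_rows [::] v) (descent_bits ltn v) =
   \sum_(m <- shuffles a (sumn s) (sit_words s))
      g (peak_rows [::] (pmap id m) && second_ins m) (descent_bits (lift_descent ltn) m))%R.
Proof.
move=> a0; have sS : {in sit_words s, forall w, size w = sumn s} by exact: size_sits.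
apply/esym; apply: (@big_bij _ _ (map code)).
- by rewrite shuf_uniq // sits_uniq.
- exact: sits_uniq.
- by move=> x y _ _; apply: code_inj.
- case=> [|[j|] m]; rewrite mem_shuf // => /and3P[] // _ cm.
  rewrite !mem_sits -[pmap id _]/(pmap id m) /= sitp_code => /andP[-> /eqP sm].
  by rewrite -/(shape_from [:: 1] _) sh_code sm eqseq_cons eqxx andbT.
- move=> v; rewrite mem_sits; case: (code_surj v) => m <-.
  case: m => [|[j|] m] //= ; rewrite -/(shape_from _ (map code m)) sitp_code sh_code.
  rewrite eqseq_cons => /and3P[sm ca sh_m]; exists (None :: m) => //.
  by rewrite mem_shuf //= mem_sits sm ca.
case=> [|[j|] m]; rewrite mem_shuf // => /and3P[] // _ _ _; congr (g _ _).
  rewrite [map _ _]/=; case: m => [|[j|] m] //.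
    by rewrite [second_ins _]/= andbF /=; case: j; case: (map code m).
  by rewrite [RHS]/= pkv_code // andbT.
elim: m (None) => //= x m IHm y; congr (_ :: _); last by [].
by case: y x => [?|] [?|].
Qed.

(** * Expansion at the level of words *)

Lemma all_up l s : can_up l s -> all (leq 1) s -> all (leq 1) (up l s).
Proof.
move=> cu; have l0 := can_up_gt0 cu.
elim: s cu => //= r s IHs; case: ifP => [cu _ | _ _] /andP[r0 h] /=.
  by rewrite r0 IHs.
by rewrite l0.
Qed.

Lemma all_ups s u : column_path s u -> all (leq 1) s -> all (leq 1) (add_columns s u).
Proof. by elim: u s => //= l u IHu s /andP[cu uu] /(all_up cu) /(IHu _ uu). Qed.

Lemma upaths_nil_strip S : strip 1 S [::] -> S = [::].
Proof.
case: S => // k S kS; have := strip_lim kS (mem_head k S).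
by case/strip_cons: kS => _; rewrite /=; nlia.
Qed.

Lemma size_grow s S ms : size (grow s S ms).1 = size ms.
Proof. by elim: ms s S => //= m ms IHms s S; rewrite IHms. Qed.

Lemma count_ins m : count ins m + size (pmap id m) = size m.
Proof. by elim: m => //= -[x|] m /=; rewrite /ins /= => <-; rewrite ?addnS. Qed.

(** The first move is [None] and creates a row of length 1. The growth starts after it, since the
    lemmas on strips need a bottom row of positive length. *)
Definition grow_data (x : seq nat * seq (option nat)) : (seq nat * seq nat) * seq nat :=
  let r := grow [:: 1] [::] (behead x.2) in ((add_columns [:: 1] r.1, r.2), 1 :: r.1).

Definition weak_descent (x y : nat) : bool := y <= x.

Lemma grow_first x m : column_path [::] (pmap id (x :: m)) ->
  grow [:: 1] [::] (x :: m) = if x is Some _ then (1 :: (grow [:: 1; 1] [::] m).1, (grow [:: 1; 1] [::] m).2)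
    else (2 :: (grow [:: 2] [::] m).1, (grow [:: 2] [::] m).2).
Proof. by case: x => [l|] //=; rewrite /can_up in_nil andbF orbF => /andP[/eqP-> _]. Qed.

(** As [grow_pk] needs a bottom row of length at least 2, the second move is treated separately:
    [None] produces such a row, and [Some 1] gives the shape [[:: 1; 1]], which is not peak. *)
Lemma grow_pk1 m : column_path [::] (pmap id m) ->
  peak_columns [::] (pmap id (None :: m)) && second_ins (None :: m) =
  peak_columns [::] (1 :: (grow [:: 1] [::] m).1).
Proof.
case: m => [|x m] // um; rewrite grow_first //; case: x um => [l|] um.
  by rewrite [second_ins _]/= andbF; case: (grow _ _ m).1.
by rewrite [second_ins _]/= andbT -(@grow_pk 2 [::] [::] m isT isT um).
Qed.

Lemma grow_des1 m : column_path [::] (pmap id m) ->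
  descent_bits (lift_descent weak_descent) (None :: m) = descent_bits weak_descent (1 :: (grow [:: 1] [::] m).1).
Proof.
case: m => [|x m] // um; have := @grow_des 1 [::] [::] x m isT isT um.
by rewrite grow_first //; case: x um => [l|] um /= <-.
Qed.

(** The bijection [grow_data] as an identity of sums. On the left there is an inner composition with
    a shuffle, on the right an outer one with a strip and a column word. Removing the strip gives
    back the inner composition, so the weights agree by the recursion of [dirt_count]. *)
Lemma upaths_cons a al n (g : bool -> seq bool -> int) : 0 < a ->
  (\sum_(b <- compositions n) (dirt_count al b)%:R *
      \sum_(m <- shuffles a n (column_words b))
         g (peak_columns [::] (pmap id m) && second_ins m) (descent_bits (lift_descent weak_descent) m) =
   \sum_(b <- compositions (a + n)) (dirt_count (a :: al) b)%:R *
      \sum_(u <- column_words b) g (peak_columns [::] u) (descent_bits weak_descent u))%R.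
Proof.
move=> a0.
pose X := [seq (x, u) | x <- [seq (b, Z) | b <- compositions (a + n), Z <- strips b a],
                        u <- column_words x.1].
pose Y := [seq (b, m) | b <- compositions n, m <- shuffles a n (column_words b)].
pose F (y : seq nat * seq (option nat)) := ((dirt_count al y.1)%:R *
   g (peak_columns [::] (pmap id y.2) && second_ins y.2) (descent_bits (lift_descent weak_descent) y.2))%R : int.
pose G (x : (seq nat * seq nat) * seq nat) := ((dirt_count al (downs x.1.2 (behead x.1.1)))%:R *
   g (peak_columns [::] x.2) (descent_bits weak_descent x.2))%R : int.
have sU b : is_composition n b -> {in column_words b, forall u, size u = n}.
  by move=> /andP[_ /eqP <-] u; apply: size_upaths.
transitivity (\sum_(y <- Y) F y)%R.
  rewrite /Y big_allpairs_dep; apply: eq_bigr => b _; rewrite mulr_sumr.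
  by apply: eq_bigr.
transitivity (\sum_(x <- X) G x)%R; last first.
  rewrite /X big_allpairs_dep big_allpairs_dep; apply: eq_bigr => b _ /=.
  rewrite natr_sum mulr_suml; apply: eq_bigr => S _.
  by rewrite mulr_sumr.
have memY y : (y \in Y) = [&& is_composition n y.1, column_path [::] (pmap id y.2),
    add_columns [::] (pmap id y.2) == y.1, ins (head (Some 0) y.2) & count ins y.2 == a].
  case: y => b m; apply/allpairsPdep/and5P => /= [[b' [m' [+ + [-> ->]]]]|[bn um ub hm cm]].
    rewrite mem_compositions => bn; rewrite mem_shuf //; last exact: sU.
    by rewrite mem_upaths bn; case/and3P=> -> -> /andP[-> ->].
  exists b, m; rewrite mem_compositions bn mem_shuf //; last exact: sU.
  by rewrite hm cm mem_upaths um ub.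
have memX x : (x \in X) = [&& is_composition (a + n) x.1.1, x.1.2 \in strips x.1.1 a,
     column_path [::] x.2 & add_columns [::] x.2 == x.1.1].
  case: x => [[b S] u]; apply/allpairsPdep/and4P => /= [[[b' S'] [u' [+ + [-> -> ->]]]]|[bn Sb uu ub]].
    case/allpairsPdep=> b1 [S1 [b1n S1b [-> ->]]]; rewrite -mem_compositions.
    by rewrite mem_upaths => /andP[-> ->].
  exists (b, S), u; rewrite mem_upaths uu ub; split=> //.
  by apply/allpairsPdep; exists b, S; rewrite mem_compositions.
apply: (@big_bij _ _ grow_data).
- apply: allpairs_uniq_dep; first exact: compositions_uniq.
    move=> b; rewrite mem_compositions => bn; apply: shuf_uniq => //; first exact: sU.
    exact: upaths_uniq.
  by move=> [b m] [b' m'] _ _ [-> ->].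
- apply: allpairs_uniq_dep.
  + apply: allpairs_uniq_dep; first exact: compositions_uniq.
      by move=> b _; apply: strips_uniq.
    by move=> [b m] [b' m'] _ _ [-> ->].
  + by move=> x _; apply: upaths_uniq.
  by move=> [b m] [b' m'] _ _ [-> ->].
- move=> [b m] [b' m']; rewrite !memY /= => /and5P[_ um /eqP <- hm _] /and5P[_ um' /eqP <- hm' _].
  case: m um hm => [|[//|] m] // um _; case: m' um' hm' => [|[//|] m'] // um' _.
  move=> [_ eS eu]; have [||||||_ ->] // := @grow_inj 1 [::] [::] [::] m m'.
  by rewrite (surjective_pairing (grow _ _ m)) eS eu -surjective_pairing.
- move=> [b m]; rewrite memY memX /= => /and5P[/andP[b0 bn] um /eqP ub hm cm].
  case: m um hm ub cm => [|[//|] m] // um _ ub cm.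
  have [//|//|//|ug [b' [s' [eu b'0 bS' dS' sz]]]] := @grow_ok 1 [::] [::] m.
  rewrite ug eqxx {2}eu mem_strips bS' sz /= andbT; apply/andP; split; last first.
    by rewrite /= in cm; rewrite addn0.
  rewrite /is_composition all_ups //= sumn_ups // size_grow /=.
  move: bn cm; rewrite -ub sumn_ups //= => bn cm.
  by have h := count_ins m; apply/eqP; rewrite /= in bn cm; nlia.
- move=> [[b S] [|l u]]; rewrite memX.
    by case/and4P=> _ /= Sb _ /eqP eb; rewrite -eb in Sb.
  case/and4P=> /= /andP[b0 bn] Sb.
  rewrite /can_up in_nil andbF orbF => /andP[/eqP -> /= uu] /eqP ub.
  case: b ub b0 bn Sb => [|b' s'] // ub b0 bn; rewrite mem_strips => /andP[bS /eqP sz].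
  have [S1 [ms [bS1 u1 gr]]] := @grow_surj 1 [::] u b' s' S isT uu ub bS.
  have eS1 := upaths_nil_strip bS1; rewrite eS1 /= in u1 gr.
  have [_ [b2 [s2 [eu _ _ dS2 sz2]]]] := @grow_ok 1 [::] [::] ms isT isT u1.
  rewrite gr /= ub /= in eu dS2 sz2; move: eu dS2 sz2 => [<- <-] dS2 sz2.
  exists (downs S s', None :: ms); last by rewrite /grow_data /= gr ub.
  rewrite memY /= u1 dS2 eqxx /=.
  apply/andP; split; last by rewrite -sz sz2 addn0.
  rewrite /is_composition all_ups // sumn_ups //.
  have := size_grow [:: 1] [::] ms; rewrite gr /= => su.
  move: bn; rewrite -ub sumn_ups //= => bn.
  by move: bn; rewrite su -(count_ins ms) -sz sz2 addnA eqn_add2l.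
move=> [b m]; rewrite memY => /and5P[/= /andP[b0 bn] um /eqP ub hm cm].
case: m um hm ub cm => [|[//|] m] // um _ ub cm.
have [//|//|//|ug [b' [s' [eu b'0 bS' dS' sz]]]] := @grow_ok 1 [::] [::] m.
rewrite /F /G /grow_data; congr (_%:R * _)%R; first by rewrite /= eu /= dS' -ub.
rewrite -[LHS]/(g (peak_columns [::] (pmap id (None :: m)) && second_ins (None :: m))
                  (descent_bits (lift_descent weak_descent) (None :: m))).
by rewrite grow_pk1 // grow_des1.
Qed.

Theorem sits_upaths al (g : bool -> seq bool -> int) : all (leq 1) al ->
  (\sum_(v <- sit_words al) g (peak_rows [::] v) (descent_bits ltn v) =
   \sum_(b <- compositions (sumn al)) (dirt_count al b)%:R *
      \sum_(u <- column_words b) g (peak_columns [::] u) (descent_bits weak_descent u))%R.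
Proof.
elim: al g => [|a al IHal] g.
  move=> _; have -> : sit_words [::] = [:: [::]] by [].
  have -> : compositions (sumn [::]) = [:: [::]] by [].
  by rewrite !big_seq1 mul1r.
move=> /= /andP[a0 al0]; rewrite sits_cons // -upaths_cons //.
rewrite big_shuf //; last exact: size_sits.
(* The hypothesis is used for the function that sums [g] over all ways of shuffling in the bottom
   row. *)
rewrite (IHal (fun k D => \sum_(p <- patterns a (sumn al)) g (k && second_true p) (mix D p))%R) //.
rewrite !big_seq; apply: eq_bigr => b; rewrite mem_compositions => /andP[_ /eqP bn].
congr (_ * _)%R; rewrite big_shuf // -bn; exact: size_upaths.
Qed.

(** * Descents for two orders of the letters *)

Section InsertionSort.

Variables (T : eqType) (le : rel T).

Fixpoint insert_sorted (x : T) (s : seq T) : seq T :=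
  if s is y :: s' then if le x y then x :: s else y :: insert_sorted x s' else [:: x].

Definition isort (s : seq T) : seq T := foldr insert_sorted [::] s.

Lemma perm_isert x s : perm_eq (insert_sorted x s) (x :: s).
Proof.
elim: s => //= y s IHs; case: ifP => // _.
by rewrite -[x :: y :: s]/([:: x] ++ [:: y] ++ s) perm_sym perm_catCA /= perm_cons perm_sym.
Qed.

Lemma perm_isort s : perm_eq (isort s) s.
Proof. by elim: s => //= x s IHs; rewrite (perm_trans (perm_isert _ _)) // perm_cons. Qed.

Hypotheses (leT : total le) (letr : transitive le).

Lemma sorted_isort s : sorted le (isort s).
Proof.
elim: s => //= x s; move: (isort s) => {}s; elim: s => //= y s IHs sy.
case: ifP => [xy|xy] /=; first by rewrite xy.
have yx : le y x by have := leT x y; rewrite xy.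
rewrite path_sortedE // (perm_all _ (perm_isert x s)) /= yx IHs ?(path_sorted sy) ?andbT //.
by move: sy; rewrite path_sortedE // => /andP[].
Qed.

End InsertionSort.

Section Blocks.

Variables (T : eqType) (X : seq (seq T)).

Definition swappable (le1 le2 : rel T) := forall p x y s,
  p ++ x :: y :: s \in X -> le1 x y -> ~~ le2 x y -> p ++ y :: x :: s \in X.

(* Insertion sort for le2 of blocks sorted for le1 only exchanges neighbours on
   which the two orders disagree. *)
Lemma blocks_le (le1 le2 : rel T) (g : seq nat) :
    total le2 -> transitive le1 -> transitive le2 -> antisymmetric le1 ->
    uniq X -> {in X, forall w, size w = sumn g} -> swappable le1 le2 ->
  count (fun w => all (sorted le1) (reshape g w)) X <=
  count (fun w => all (sorted le2) (reshape g w)) X.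
Proof.
move=> tot2 tr1 tr2 an1 uX sX sw.
have reach1 x p u s : all (le1 x) u -> p ++ x :: u ++ s \in X -> p ++ insert_sorted le2 x u ++ s \in X.
  elim: u p => //= y u IHu p /andP[xy xu] pX; case: ifP => // xy2.
  rewrite -cat_rcons; apply: IHu => //; rewrite cat_rcons.
  by apply: sw => //; rewrite xy2.
have reach2 t p s : sorted le1 t -> p ++ t ++ s \in X -> p ++ isort le2 t ++ s \in X.
  elim: t p => //= x t IHt p xt pX; apply: reach1; last first.
    by rewrite -cat_rcons; apply: IHt; rewrite ?cat_rcons ?(path_sorted xt).
  by rewrite (perm_all _ (perm_isort le2 t)); apply: order_path_min xt.
have reach3 bs p : all (sorted le1) bs -> p ++ flatten bs \in X ->
    p ++ flatten (map (isort le2) bs) \in X.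
  elim: bs p => //= t bs IHbs p /andP[st sbs] pX.
  by rewrite catA; apply: IHbs => //; rewrite -catA; apply: reach2.
pose f w := flatten (map (isort le2) (reshape g w)).
have fK w : size w = sumn g -> reshape g (f w) = map (isort le2) (reshape g w).
  move=> sw'; have esh : shape (map (isort le2) (reshape g w)) = g.
    rewrite -[RHS](@reshapeKl _ g w) ?sw' // /shape -map_comp; apply: eq_map => t /=.
    by rewrite (perm_size (perm_isort le2 t)).
  by rewrite /f -{1}esh flattenK.
rewrite -!size_filter -(size_map f); apply: uniq_leq_size.
  rewrite map_inj_in_uniq ?filter_uniq // => v w; rewrite !mem_filter.
  move=> /andP[v1 /sX sv] /andP[w1 /sX sw'] efw.
  have : map (isort le2) (reshape g v) = map (isort le2) (reshape g w).
    by rewrite -!fK // efw.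
  move=> emap; suff e : reshape g v = reshape g w.
    by rewrite -(@reshapeKr _ g v) ?sv // e reshapeKr ?sw'.
  elim: (reshape g v) (reshape g w) v1 w1 emap => [|t bs IHbs] [|t' bs'] //=.
  move=> /andP[t1 b1] /andP[t1' b1'] [et /IHbs -> //]; congr (_ :: _).
  (* A block sorted for [le1] is determined by its content, which sorting for [le2] preserves. *)
  apply: (sorted_eq tr1 an1 t1 t1').
  by apply: perm_trans (perm_isort le2 t'); rewrite -et perm_sym perm_isort.
move=> _ /mapP[w + ->]; rewrite !mem_filter => /andP[w1 wX].
rewrite fK ?sX //; apply/andP; split.
  by apply/allP=> _ /mapP[t _ ->]; apply: sorted_isort.
by apply: (@reach3 _ [::]) => //; rewrite reshapeKr ?sX.
Qed.

(* In a pattern, [None] leaves open whether there is a descent.  The words that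
   match a pattern without [Some true] are those with increasing blocks; the
   general case follows by inclusion and exclusion. *)
Fixpoint cuts_shape (D : seq (option bool)) : seq nat :=
  match D with
  | [::] => [:: 1]
  | None :: D' => 1 :: cuts_shape D'
  | Some _ :: D' => (head 0 (cuts_shape D')).+1 :: behead (cuts_shape D')
  end.

Definition pmatch (P : seq (option bool)) (D : seq bool) : bool :=
  all2 (fun q d => if q is Some b then b == d else true) P D.

Lemma sumn_cut_shape D : sumn (cuts_shape D) = (size D).+1.
Proof.
elim: D => //= -[b|] D IHD /=; last by rewrite IHD.
by rewrite -IHD; case: (cuts_shape D).
Qed.

Lemma blocks_match (le : rel T) P w : size w = (size P).+1 -> Some true \notin P ->
  all (sorted le) (reshape (cuts_shape P) w) = pmatch P (descent_bits (fun x y => ~~ le x y) w).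
Proof.
elim: P w => [|q P IHP] [|x [|y w]] // sw; rewrite inE negb_or => /andP[q1 P1].
have {IHP} := IHP (y :: w) _ P1; rewrite [size (y :: w)]/= => IH.
have /IH {IH} : (size w).+1 = (size P).+1 by case: sw => ->.
rewrite /pmatch /=.
have : 0 < head 0 (cuts_shape P) by case: (P) => [|[?|] ?].
case: (cuts_shape P) => // k g k0; case: q q1 {sw} => [[|]|] // _ <- /=.
by case: k k0 => //= k _; rewrite -andbA; case: (le x y).
Qed.

Variables (le1 le2 : rel T) (n : nat).
Hypotheses (tot1 : total le1) (tot2 : total le2) (tr1 : transitive le1) (tr2 : transitive le2).
Hypotheses (an1 : antisymmetric le1) (an2 : antisymmetric le2).
Hypotheses (uX : uniq X) (sX : {in X, forall w, size w = n}).
Hypotheses (sw12 : swappable le1 le2) (sw21 : swappable le2 le1).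

Notation des1 := (descent_bits (fun x y => ~~ le1 x y)).
Notation des2 := (descent_bits (fun x y => ~~ le2 x y)).

Lemma pmatch_split P1 P2 D :
  (pmatch (P1 ++ None :: P2) D : nat) =
  pmatch (P1 ++ Some true :: P2) D + pmatch (P1 ++ Some false :: P2) D.
Proof.
elim: P1 D => [|q P1 IHP] [|d D] //; first by case: d; rewrite ?addn0.
rewrite /pmatch /= -!/(pmatch _ _).
by case: (if q is Some b then b == d else true); rewrite ?IHP.
Qed.

Lemma count_pmatch_split P1 P2 (h : seq T -> seq bool) :
  count (fun w => pmatch (P1 ++ None :: P2) (h w)) X =
  count (fun w => pmatch (P1 ++ Some true :: P2) (h w)) X +
  count (fun w => pmatch (P1 ++ Some false :: P2) (h w)) X.
Proof. by elim: X => //= w Y ->; rewrite pmatch_split; lia. Qed.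

Lemma count_pmatch P : 0 < n -> size P = n.-1 ->
  count (fun w => pmatch P (des1 w)) X = count (fun w => pmatch P (des2 w)) X.
Proof.
move=> n0; suff gen P2 : forall P1, Some true \notin P1 -> size (P1 ++ P2) = n.-1 ->
   count (fun w => pmatch (P1 ++ P2) (des1 w)) X = count (fun w => pmatch (P1 ++ P2) (des2 w)) X.
  exact: (gen P [::]).
elim: P2 => [|q P2 IHP] P1 P1n.
  rewrite cats0 => sP; have szX w : w \in X -> size w = (size P1).+1.
    by move=> /sX ->; rewrite sP prednK.
  have shX w : w \in X -> size w = sumn (cuts_shape P1).
    by rewrite sumn_cut_shape; apply: szX.
  have E (le : rel T) : count (fun w => pmatch P1 (descent_bits (fun x y => ~~ le x y) w)) X =
      count (fun w => all (sorted le) (reshape (cuts_shape P1) w)) X.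
    by apply: eq_in_count => w /szX sw; rewrite blocks_match.
  by rewrite !E; apply/eqP; rewrite eqn_leq !blocks_le.
have IH q' : q' != Some true -> size (P1 ++ q' :: P2) = n.-1 ->
   count (fun w => pmatch (P1 ++ q' :: P2) (des1 w)) X =
   count (fun w => pmatch (P1 ++ q' :: P2) (des2 w)) X.
  move=> q1; rewrite -cat_rcons; apply: IHP.
  by rewrite mem_rcons inE negb_or eq_sym q1.
case: q => [[|]|] sz; try exact: IH.
have := IH None isT; have := IH (Some false) isT; rewrite !count_pmatch_split.
by move: sz; rewrite !size_cat /= => sz -> // /(_ sz) /addIn.
Qed.

Lemma des_equidistributed : perm_eq (map des1 X) (map des2 X).
Proof.
case: (posnP n) => [n0 | n0].
  rewrite (eq_in_map des1 des2 X).1 // => w /sX; rewrite n0.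
  by case: w.
have szd (r : rel T) w : w \in X -> size (descent_bits r w) = n.-1.
  by move=> /sX <-; case: w => //= x w; rewrite size_pairmap.
apply/allP=> D _; apply/eqP; rewrite !count_map.
case: (size D =P n.-1) => [sD | sD]; last first.
  by transitivity 0; [|symmetry]; apply/eqP; rewrite -leqn0 leqNgt -has_count;
     apply/hasPn => w /szd sz; apply/eqP => eD; case: sD; rewrite -eD sz.
have E (r : rel T) : count (preim (descent_bits r) (pred1 D)) X =
    count (fun w => pmatch (map Some D) (descent_bits r w)) X.
  apply: eq_in_count => w /(szd r); rewrite -sD /=.
  elim: (descent_bits r w) (D) => [|e E IHE] [|d D'] //= [/IHE <-].
  by rewrite eqseq_cons eq_sym.
by rewrite !E count_pmatch // size_map.
Qed.

End Blocks.

(** * Column and row readings of peak tableaux *)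

(* The boxes (column, row) of the entries, with columns numbered from 1 and rows
   from 0. *)
Fixpoint boxes (s v : seq nat) : seq (nat * nat) :=
  if v is j :: v' then ((nth 0 s j).+1, j) :: boxes (incr_nth s j) v' else [::].

Definition le_c (x y : nat * nat) : bool := (x.1 < y.1) || (x.1 == y.1) && (x.2 <= y.2).
(** The reading by rows starts with the top row, hence the reversed comparison of row indices. *)
Definition le_r (x y : nat * nat) : bool := (y.2 < x.2) || (x.2 == y.2) && (x.1 <= y.1).

Lemma boxes_snd s v : map snd (boxes s v) = v.
Proof. by elim: v s => //= j v IHv s; rewrite IHv. Qed.

Lemma boxes_cat s v w : boxes s (v ++ w) = boxes s v ++ boxes (shape_from s v) w.
Proof. by elim: v s => //= j v IHv s; rewrite IHv. Qed.

Lemma boxes_inj s : injective (boxes s).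
Proof. by move=> v w e; rewrite -(boxes_snd s v) e boxes_snd. Qed.

Lemma sitp_cat s v w : sit_path s (v ++ w) = sit_path s v && sit_path (shape_from s v) w.
Proof. by elim: v s => //= j v IHv s; rewrite IHv andbA. Qed.

Lemma pkv_cat s v w : peak_rows s (v ++ w) = peak_rows s v && peak_rows (shape_from s v) w.
Proof.
elim: v s => [|j v IHv] s /=; last by rewrite IHv andbA.
by case: w => [|j w] /=; rewrite ?andbT ?andbb // andbA andbb.
Qed.

Lemma sh_cat s v w : shape_from s (v ++ w) = shape_from (shape_from s v) w.
Proof. exact: foldl_cat. Qed.

Lemma incr_nthC s i j : incr_nth (incr_nth s i) j = incr_nth (incr_nth s j) i.
Proof.
apply: (@eq_from_nth _ 0) => [|k _]; last by rewrite !nth_incr_nth addnCA.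
by rewrite !size_incr_nth; do !case: ifP; nlia.
Qed.

Lemma sitp_pos s v : sit_path s v -> all (leq 1) s -> all (leq 1) (shape_from s v).
Proof.
elim: v s => //= j v IHv s /andP[js sv] s0; apply: IHv => //.
elim: s j js s0 {sv} => [|x s IHs] [|j] //= js /andP[x0 s0] //=.
by rewrite x0 IHs.
Qed.

Lemma nth_pos s i : all (leq 1) s -> (0 < nth 0 s i) = (i < size s).
Proof.
move=> /all_nthP h; case: (ltnP i (size s)) => [ls | ls]; first exact: h.
by rewrite nth_default.
Qed.

Lemma is_peak_nth s i : is_peak s -> i.+1 < size s -> 1 < nth 0 s i.
Proof.
move=> /all_nthP h ls; have := h 0 i; rewrite size_take nth_take; last by nlia.
by apply; case: ifP; nlia.
Qed.

Lemma is_peak_incr s i : 1 < nth 0 s i -> is_peak (incr_nth s i) = is_peak s.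
Proof.
move=> si; have ls : i < size s by rewrite ltnNge; apply/negP=> h; rewrite nth_default in si.
rewrite !is_peakE size_incr_nth ls; congr (all id (take _ _)).
apply: (@eq_from_nth _ false) => [|k]; rewrite !size_map size_incr_nth ls //.
move=> ks; rewrite !(nth_map 0) ?size_incr_nth ?ls // nth_incr_nth.
by case: (i =P k) => [<- | _] //; rewrite si; nlia.
Qed.

Lemma sits_swap s r r' w : sit_path s [:: r, r' & w] -> peak_rows s [:: r, r' & w] ->
    r != r' -> 1 < nth 0 s r -> 1 < nth 0 s r' ->
  [/\ sit_path s [:: r', r & w], peak_rows s [:: r', r & w] &
   boxes s [:: r', r & w] = ((nth 0 s r').+1, r') :: ((nth 0 s r).+1, r) ::
      boxes (incr_nth (incr_nth s r) r') w].
Proof.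
move=> /= /and3P[h1 h2 h3] /and3P[h4 h5 h6] rr' sr sr'.
have ls i : 1 < nth 0 s i -> i < size s.
  by move=> si; rewrite ltnNge; apply/negP=> h; rewrite nth_default in si.
rewrite [incr_nth (incr_nth s r') r]incr_nthC h3 h6 h4 is_peak_incr // h4.
rewrite !size_incr_nth !(ls r') // nth_incr_nth eq_sym (negPf rr') add0n; split=> //.
by rewrite (ltnW (ls _ sr')) (ltnW (ls _ sr)).
Qed.

(* Neighbours ordered differently by column and row readings lie in columns
   >= 3: exchanging them alters neither the first two columns nor a row. *)
Lemma disagree_ge2 s r r' w : all (leq 1) s -> sit_path s [:: r, r' & w] ->
    peak_rows s [:: r, r' & w] ->
    let x := ((nth 0 s r).+1, r) in let y := ((nth 0 (incr_nth s r) r').+1, r') in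
    le_c x y != le_r x y ->
  [/\ r != r', 1 < nth 0 s r & 1 < nth 0 s r'].
Proof.
move=> s0 /= /and3P[rs r's _] /and3P[ps pr].
set s2 := incr_nth (incr_nth s r) r'.
have pk v t : peak_rows t v -> is_peak t by case: v => [|j v] /=; [rewrite andbT|case/andP].
move=> /pk ps2; have P := nth_pos _ s0.
rewrite nth_incr_nth /le_c /le_r /=.
case: (ltngtP r r') => [rr' | r'r | <-]; last 1 first.
- by rewrite add1n ltnSn leqnSn.
- move=> d; have {d} d : nth 0 s r <= nth 0 s r' by move: d; nlia.
  have r's2 : r' < size s2 by rewrite !size_incr_nth; do !case: ifP; nlia.
  case: (posnP (nth 0 s r')) => [r'0 | ].
    have := is_peak_nth ps2 (leq_ltn_trans rr' r's2 : r.+1 < _).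
    rewrite /s2 !nth_incr_nth eqxx; case: eqP; nlia.
  rewrite P => r'1; have := is_peak_nth ps (leq_ltn_trans rr' r'1 : r.+1 < _).
  by split=> //; nlia.
move=> d; have {d} d : nth 0 s r' <= nth 0 s r by move: d; nlia.
have r'1 : r' < size s by apply: leq_trans r'r rs.
have r1 : r < size s by move: r'1; rewrite -!P; nlia.
have := is_peak_nth ps (leq_ltn_trans r'r r1 : r'.+1 < _).
by split=> //; nlia.
Qed.

(** As the two rows differ, exchanging the letters exchanges their boxes; all later boxes depend
    only on the shape reached, which is the same. *)
Lemma swappable_boxes (le1 le2 : rel (nat * nat)) a :
    (forall x y, le1 x y -> ~~ le2 x y -> le_c x y != le_r x y) ->
  swappable (map (boxes [::]) [seq v <- sit_words a | peak_rows [::] v]) le1 le2.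
Proof.
move=> dis p x y s /mapP[v + ev] l1 l2.
have ev2 : v = map snd p ++ [:: x.2, y.2 & map snd s].
  by rewrite -(boxes_snd [::] v) -ev map_cat.
move: ev; rewrite ev2 mem_filter mem_sits boxes_cat pkv_cat sitp_cat sh_cat.
set q := map snd p; set t := map snd s; set z := shape_from [::] q.
have sp : size p = size (boxes [::] q) by rewrite -(size_map snd (boxes _ _)) boxes_snd size_map.
move=> /eqP; rewrite eqseq_cat // => /andP[/eqP ep /eqP [ex ey es]].
move=> /andP[/andP[pq pz] /andP[/andP[sq sz] /eqP sha]].
have z0 : all (leq 1) z by apply: sitp_pos sq _.
have [] := disagree_ge2 z0 sz pz.
  by rewrite -ex -ey; apply: dis.
move=> rr' zr zr'; have [sz' pz' bz'] := sits_swap sz pz rr' zr zr'.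
apply/mapP; exists (q ++ [:: y.2, x.2 & t]).
  rewrite mem_filter mem_sits pkv_cat sitp_cat sh_cat -/z pq pz' sq sz' /=.
  by rewrite incr_nthC; apply/eqP.
rewrite boxes_cat -ep -/z bz' es; congr (_ ++ _).
have r'r : (x.2 == y.2) = false by apply/negbTE.
by move: ex ey; rewrite nth_incr_nth r'r add0n => <- <-.
Qed.

Lemma le_r_des s v : descent_bits (fun x y => ~~ le_r x y) (boxes s v) = descent_bits ltn v.
Proof.
case: v => // j v; elim: v j s => //= k v IHv j s; rewrite IHv; congr (_ :: _).
rewrite /le_r /= nth_incr_nth.
by case: (ltngtP k j) => //= ->; rewrite ltnS leqnSn.
Qed.

Lemma des_c_r a : perm_eq
  [seq descent_bits (fun x y => ~~ le_c x y) (boxes [::] v) | v <- [seq v <- sit_words a | peak_rows [::] v]]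
  [seq descent_bits ltn v | v <- [seq v <- sit_words a | peak_rows [::] v]].
Proof.
rewrite -[X in perm_eq _ X](eq_map (le_r_des [::])).
rewrite (map_comp (descent_bits (fun x y => ~~ le_c x y)) (boxes [::])).
rewrite (map_comp (descent_bits (fun x y => ~~ le_r x y)) (boxes [::])).
apply: (@des_equidistributed _ _ le_c le_r (sumn a)).
- by move=> x y; rewrite /le_c; case: ltngtP => //= _; apply: leq_total.
- by move=> x y; rewrite /le_r; case: ltngtP => //= _; apply: leq_total.
- by move=> y x z; rewrite /le_c; nlia.
- by move=> y x z; rewrite /le_r; nlia.
- by move=> [x1 x2] [y1 y2]; rewrite /le_c /= => h; congr (_, _); move: h; nlia.
- by move=> [x1 x2] [y1 y2]; rewrite /le_r /= => h; congr (_, _); move: h; nlia.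
- by rewrite (map_inj_uniq (@boxes_inj [::])) filter_uniq // sits_uniq.
- move=> _ /mapP[v + ->]; rewrite mem_filter => /andP[_ /size_sits <-].
  by rewrite -(size_map snd) boxes_snd.
- by apply: swappable_boxes => x y -> /negbTE ->.
by apply: swappable_boxes => x y -> /negbTE ->.
Qed.

(** * Fillings as words of rows *)

Definition word_row (v : seq nat) (j : nat) : seq nat :=
  [seq t.+1 | t <- iota 0 (size v) & nth 0 v t == j].

(* The word v gives, for each t, the row (numbered from 0) of the entry t + 1. *)
Definition fill (l : nat) (v : seq nat) : filling := [seq word_row v j | j <- iota 0 l].

(** Fixes the lengths of the rows but not the order in which they open: immaculate and composition
    tableaux open theirs upwards, recording tableaux downwards. *)
Definition content (a v : seq nat) : bool :=
  all (gtn (size a)) v && all (fun j => count_mem j v == nth 0 a j) (iota 0 (size a)).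

Lemma contentP (a v : seq nat) : reflect ((forall t, t < size v -> nth 0 v t < size a) /\
    forall j, count_mem j v = nth 0 a j) (content a v).
Proof.
apply: (iffP andP) => [[/all_nthP h1 /allP h2]|[h1 h2]].
  split=> [t tv | j]; first exact: h1.
  case: (ltnP j (size a)) => ja; first by apply/eqP/h2; rewrite mem_iota.
  rewrite [RHS]nth_default //; apply/count_memPn/negP=> /(nthP 0)[t tv tj].
  by have := h1 0 t tv; rewrite tj /=; nlia.
split; last by apply/allP=> j _; apply/eqP.
by apply/(all_nthP 0) => t /h1.
Qed.

(** One less than the column of the entry [t.+1], since rows increase. *)
Definition earlier (v : seq nat) (t : nat) : nat := count_mem (nth 0 v t) (take t v).

Lemma occ_lt v t : t < size v -> earlier v t < count_mem (nth 0 v t) v.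
Proof.
move=> tv; have : count_mem (nth 0 v t) (take t v ++ drop t v) = count_mem (nth 0 v t) v.
  by rewrite cat_take_drop.
by rewrite count_cat (drop_nth 0 tv) /= eqxx /earlier => <-; rewrite addnA addn1 leq_addr.
Qed.

Definition box_at (v : seq nat) (t : nat) : nat * nat := ((earlier v t).+1, (nth 0 v t).+1).

Lemma size_word_row v j : size (word_row v j) = count_mem j v.
Proof.
rewrite size_map size_filter -[in RHS](mkseq_nth 0 v) /mkseq count_map.
by apply: eq_count => t.
Qed.

Lemma iota_cat_at t n : t < n -> iota 0 n = iota 0 t ++ t :: iota t.+1 (n - t.+1).
Proof.
move=> tn; have e : n = t + (n - t.+1).+1 by nlia.
by rewrite {1}e iotaD add0n.
Qed.

Lemma nth_word_row v t : t < size v -> nth 0 (word_row v (nth 0 v t)) (earlier v t) = t.+1.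
Proof.
move=> tv; rewrite /word_row (iota_cat_at tv) filter_cat map_cat /= eqxx.
rewrite nth_cat size_map size_filter.
have -> : count (fun u => nth 0 v u == nth 0 v t) (iota 0 t) = earlier v t.
  have et : take t v = [seq nth 0 v u | u <- iota 0 t].
    by rewrite -[in LHS](mkseq_nth 0 v) /mkseq -map_take take_iota (minn_idPl (ltnW tv)).
  by rewrite /earlier et count_map; apply: eq_count.
by rewrite ltnn subnn.
Qed.

Lemma mem_word_row v j t : (t.+1 \in word_row v j) = (t < size v) && (nth 0 v t == j).
Proof.
rewrite (mem_map succn_inj) mem_filter mem_iota /= andbC //.
Qed.

Lemma word_row_uniq v j : uniq (word_row v j).
Proof. by rewrite map_inj_uniq ?filter_uniq ?iota_uniq //; apply: succn_inj. Qed.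

Lemma sorted_word_row v j : sorted ltn (word_row v j).
Proof.
rewrite sorted_map; apply: (sub_sorted (e := ltn)) => //.
by apply: sorted_filter; [exact: ltn_trans | exact: iota_ltn_sorted].
Qed.

Lemma shape_fill a v : content a v -> shape (fill (size a) v) = a.
Proof.
case/contentP=> _ h; rewrite /shape /fill -map_comp -[RHS](mkseq_nth 0).
by apply: eq_map => j /=; rewrite size_word_row h.
Qed.

Lemma nth_fill l v j : j < l -> nth [::] (fill l v) j = word_row v j.
Proof. by move=> jl; rewrite (nth_map 0) ?size_iota // nth_iota. Qed.

Lemma mem_diagram (a : seq nat) c r : ((c, r) \in diagram a) =
  [&& 0 < r, r <= size a, 0 < c & c <= nth 0 a r.-1].
Proof.
apply/allpairsPdep/and4P => [[j [i [+ + [-> ->]]]]|[r0 ra c0 ca]].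
  by rewrite !mem_iota !add1n !ltnS => /andP[-> ->] /andP[-> ->].
by exists r, c; rewrite !mem_iota !add1n !ltnS r0 ra c0 ca.
Qed.

Lemma diagram_uniq a : uniq (diagram a).
Proof.
apply: allpairs_uniq_dep => [|j _|]; rewrite ?iota_uniq //.
by move=> [x y] [x' y'] _ _ [-> ->].
Qed.

Section Fill.

Variables (a v : seq nat).
Hypothesis av : content a v.

Notation T := (fill (size a) v).

Lemma bx_diagram t : t < size v -> box_at v t \in diagram a.
Proof.
move=> tv; have [h1 h2] := contentP _ _ av; rewrite mem_diagram /= h1 // -h2.
exact: occ_lt.
Qed.

Lemma entry_bx t : t < size v -> entry T (box_at v t) = t.+1.
Proof.
move=> tv; have [h1 h2] := contentP _ _ av.
by rewrite /entry /= nth_fill ?h1 // nth_word_row.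
Qed.

Lemma diagram_bx c : c \in diagram a -> exists2 t, t < size v & c = box_at v t.
Proof.
case: c => c r; rewrite mem_diagram => /and4P[r0 ra c0 ca].
have [h1 h2] := contentP _ _ av; rewrite -h2 -size_word_row in ca.
have cs : c.-1 < size (word_row v r.-1) by nlia.
have := mem_nth 0 cs; case e: (nth _ _ _) => [|t]; first by case/mapP.
rewrite mem_word_row => /andP[tv /eqP er]; exists t => //.
congr (_, _); last by rewrite er prednK.
have := nth_word_row tv; rewrite er -e => /eqP; rewrite nth_uniq ?word_row_uniq //.
  by move=> /eqP ->; rewrite prednK.
by rewrite size_word_row -er occ_lt.
Qed.

Lemma all_diagram (P : pred (nat * nat)) :
  all P (diagram a) = all (fun t => P (box_at v t)) (iota 0 (size v)).
Proof.
apply/allP/allP => h.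
  by move=> t; rewrite mem_iota => tv; apply: h; apply: bx_diagram.
by move=> c /diagram_bx[t tv ->]; apply: h; rewrite mem_iota.
Qed.

Lemma box_of_fill t : t < size v -> box_of T t.+1 = box_at v t.
Proof.
move=> tv; rewrite /box_of (shape_fill av).
have hs : has (fun c => entry T c == t.+1) (diagram a).
  by apply/hasP; exists (box_at v t); rewrite ?bx_diagram ?entry_bx.
have := nth_find (0, 0) hs; have : nth (0, 0) (diagram a) (find (fun c => entry T c == t.+1) (diagram a)) \in diagram a.
  by rewrite mem_nth // -has_find.
by case/diagram_bx => t' t'v ->; rewrite entry_bx // => /eqP[->].
Qed.

Lemma perm_fill : perm_eq (flatten T) (iota 1 (size v)).
Proof.
have [h1 h2] := contentP _ _ av.
have key (J : seq nat) : uniq J -> perm_eq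
    (flatten [seq word_row v j | j <- J])
    [seq t.+1 | t <- iota 0 (size v) & nth 0 v t \in J].
  elim: J => [|j J IHJ] /=.
    by rewrite (eq_filter (a2 := pred0)) ?filter_pred0.
  move=> /andP[jJ uJ]; rewrite (perm_trans (_ : perm_eq _ (word_row v j ++
    [seq t.+1 | t <- iota 0 (size v) & nth 0 v t \in J]))) ?perm_cat2l ?IHJ //.
  rewrite -map_cat; apply: perm_map.
  apply: (perm_trans _ (introT permPl (perm_filterC (fun t => nth 0 v t == j) _))).
  have eqp (p q : pred nat) s : p =1 q -> perm_eq (filter p s) (filter q s).
    by move=> /eq_filter ->.
  rewrite -!filter_predI; apply: perm_cat; apply: eqp => t; rewrite /= inE; case: eqP => //= ->.
  exact/negbTE.
rewrite (perm_trans (key _ (iota_uniq 0 _))) // -[1]addn0 iotaDl.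
have -> : [seq t <- iota 0 (size v) | nth 0 v t \in iota 0 (size a)] = iota 0 (size v).
  by apply/all_filterP/allP => t; rewrite !mem_iota => /h1.
by [].
Qed.

Lemma size_content : size v = sumn a.
Proof. by rewrite -(shape_fill av) -size_flatten (perm_size perm_fill) size_iota. Qed.

Lemma fill_fillings : T \in fillings a.
Proof. by rewrite mem_fillings (shape_fill av) eqxx -size_content perm_fill. Qed.

Lemma fill_rows : rows_increasing T.
Proof. by apply/allP=> _ /mapP[j _ ->]; apply: sorted_word_row. Qed.

End Fill.

Lemma fill_inj a v w : content a v -> content a w ->
  fill (size a) v = fill (size a) w -> v = w.
Proof.
move=> av aw e; have sv := size_content av; have sw := size_content aw.
apply: (@eq_from_nth _ 0) => [|t tv]; first by rewrite sv sw.
have tw : t < size w by rewrite sw -sv.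
have := box_of_fill av tv; rewrite e box_of_fill // => -[_ ].
by [].
Qed.

Lemma fill_surj a T : T \in fillings a -> rows_increasing T ->
  exists2 v, content a v & T = fill (size a) v.
Proof.
rewrite mem_fillings => /andP[/eqP shT pT] /allP rT.
have sT : size T = size a by rewrite -shT size_map.
pose v := [seq find (fun r => t \in r) T | t <- iota 1 (sumn a)].
have sv : size v = sumn a by rewrite size_map size_iota.
have uT : uniq (flatten T) by rewrite (perm_uniq pT) iota_uniq.
have memT e : (e \in flatten T) = (0 < e <= sumn a) by rewrite (perm_mem pT) mem_iota add1n ltnS.
have rowE j e : j < size T -> e \in nth [::] T j -> find (fun r => e \in r) T = j.
  move=> jT eT; apply/eqP; rewrite eqn_leq leqNgt; apply/andP; split.
    by apply/negP=> /(before_find [::]); rewrite eT.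
  rewrite leqNgt; apply/negP=> fj; have := nth_find [::] (a := fun r => e \in r) (s := T).
  rewrite has_find (ltn_trans fj jT) => /(_ isT) ef.
  set f := find _ _ in fj ef.
  move: uT; rewrite -(cat_take_drop j T) flatten_cat cat_uniq => /and3P[_ /hasPn h _].
  have : e \in flatten (drop j T) by rewrite (drop_nth [::] jT) /= mem_cat eT.
  move/h => /negP; apply; apply/flattenP; exists (nth [::] T f) => //.
  by rewrite -(nth_take _ fj) mem_nth // size_take jT.
have rw j : j < size T -> nth [::] T j = word_row v j.
  move=> jT; apply: (@irr_sorted_eq _ ltn); [exact: ltn_trans|exact: ltnn| | |].
  - by apply: rT; rewrite mem_nth.
  - exact: sorted_word_row.
  case=> [|t].
    rewrite -[RHS]negbK; have -> : 0 \notin word_row v j by apply/mapP=> -[].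
    apply/negP=> T0; have : 0 \in flatten T by apply/flattenP; exists (nth [::] T j); rewrite ?mem_nth.
    by rewrite memT.
  rewrite mem_word_row sv; case: (ltnP t (sumn a)) => ta.
    rewrite (nth_map 0) ?size_iota // nth_iota // add1n.
    apply/idP/eqP => [|fj]; first exact: rowE.
    have := nth_find [::] (a := fun r => t.+1 \in r) (s := T); rewrite fj; apply.
    by rewrite has_find fj.
  apply/negP=> tT; have : t.+1 \in flatten T by apply/flattenP; exists (nth [::] T j); rewrite ?mem_nth.
  by rewrite memT; nlia.
have Tv : T = fill (size a) v.
  apply: (@eq_from_nth _ [::]) => [|j jT]; first by rewrite size_map size_iota.
  by rewrite rw // nth_fill // -sT.
exists v => //; apply/contentP; split=> [t | j].
  rewrite sv => ta; rewrite (nth_map 0) ?size_iota // nth_iota // add1n -sT -has_find.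
  have : t.+1 \in flatten T by rewrite memT ta.
  by case/flattenP=> r rT' tr; apply/hasP; exists r.
case: (ltnP j (size a)) => ja.
  by rewrite -size_word_row -rw ?sT // -shT (nth_map [::]) // sT.
rewrite [RHS]nth_default //; apply/count_memPn/mapP => -[t]; rewrite mem_iota => ta ej.
have : t \in flatten T by rewrite memT; move: ta; nlia.
case/flattenP=> r rT' tr; have : has (fun r => t \in r) T by apply/hasP; exists r.
by rewrite has_find -ej sT ltnNge ja.
Qed.

Lemma nth_sh s v j : nth 0 (shape_from s v) j = nth 0 s j + count_mem j v.
Proof.
elim: v s => [|i v IHv] s /=; first by rewrite addn0.
by rewrite IHv nth_incr_nth -addnA addnCA.
Qed.

Lemma sh_content a v : shape_from [::] v = a -> content a v.
Proof.
move=> <-; apply/contentP; split=> [t tv | j]; last by rewrite nth_sh nth_nil.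
by have [/all_nthP h _] := size_sh [::] v; apply: h.
Qed.

Lemma size_sh_le N s v : all (gtn N) v -> size s <= N -> size (shape_from s v) <= N.
Proof.
elim: v s => //= j v IHv s /andP[jN vN] sN; apply: IHv => //.
by rewrite size_incr_nth; case: ifP.
Qed.

Lemma content_sh a v : all (leq 1) a -> content a v -> shape_from [::] v = a.
Proof.
move=> a0 /contentP[h1 h2]; have hn j : nth 0 (shape_from [::] v) j = nth 0 a j.
  by rewrite nth_sh nth_nil h2.
apply: (@eq_from_nth _ 0) => // ; apply/eqP; rewrite eqn_leq; apply/andP; split.
  by apply: size_sh_le => //; apply/(all_nthP 0).
rewrite leqNgt; apply/negP=> lt.
by have := nth_pos (size (shape_from [::] v)) a0; rewrite -hn nth_default // lt.
Qed.

Lemma sitpP s v : reflect (forall t, t < size v -> nth 0 v t <= size (shape_from s (take t v)))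
  (sit_path s v).
Proof.
elim: v s => [|j v IHv] s /=; first exact: ReflectT.
apply: (iffP andP) => [[js /IHv h] [|t] //| h]; first exact: h.
by split; [exact: (h 0) | apply/IHv => t tv; exact: (h t.+1)].
Qed.

Lemma pkvP s v : reflect (forall t, t <= size v -> is_peak (shape_from s (take t v))) (peak_rows s v).
Proof.
elim: v s => [|j v IHv] s /=.
  by rewrite andbT; apply: (iffP idP) => [ps [|t] // | /(_ 0 isT)].
apply: (iffP andP) => [[js /IHv h] [|t] //| h]; first exact: h.
by split; [exact: (h 0) | apply/IHv => t tv; exact: (h t.+1)].
Qed.

Lemma first_word_row v j : j \in v -> nth 0 (word_row v j) 0 = (index j v).+1.
Proof.
move=> jv; have iv : index j v < size v by rewrite index_mem.
have := nth_word_row iv; rewrite nth_index //; suff -> : earlier v (index j v) = 0 by [].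
rewrite /earlier nth_index //; apply/count_memPn/negP.
by rewrite in_take_leq ?ltnn // ltnW.
Qed.

Section Fill.

Variables (a v : seq nat).
Hypotheses (av : content a v) (a0 : all (leq 1) a).

Notation T := (fill (size a) v).

Lemma mem_content j : (j \in v) = (j < size a).
Proof.
have [h1 h2] := contentP _ _ av.
by rewrite -nth_pos // -h2 -has_count has_pred1.
Qed.

Lemma column1_fill : column T 1 = [seq (index j v).+1 | j <- iota 0 (size a)].
Proof.
rewrite /column /fill (all_filterP _); last first.
  apply/allP=> _ /mapP[j + ->]; rewrite mem_iota /= => ja.
  by rewrite size_word_row -has_count has_pred1 mem_content.
rewrite -map_comp; apply/eq_in_map => j; rewrite mem_iota /= => ja.
by rewrite first_word_row // mem_content.
Qed.

(** The first column lists the first occurrences of the letters. It increases exactly when no letter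
    precedes the first occurrence of a smaller one, that is, when each new row opens on top. *)
Lemma column1_sitp : column1_increasing T = sit_path [::] v.
Proof.
have [h1 h2] := contentP _ _ av.
rewrite /column1_increasing column1_fill; apply/idP/sitpP => [/(sorted_ltn_nth ltn_trans 0) h t tv|h].
  rewrite leqNgt; apply/negP; set j := size _ => jt.
  have jt2 : j < size a by apply: ltn_trans jt (h1 _ tv).
  have := h j (nth 0 v t); rewrite !inE size_map size_iota => /(_ jt2 (h1 _ tv) jt).
  rewrite !(nth_map 0) ?size_iota ?h1 // !nth_iota ?h1 // !add0n ltnS ltnNge => /negP; apply.
  apply: leq_trans (index_nth 0 tv) _; rewrite leqNgt; apply/negP=> jt3.
  have : j \in take t v by rewrite in_take_leq // ltnW.
  by rewrite -has_pred1 has_count -[count _ _]add0n -[X in X + _](nth_nil 0 j) -nth_sh nth_default.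
apply/(sortedP 0) => j; rewrite size_map size_iota => ja.
have ja' : j < size a by apply: ltnW.
rewrite !(nth_map 0) ?size_iota // !nth_iota // !add0n /= ltnS.
have iv : index j.+1 v < size v by rewrite index_mem mem_content.
have := h _ iv; rewrite nth_index ?mem_content //.
have pre : sit_path [::] (take (index j.+1 v) v).
  by move: (introT (sitpP _ _) h); rewrite -{1}(cat_take_drop (index j.+1 v) v) sitp_cat => /andP[].
rewrite -nth_pos; last exact: sitp_pos pre _.
rewrite nth_sh nth_nil -has_count has_pred1 => jt.
by rewrite -in_take_leq // ltnW.
Qed.

Lemma bx_take k t : t < k -> box_at (take k v) t = box_at v t.
Proof. by move=> tk; rewrite /box_at /earlier nth_take // take_takel // ltnW. Qed.

Lemma diagram_take k : k <= size v ->
  perm_eq [seq c <- diagram a | entry T c <= k] (diagram (shape_from [::] (take k v))).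
Proof.
move=> kv; have ck := sh_content (erefl (shape_from [::] (take k v))).
apply: uniq_perm; rewrite ?filter_uniq ?diagram_uniq // => c.
rewrite mem_filter; apply/andP/idP => [[ek /(diagram_bx av)[t tv ec]]|].
  move: ek; rewrite ec entry_bx // => tk.
  by rewrite -(bx_take tk) bx_diagram // size_takel.
case/(diagram_bx ck) => t; rewrite size_takel // => tk ->.
have tv : t < size v by apply: leq_trans kv.
by rewrite bx_take // entry_bx // bx_diagram.
Qed.

Lemma diagram_inj g h : all (leq 1) g -> all (leq 1) h -> diagram g =i diagram h -> g = h.
Proof.
move=> g0 h0 e.
have sz g' h' : all (leq 1) g' -> diagram g' =i diagram h' -> size g' <= size h'.
  move=> g0' e'; case: (posnP (size g')) => [-> // | sg].
  have := e' (1, size g'); rewrite !mem_diagram sg leqnn /=.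
  by rewrite nth_pos // prednK // leqnn => /esym /andP[].
have sgh : size g = size h by apply/eqP; rewrite eqn_leq !sz // => c; rewrite e.
apply: (@eq_from_nth _ 0) => // j jg.
have hc c : 0 < c -> (c <= nth 0 g j) = (c <= nth 0 h j).
  by move=> c0; have := e (c, j.+1); rewrite !mem_diagram /= -sgh jg c0.
apply/eqP; rewrite eqn_leq.
by rewrite -hc ?nth_pos // leqnn hc ?leqnn // nth_pos // -sgh.
Qed.

(** The boxes with entries at most [k] form the diagram of the shape of the prefix of length [k].
    This shape is a composition because rows open in order, and [diagram_inj] identifies it with any
    composition found by the peak-tableau condition. *)
Lemma peak_pkv : sit_path [::] v -> peak_tableau_condition T = peak_rows [::] v.
Proof.
move=> sv; rewrite /peak_tableau_condition (shape_fill av) -(size_content av).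
have pos k : all (leq 1) (shape_from [::] (take k v)).
  by apply: sitp_pos => //; move: sv; rewrite -{1}(cat_take_drop k v) sitp_cat => /andP[].
apply/allP/pkvP => h k.
  case: k => [|k] kv; first by rewrite take0.
  have /h/hasP[g] : k.+1 \in iota 1 (size v) by rewrite mem_iota.
  rewrite mem_compositions => /andP[g0 gk] /andP[pg pe].
  suff -> : shape_from [::] (take k.+1 v) = g by [].
  apply: diagram_inj => // c.
  by rewrite -(perm_mem pe) (perm_mem (diagram_take kv)).
rewrite mem_iota add1n ltnS => /andP[k0 kv]; apply/hasP; exists (shape_from [::] (take k v)).
  by rewrite mem_compositions /is_composition pos sumn_sh size_takel /=.
by rewrite h // diagram_take.
Qed.

End Fill.

(** * Descents of reading words *)

Definition descent_list (D : seq bool) : seq nat :=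
  [seq i <- iota 1 (size D) | nth false D i.-1].

Lemma sorted_index (R : rel nat) w x y : transitive R -> irreflexive R ->
    sorted R w -> x \in w -> y \in w -> x != y -> R x y || R y x ->
  (index x w < index y w) = R x y.
Proof.
move=> tr ir sw xw yw xy tot.
have H := sorted_ltn_index tr sw; case: ltngtP => h.
- by rewrite (H _ _ xw yw h).
- have Ryx := H _ _ yw xw h; apply/esym/negP=> Rxy.
  by have := tr _ _ _ Rxy Ryx; rewrite ir.
by case/eqP: xy; rewrite -(nth_index 0 xw) h nth_index.
Qed.

(** The reading word lists the entries by increasing boxes for [K], so positions in it are compared
    through boxes. Entry [i] lies in [box_at v i.-1] and entry [i.+1] in [box_at v i]. *)
Lemma descents_key (K : rel (nat * nat)) v w : transitive K -> irreflexive K ->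
    (forall x y, x != y -> K x y || K y x) ->
    perm_eq w (iota 1 (size v)) ->
    sorted K (map (fun e => box_at v e.-1) w) ->
    (forall s t, s < size v -> t < size v -> box_at v s = box_at v t -> s = t) ->
  descents w = [seq i <- iota 1 (size v).-1 | K (box_at v i) (box_at v i.-1)].
Proof.
move=> tr ir tot pw sw inj; have sz : size w = size v by rewrite (perm_size pw) size_iota.
rewrite /descents sz; apply: eq_in_filter => i; rewrite mem_iota add1n => /andP[i0 iv].
have mw e : (e \in w) = (0 < e <= size v) by rewrite (perm_mem pw) mem_iota add1n ltnS.
have iv' : i < size v by move: i0 iv; case: (size v) => [|k]; nlia.
have i'v : i.-1 < size v := leq_ltn_trans (leq_pred i) iv'.
pose R e f := K (box_at v e.-1) (box_at v f.-1).
have trR : transitive R by move=> x y z; apply: tr.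
have irR : irreflexive R by move=> x; apply: ir.
have swR : sorted R w by rewrite sorted_map in sw.
rewrite (sorted_index trR irR swR) ?mw ?i0 ?(ltnW iv') //; first by apply/eqP; nlia.
by apply: tot; apply/eqP => /(inj _ _ iv' i'v); nlia.
Qed.

Lemma bx_inj a v s t : content a v -> s < size v -> t < size v -> box_at v s = box_at v t -> s = t.
Proof.
by move=> av sv tv e; have := entry_bx av sv; rewrite e entry_bx // => -[->].
Qed.

Definition column_boxes (a : seq nat) (i : nat) : seq (nat * nat) :=
  [seq (i, j.+1) | j <- iota 0 (size a) & i <= nth 0 a j].

Lemma column_key a v i : content a v -> 0 < i ->
  map (fun e => box_at v e.-1) (column (fill (size a) v) i) = column_boxes a i.
Proof.
move=> av i0; rewrite /column /fill filter_map -!map_comp /column_boxes.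
rewrite (@eq_in_filter _ _ (fun j => i <= nth 0 a j)); last first.
  by move=> j _ /=; have [_ h] := contentP _ _ av; rewrite size_word_row h.
apply/eq_in_map => j; rewrite mem_filter mem_iota /= => /andP[ij ja].
have /(diagram_bx av)[t tv e] : (i, j.+1) \in diagram a.
  by rewrite mem_diagram /= ja i0.
have := entry_bx av tv; rewrite -e /entry /= nth_fill // => -> /=.
by rewrite -e.
Qed.

Lemma cols_sorted (K : rel (nat * nat)) a (I : seq nat) : transitive K ->
    (forall i j k, i \in I -> j < k -> K (i, j) (i, k)) ->
    (forall i i' j k, i \in I -> i' \in I -> i < i' -> K (i, j) (i', k)) ->
    sorted ltn I -> pairwise K (flatten [seq column_boxes a i | i <- I]).
Proof.
move=> tr h1 h2; elim: I h1 h2 => //= i I IHI h1 h2 iI.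
rewrite pairwise_cat; apply/and3P; split.
- apply/allrelP => x y /mapP[j _ ->] /flattenP[_ /mapP[i' i'I ->] /mapP[k _ ->]].
  apply: h2; rewrite ?inE ?eqxx ?i'I ?orbT //.
  exact: (allP (order_path_min ltn_trans iI)).
- rewrite -(sorted_pairwise tr) sorted_map.
  apply: (sub_sorted (e := ltn)) => [j k jk|]; first by apply: h1; rewrite ?mem_head.
  by apply: sorted_filter; [exact: ltn_trans | exact: iota_ltn_sorted].
apply: IHI; last exact: path_sorted iI.
- by move=> i' j k i'I; apply: h1; rewrite inE i'I orbT.
by move=> i1 i2 j k i1I i2I; apply: h2; rewrite inE ?i1I ?i2I orbT.
Qed.

Lemma num_columns_size T r : r \in T -> size r <= num_columns T.
Proof. by move=> rT; rewrite /num_columns; apply: (@leq_bigmax_seq _ _ xpredT). Qed.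

Lemma mem_column a v e i : content a v -> 0 < i ->
  e \in column (fill (size a) v) i -> 0 < e <= size v.
Proof.
move=> av i0 /mapP[r]; rewrite mem_filter => /andP[ir rT] ->.
have : nth 0 r i.-1 \in flatten (fill (size a) v).
  by apply/flattenP; exists r => //; rewrite mem_nth // prednK.
by rewrite (perm_mem (perm_fill av)) mem_iota add1n ltnS.
Qed.

Lemma in_column a v t : content a v -> t < size v ->
  t.+1 \in column (fill (size a) v) (earlier v t).+1.
Proof.
move=> av tv; apply/mapP; exists (word_row v (nth 0 v t)); last by rewrite nth_word_row.
rewrite mem_filter size_word_row occ_lt //=; apply/mapP; exists (nth 0 v t) => //.
by rewrite mem_iota /=; have [h _] := contentP _ _ av; apply: h.
Qed.

Lemma occ_columns a v t : content a v -> t < size v ->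
  (earlier v t).+1 <= num_columns (fill (size a) v).
Proof.
move=> av tv; apply: leq_trans (num_columns_size (r := word_row v (nth 0 v t)) _).
  by rewrite size_word_row occ_lt.
by apply/mapP; exists (nth 0 v t) => //; rewrite mem_iota; have [h _] := contentP _ _ av; apply: h.
Qed.

Definition lt_c (x y : nat * nat) : bool := (x.1 < y.1) || (x.1 == y.1) && (x.2 < y.2).

Definition lt_Y (x y : nat * nat) : bool :=
  (x.1 < y.1) || (x.1 == y.1) && (if x.1 == 1 then y.2 < x.2 else x.2 < y.2).

Lemma word_perm a v w : content a v -> uniq (map (fun e => box_at v e.-1) w) ->
    {subset w <= [pred e | 0 < e <= size v]} ->
    (forall t, t < size v -> t.+1 \in w) ->
  perm_eq w (iota 1 (size v)).
Proof.
move=> av uw sub sup; apply: uniq_perm; [exact: map_uniq uw | exact: iota_uniq |].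
move=> e; rewrite mem_iota add1n ltnS; apply/idP/idP => [/sub // |].
by case: e => // e /= ev; apply: sup.
Qed.

Lemma descents_word_c a v : content a v -> descents (word_c (fill (size a) v)) =
  [seq i <- iota 1 (size v).-1 | lt_c (box_at v i) (box_at v i.-1)].
Proof.
move=> av; set T := fill _ _.
have tr : transitive lt_c by move=> x y z; rewrite /lt_c; nlia.
have ir : irreflexive lt_c by move=> x; rewrite /lt_c !ltnn andbF.
have key : map (fun e => box_at v e.-1) (word_c T) =
    flatten [seq column_boxes a i | i <- iota 1 (num_columns T)].
  rewrite /word_c map_flatten -map_comp; congr flatten; apply/eq_in_map => i.
  by rewrite mem_iota => /andP[i0 _] /=; rewrite column_key.
have pw : pairwise lt_c (map (fun e => box_at v e.-1) (word_c T)).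
  rewrite key; apply: cols_sorted => //.
  - by move=> i j k _ jk; rewrite /lt_c /= eqxx jk orbT.
  - by move=> i i' j k _ _ ii'; rewrite /lt_c /= ii'.
  by apply: iota_ltn_sorted.
apply: descents_key => //.
- move=> [x1 x2] [y1 y2]; rewrite xpair_eqE /lt_c /=; nlia.
- apply: (word_perm av).
  + by apply: pairwise_uniq pw; apply: ir.
  + move=> e /flattenP[_ /mapP[i + ->]]; rewrite mem_iota => /andP[i0 _].
    exact: mem_column.
  move=> t tv; apply/flattenP; exists (column T (earlier v t).+1); last exact: in_column.
  by apply/mapP; exists (earlier v t).+1; rewrite // mem_iota /= add1n ltnS occ_columns.
- by rewrite sorted_pairwise.
by move=> s t sv tv; apply: bx_inj av sv tv.
Qed.

Lemma descents_word_Y a v : content a v -> descents (word_Y (fill (size a) v)) =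
  [seq i <- iota 1 (size v).-1 | lt_Y (box_at v i) (box_at v i.-1)].
Proof.
move=> av; set T := fill _ _.
have tr : transitive lt_Y by move=> x y z; rewrite /lt_Y; do !case: eqP; nlia.
have ir : irreflexive lt_Y by move=> x; rewrite /lt_Y !ltnn if_same andbF.
have key : map (fun e => box_at v e.-1) (word_Y T) =
    rev (column_boxes a 1) ++ flatten [seq column_boxes a i | i <- iota 2 (num_columns T).-1].
  rewrite /word_Y map_cat map_rev column_key // map_flatten -map_comp; congr (_ ++ flatten _).
  apply/eq_in_map => i.
  by rewrite mem_iota => /andP[i0 _] /=; rewrite column_key // ltnW.
have pw : pairwise lt_Y (map (fun e => box_at v e.-1) (word_Y T)).
  rewrite key pairwise_cat; apply/and3P; split.
  - apply/allrelP => x y; rewrite mem_rev => /mapP[j _ ->] /flattenP[_ /mapP[i + ->] /mapP[k _ ->]].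
    by rewrite mem_iota /lt_Y /= => /andP[-> _].
  - rewrite -(sorted_pairwise tr) rev_sorted sorted_map.
    apply: (sub_sorted (e := ltn)) => [j k jk|]; first by rewrite /lt_Y /= ltnS; exact: jk.
    by apply: sorted_filter; [exact: ltn_trans | exact: iota_ltn_sorted].
  apply: cols_sorted => //.
  - move=> i j k; rewrite mem_iota => /andP[i2 _] jk; rewrite /lt_Y /= eqxx jk.
    by case: eqP i2 => [->|]; rewrite ?orbT.
  - by move=> i i' j k _ _ ii'; rewrite /lt_Y /= ii'.
  by apply: iota_ltn_sorted.
apply: descents_key => //.
- move=> [x1 x2] [y1 y2]; rewrite xpair_eqE /lt_Y /=; do !case: eqP; nlia.
- apply: (word_perm av).
  + by apply: pairwise_uniq pw; apply: ir.
  + move=> e; rewrite mem_cat mem_rev => /orP[|/flattenP[_ /mapP[i + ->]]].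
      exact: mem_column.
    by rewrite mem_iota => /andP[i0 _]; apply: mem_column => //; apply: ltnW.
  move=> t tv; rewrite mem_cat mem_rev; have h := in_column av tv.
  case e: (earlier v t) h => [|c] h; first by rewrite h.
  apply/orP; right; apply/flattenP; exists (column T c.+2) => //.
  apply/mapP; exists c.+2; rewrite // mem_iota /=.
  by have := occ_columns av tv; rewrite e -/T; nlia.
- by rewrite sorted_pairwise.
by move=> s t sv tv; apply: bx_inj av sv tv.
Qed.

(** * Immaculate and composition tableaux as words *)

Lemma nth_boxes s v t : t < size v ->
  nth (0, 0) (boxes s v) t = ((nth 0 s (nth 0 v t) + earlier v t).+1, nth 0 v t).
Proof.
elim: v s t => // j v IHv s [|t] tv; first by rewrite /earlier /= addn0.
rewrite /= IHv // nth_incr_nth /earlier /=; congr ((_).+1, _).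
by rewrite -addnA addnCA.
Qed.

Lemma size_boxes s v : size (boxes s v) = size v.
Proof. by rewrite -(size_map snd) boxes_snd. Qed.

Lemma size_desbits (T : Type) (r : rel T) w : size (descent_bits r w) = (size w).-1.
Proof. by case: w => //= x w; rewrite size_pairmap. Qed.

Lemma nth_desbits (T : Type) (r : rel T) x0 w i : 0 < i -> i < size w ->
  nth false (descent_bits r w) i.-1 = r (nth x0 w i.-1) (nth x0 w i).
Proof.
by case: w i => // x w [|i] // _ iw; rewrite /= (nth_pairmap x0).
Qed.

Lemma descent_listE (T : Type) (r : rel T) x0 (w : seq T) (P : pred nat) :
    (forall i, 0 < i -> i < size w -> r (nth x0 w i.-1) (nth x0 w i) = P i) ->
  [seq i <- iota 1 (size w).-1 | P i] = descent_list (descent_bits r w).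
Proof.
move=> h; rewrite /descent_list size_desbits; apply/eq_in_filter => i.
rewrite mem_iota add1n => /andP[i0 iw].
have iw' : i < size w by move: i0 iw; case: (size w) => [|k]; nlia.
by rewrite (nth_desbits _ x0) // h.
Qed.

Lemma descents_c_bits a v : content a v -> descents (word_c (fill (size a) v)) =
  descent_list (descent_bits (fun x y => ~~ le_c x y) (boxes [::] v)).
Proof.
move=> av; rewrite (descents_word_c av) -(size_boxes [::] v).
apply: (@descent_listE _ _ (0, 0)) => i i0; rewrite size_boxes => iv.
have iv' : i.-1 < size v by nlia.
by rewrite !nth_boxes // !nth_nil /le_c /lt_c /=; nlia.
Qed.

Lemma SPIT_sum a (F : seq nat -> int) : all (leq 1) a ->
  (\sum_(T <- SPIT a) F (descents (word_c T)) =
   \sum_(v <- [seq v <- sit_words a | peak_rows [::] v])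
      F (descent_list (descent_bits (fun x y => ~~ le_c x y) (boxes [::] v))))%R.
Proof.
move=> a0; apply/esym; apply: (@big_bij _ _ (fill (size a))).
- by rewrite filter_uniq // sits_uniq.
- by rewrite filter_uniq // fillings_uniq.
- move=> v w; rewrite ![_ \in [seq _ <- sit_words a | _]]mem_filter !mem_sits => /and3P[_ _ /eqP/sh_content av] /and3P[_ _ /eqP/sh_content aw].
  exact: fill_inj.
- move=> v; rewrite [_ \in [seq _ <- sit_words a | _]]mem_filter mem_sits [_ \in SPIT a]mem_filter => /and3P[pv sv /eqP/sh_content av].
  by rewrite fill_rows column1_sitp // sv peak_pkv // pv fill_fillings.
- move=> T; rewrite mem_filter => /andP[/and3P[rT cT pT] /fill_surj/(_ rT)[v av eT]].
  rewrite eT column1_sitp // in cT; rewrite eT peak_pkv // in pT.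
  by exists v; rewrite // mem_filter mem_sits pT cT (content_sh a0 av) eqxx.
by move=> v; rewrite mem_filter mem_sits => /and3P[_ _ /eqP/sh_content av]; rewrite descents_c_bits.
Qed.

(** The triple condition of composition tableaux, turned into a condition on the row that receives
    the next entry. *)
Definition yct_step (s : seq nat) (j : nat) : bool :=
  (0 < nth 0 s j) ==> all (fun i => nth 0 s i != nth 0 s j) (iota j.+1 (size s - j.+1)).

Lemma ystepP s j : reflect (0 < nth 0 s j -> forall i, j < i -> nth 0 s i <> nth 0 s j) (yct_step s j).
Proof.
apply: (iffP implyP) => h sj; have := h sj.
  move=> /allP h1 i ji; case: (ltnP i (size s)) => si; last by rewrite nth_default //; nlia.
  by apply/eqP/h1; rewrite mem_iota ji /=; nlia.
by move=> h1; apply/allP => i; rewrite mem_iota => /andP[ji _]; apply/eqP/h1.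
Qed.

Fixpoint yct_path (s v : seq nat) : bool :=
  if v is j :: v' then [&& j <= size s, yct_step s j & yct_path (incr_nth s j) v'] else true.

Lemma yctpP s v : reflect (forall t, t < size v -> nth 0 v t <= size (shape_from s (take t v)) /\
    yct_step (shape_from s (take t v)) (nth 0 v t)) (yct_path s v).
Proof.
elim: v s => [|j v IHv] s /=; first exact: ReflectT.
apply: (iffP and3P) => [[js yj /IHv h] [|t] //| h]; first exact: h.
have [h1 h2] := h 0 isT.
by split=> //; apply/IHv => t tv; exact: (h t.+1).
Qed.

Lemma up_step l s : can_up l s -> all (leq 1) s ->
  exists j, [/\ j <= size s, up l s = incr_nth s j, (nth 0 s j).+1 = l & yct_step s j].
Proof.
elim: s => [|r s IHs].
  by rewrite /can_up in_nil andbF orbF => /eqP-> _; exists 0.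
move=> cu /= /andP[r0 s0]; case: ifP => [cus | ncu].
  have [j [js -> hj yj]] := IHs cus s0; exists j.+1; split=> //.
  apply/ystepP => /= sj [|i] // ij; exact: (ystepP _ _ yj).
have [l1 rl] : 1 < l /\ r = l.-1.
  by move: cu ncu; rewrite /can_up inE; case: (l == 1) => //=; case: (ltnP 1 l) => //= _ h1 h2; move: h1; rewrite h2 orbF => /eqP->.
exists 0; split; rewrite //=; first by rewrite rl prednK // ltnW.
  by rewrite rl prednK // ltnW.
apply/ystepP => /= _ [|i] // _ /= si.
have : l.-1 \in s; last by move: ncu; rewrite can_upE // -mem_count => ->.
rewrite -rl -si mem_nth // ltnNge; apply/negP=> h.
by rewrite nth_default // in si; rewrite -si in r0.
Qed.

(** This is why the column of a new entry determines its row, and the column word determines the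
    tableau. *)
Lemma ystep_inj s i j : all (leq 1) s -> i <= size s -> j <= size s ->
  yct_step s i -> yct_step s j -> nth 0 s i = nth 0 s j -> i = j.
Proof.
move=> s0 si sj /ystepP yi /ystepP yj e.
case: (posnP (nth 0 s i)) => [z | p].
  have : i >= size s by rewrite leqNgt -nth_pos // z.
  have : j >= size s by rewrite leqNgt -nth_pos // -e z.
  by nlia.
by case: (ltngtP i j) => // ij; [case: (yi p _ ij) | case: (yj _ _ ij); rewrite -?e].
Qed.

Lemma step_up s j : all (leq 1) s -> j <= size s -> yct_step s j ->
  can_up (nth 0 s j).+1 s /\ up (nth 0 s j).+1 s = incr_nth s j.
Proof.
move=> s0 sj yj; have cu : can_up (nth 0 s j).+1 s.
  rewrite /can_up eqSS; case: (posnP (nth 0 s j)) => [->|p] //=.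
  by rewrite ltnS p mem_nth ?orbT // -nth_pos.
split=> //; have [i [si -> ei yi]] := up_step cu s0.
by congr incr_nth; apply: ystep_inj si sj yi yj _; case: ei.
Qed.

Lemma incr_pos s j : all (leq 1) s -> j <= size s -> all (leq 1) (incr_nth s j).
Proof. by move=> s0 js; apply: (@sitp_pos s [:: j]) => //=; rewrite js. Qed.

Lemma yctp_upath s v : all (leq 1) s -> yct_path s v ->
  let u := map fst (boxes s v) in
  [/\ column_path s u, add_columns s u = shape_from s v & peak_columns s u = peak_rows s v].
Proof.
elim: v s => //= j v IHv s s0 /and3P[sj yj yv].
have [cu eu] := step_up s0 sj yj; have [h1 h2 h3] := IHv _ (incr_pos s0 sj) yv.
split; first by rewrite cu eu.
  by rewrite -[LHS]/(add_columns (up (nth 0 s j).+1 s) _) eu h2.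
by rewrite eu h3.
Qed.

Lemma yctp_inj s v w : all (leq 1) s -> yct_path s v -> yct_path s w ->
  map fst (boxes s v) = map fst (boxes s w) -> v = w.
Proof.
elim: v s w => [|j v IHv] s [|k w] //= s0 /and3P[sj yj yv] /and3P[sk yk yw] [e].
have ejk : j = k by apply: ystep_inj sj sk yj yk e.
by rewrite ejk in yv * => /(IHv _ _ (incr_pos s0 sk) yv yw) ->.
Qed.

Lemma yctp_surj s u : all (leq 1) s -> column_path s u ->
  exists2 v, yct_path s v & map fst (boxes s v) = u.
Proof.
elim: u s => [|l u IHu] s s0 /=; first by exists [::].
move=> /andP[cu]; have [j [sj -> <- yj]] := up_step cu s0 => uu.
have [v yv <-] := IHu _ (incr_pos s0 sj) uu.
by exists (j :: v); rewrite //= sj yj.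
Qed.

Lemma yctp_sitp s v : yct_path s v -> sit_path s v.
Proof. by elim: v s => //= j v IHv s /and3P[-> _ /IHv ->]. Qed.

Lemma occ_sh v t : earlier v t = nth 0 (shape_from [::] (take t v)) (nth 0 v t).
Proof. by rewrite nth_sh nth_nil. Qed.

Lemma sh_rcons s v j : shape_from s (rcons v j) = incr_nth (shape_from s v) j.
Proof. exact: foldl_rcons. Qed.

Lemma take_pred (v : seq nat) i : 0 < i -> i < size v ->
  take i v = rcons (take i.-1 v) (nth 0 v i.-1).
Proof. by case: i => // i _ iv; rewrite (take_nth 0) // ltnW. Qed.

Lemma occ_take_lt v s t : s < t -> t < size v ->
  earlier v s < count_mem (nth 0 v s) (take t v).
Proof.
move=> st tv; have := @occ_lt (take t v) s; rewrite size_takel; last exact: ltnW.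
by move=> /(_ st); have [] := bx_take v st => -> ->.
Qed.

Lemma occ_before v k j c : k <= size v -> c < count_mem j (take k v) ->
  exists2 s, s < k & nth 0 v s = j /\ earlier v s = c.
Proof.
move=> kv cj; have ck := sh_content (erefl (shape_from [::] (take k v))).
have : (c.+1, j.+1) \in diagram (shape_from [::] (take k v)).
  rewrite mem_diagram /= nth_sh nth_nil cj andbT ltnNge; apply/negP=> h.
  by have := nth_sh [::] (take k v) j; rewrite nth_nil nth_default // add0n => e; rewrite -e in cj.
case/(diagram_bx ck) => s; rewrite size_takel // => sk.
by rewrite bx_take // => -[-> ->]; exists s.
Qed.

(** Only consecutive entries in the same column need an argument, and they always form a descent. In
    column 1 the later entry is higher and is read first; in any other column the rule of the
    topmost row puts it into a lower row, again read first. *)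
Lemma descents_Y_bits a v : content a v -> all (leq 1) a -> yct_path [::] v ->
  descents (word_Y (fill (size a) v)) =
  descent_list (descent_bits weak_descent (map fst (boxes [::] v))).
Proof.
move=> av a0 yv; rewrite (descents_word_Y av) -(size_boxes [::] v) -(size_map fst).
apply: (@descent_listE _ _ 0) => i i0; rewrite size_map size_boxes => iv.
have iv' : i.-1 < size v by nlia.
rewrite !(nth_map (0, 0)) ?size_boxes // !nth_boxes // !nth_nil /weak_descent /lt_Y /=.
rewrite ltnS leq_eqVlt orbC; congr (_ || _); rewrite !add0n eqSS.
case: eqP => //= eo; rewrite !ltnS.
have [h1 /ystepP h2] := yctpP _ _ yv _ iv'.
move: eo h1 h2; rewrite !occ_sh (take_pred i0 iv) sh_rcons nth_incr_nth.
set s := shape_from [::] (take i.-1 v); set r := nth 0 v i.-1; set r' := nth 0 v i => eo h1 h2.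
have s0 : all (leq 1) s.
  apply: sitp_pos => //; move: (yctp_sitp yv).
  by rewrite -{1}(cat_take_drop i.-1 v) sitp_cat => /andP[].
case: (ltngtP r r') eo h2 => [rr'|r'r|<-]; last by move=> eo; exfalso; nlia.
  rewrite add0n => eo h2; rewrite eo; case: (posnP (nth 0 s r)) => [-> // | p].
  by case: (h2 p _ rr').
rewrite add0n => eo h2.
have r's : r' < size s by apply: leq_trans h1.
have p : 0 < nth 0 s r' by rewrite nth_pos.
by rewrite eqSS gtn_eqF.
Qed.

(** When an entry is placed in column [k.+1] of a row, the triple condition fails for a higher row
    if that row has its box in column [k] but not yet the one in column [k.+1]: its length at that
    moment is exactly [k], the length of the row being extended. *)
Lemma yctp_condition a v : content a v -> sit_path [::] v ->
  composition_tableau_condition (fill (size a) v) = yct_path [::] v.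
Proof.
move=> av sv; rewrite /composition_tableau_condition (shape_fill av) (all_diagram av).
have D k j : (k, j.+1) \in diagram a -> exists2 t, t < size v & nth 0 v t = j /\ (earlier v t).+1 = k.
  by case/(diagram_bx av) => t tv [-> ->]; exists t.
apply/allP/yctpP => [h t tv | h s].
  split; first exact: (sitpP _ _ sv).
  apply/ystepP; rewrite -occ_sh => o0 i ji; rewrite nth_sh nth_nil add0n => ci.
  have := occ_before (v := v) (k := t) (j := i) (c := (earlier v t).-1).
  rewrite ci prednK // leqnn => /(_ (ltnW tv) isT)[s st [vs os]].
  have sv' : s < size v by apply: ltn_trans tv.
  have /h : s \in iota 0 (size v) by rewrite mem_iota.
  rewrite (all_diagram av) => /allP /(_ t); rewrite mem_iota => /(_ tv).
  rewrite !entry_bx // /= os vs prednK // eqxx !ltnS ji (ltnW st) /=.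
  case/andP=> /D[s' s'v [vs' os']].
  have -> : ((earlier v t).+1, i.+1) = box_at v s' by rewrite /box_at vs' os'.
  rewrite entry_bx // => s't.
  have : earlier v s' < count_mem i (take t v) by rewrite -vs' occ_take_lt.
  by rewrite ci; move: os' => [->]; rewrite ltnn.
rewrite mem_iota => sv'; rewrite (all_diagram av); apply/allP => t.
rewrite mem_iota => tv; rewrite !entry_bx //; apply/implyP => /= /and3P[/eqP[o] vts st].
have st' : s < t.
  by rewrite ltn_neqAle -ltnS st andbT; apply/eqP => e; move: vts; rewrite e ltnn.
have [_ /ystepP] := h t tv; rewrite -occ_sh o => /(_ isT _ vts).
rewrite nth_sh nth_nil add0n => ne.
have lt : earlier v s < count_mem (nth 0 v s) (take t v) by rewrite occ_take_lt.
have := occ_before (v := v) (k := t) (j := nth 0 v s) (c := (earlier v s).+1) (ltnW tv).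
case=> [|s' s't [vs' os']]; first by rewrite ltn_neqAle lt andbT; apply/eqP => e; case: ne.
have s'v : s' < size v by apply: ltn_trans tv.
have -> : ((earlier v s).+2, (nth 0 v s).+1) = box_at v s' by rewrite /box_at vs' os'.
by rewrite bx_diagram // entry_bx // ltnS.
Qed.

Lemma SPYCT_sum b (F : seq nat -> int) : all (leq 1) b ->
  (\sum_(P <- SPYCT b) F (descents (word_Y P)) =
   \sum_(u <- [seq u <- column_words b | peak_columns [::] u]) F (descent_list (descent_bits weak_descent u)))%R.
Proof.
(* Row words mediate between fillings and column words. *)
move=> b0; pose Z := [seq v <- [seq v <- sit_words b | yct_path [::] v] | peak_rows [::] v].
have memZ v : (v \in Z) = [&& peak_rows [::] v, yct_path [::] v & shape_from [::] v == b].
  rewrite mem_filter mem_filter mem_sits; case: (boolP (yct_path _ _)) => // /yctp_sitp ->.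
  by [].
have uZ : uniq Z by do 2 apply: filter_uniq; exact: sits_uniq.
transitivity (\sum_(v <- Z) F (descent_list (descent_bits weak_descent (map fst (boxes [::] v)))))%R.
  apply/esym; apply: (@big_bij _ _ (fill (size b))) => //.
  - by rewrite !filter_uniq // fillings_uniq.
  - move=> v w; rewrite !memZ => /and3P[_ _ /eqP/sh_content av] /and3P[_ _ /eqP/sh_content aw].
    exact: fill_inj.
  - move=> v; rewrite memZ => /and3P[pv yv /eqP/sh_content av].
    have sv := yctp_sitp yv.
    rewrite mem_filter mem_filter fill_rows column1_sitp // sv yctp_condition // yv.
    by rewrite peak_pkv // pv fill_fillings.
  - move=> P; rewrite mem_filter mem_filter => /andP[pP /andP[/and3P[rP cP yP] /fill_surj/(_ rP)[v av eP]]].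
    rewrite eP column1_sitp // in cP; rewrite eP yctp_condition // in yP; rewrite eP peak_pkv // in pP.
    by exists v; rewrite // memZ pP yP (content_sh b0 av) eqxx.
  by move=> v; rewrite memZ => /and3P[_ yv /eqP/sh_content av]; rewrite descents_Y_bits.
apply: (@big_bij _ _ (fun v => map fst (boxes [::] v))) => //.
- by rewrite filter_uniq // upaths_uniq.
- by move=> v w; rewrite !memZ => /and3P[_ yv _] /and3P[_ yw _]; apply: yctp_inj yv yw.
- move=> v; rewrite memZ mem_filter mem_upaths => /and3P[pv yv /eqP shv].
  by have [-> -> ->] := @yctp_upath [::] v isT yv; rewrite shv pv eqxx.
move=> u; rewrite mem_filter mem_upaths => /and3P[pu uu ub].
have [v yv ev] := @yctp_surj [::] u isT uu; exists v => //.
have [_ ush ups'] := @yctp_upath [::] v isT yv.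
by rewrite memZ yv -ups' -ush ev pu ub.
Qed.

(** * Recording tableaux *)

Definition column_indices (s v : seq nat) : seq nat := map fst (boxes s v).

(** All rows are present from the start, some still empty, because they open from the top downwards;
    the second part expresses this. The first part is the recording condition: it makes the extended
    row the lowest one of its new length, where [down] removes the box. *)
Definition dirt_step (s : seq nat) (j : nat) : bool :=
  all (fun i => (nth 0 s i != (nth 0 s j).+1) && ((nth 0 s j == 0) ==> (nth 0 s i == 0)))
      (iota 0 j).

Lemma dstepP s j : reflect (forall i, i < j -> nth 0 s i <> (nth 0 s j).+1 /\
    (nth 0 s j = 0 -> nth 0 s i = 0)) (dirt_step s j).
Proof.
apply: (iffP allP) => h i.
  move=> ij; have /andP[/eqP h1 /implyP h2] : _ := h i ltac:(by rewrite mem_iota).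
  by split=> // /eqP/h2/eqP.
rewrite mem_iota => /h[/eqP h1 h2]; apply/andP; split=> //.
by apply/implyP => /eqP/h2/eqP.
Qed.

Fixpoint dirt_path (s v : seq nat) : bool :=
  if v is j :: v' then dirt_step s j && dirt_path (incr_nth s j) v' else true.

Lemma dpath_cat s v w : dirt_path s (v ++ w) = dirt_path s v && dirt_path (shape_from s v) w.
Proof. by elim: v s => //= j v IHv s; rewrite IHv andbA. Qed.

Lemma cols_cat s v w : column_indices s (v ++ w) = column_indices s v ++ column_indices (shape_from s v) w.
Proof. by rewrite /column_indices boxes_cat map_cat. Qed.

Lemma size_cols s v : size (column_indices s v) = size v.
Proof. by rewrite size_map size_boxes. Qed.

Lemma sh_succ x s w : shape_from (x :: s) (map S w) = x :: shape_from s w.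
Proof. by elim: w s => //= j w IHw s; rewrite IHw. Qed.

Lemma cols_succ x s w : column_indices (x :: s) (map S w) = column_indices s w.
Proof. by elim: w s => //= j w IHw s; rewrite /column_indices /= -!/(column_indices _ _) IHw. Qed.

Lemma dstep_succ x s j : dirt_step (x :: s) j.+1 =
  [&& x != (nth 0 s j).+1, (nth 0 s j == 0) ==> (x == 0) & dirt_step s j].
Proof.
rewrite /dirt_step /= -andbA; do 2 congr (_ && _).
by rewrite (iotaDl 1 0) all_map; apply: eq_all => i.
Qed.

Lemma dpath_succ0 s w : dirt_path (0 :: s) (map S w) = dirt_path s w.
Proof. by elim: w s => //= j w IHw s; rewrite dstep_succ /= implybT IHw. Qed.

Lemma dpath_succ b s y : 0 < b -> all (ltn b) (column_indices s y) ->
  dirt_path (b :: s) (map S y) = dirt_path s y.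
Proof.
move=> b0; elim: y s => //= j y IHy s; rewrite /column_indices /= -/(column_indices _ _) => /andP[bj bc].
rewrite dstep_succ IHy // (ltn_eqF bj) /= gtn_eqF //.
by rewrite -ltnS in bj; apply: leq_trans b0 _.
Qed.

Lemma cols_zero n (s : seq nat) c : column_indices (c :: s) (nseq n 0) = iota c.+1 n.
Proof. by elim: n c => //= n IHn c; rewrite /column_indices /= -/(column_indices _ _) IHn. Qed.

Lemma sh_zero n c (s : seq nat) : shape_from (c :: s) (nseq n 0) = (c + n) :: s.
Proof. by elim: n c => [|n IHn] c /=; rewrite ?addn0 // IHn addSnnS. Qed.

Lemma dpath_zero n (s : seq nat) c : dirt_path (c :: s) (nseq n 0).
Proof. by elim: n c => //= n IHn c; rewrite IHn. Qed.

(** The rows from which [downs] takes the boxes, in the order in which the boxes are added back. *)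
Fixpoint downrows (S s : seq nat) : seq nat :=
  if S is k :: S' then index k (downs S' s) :: downrows S' s else [::].

Lemma size_down k s : size (down k s) = size s.
Proof. by elim: s => //= r s IHs; case: ifP => //= _; rewrite IHs. Qed.

Lemma nth_down k s i : nth 0 (down k s) i =
  if (i == index k s) && (i < size s) then k.-1 else nth 0 s i.
Proof.
elim: s i => [|r s IHs] i /=; first by rewrite andbF.
by case: (r =P k) => rk; case: i => [|i] //=; rewrite IHs.
Qed.

Lemma down_pos k s : 1 < k -> all (leq 1) s -> all (leq 1) (down k s).
Proof.
move=> k1; elim: s => //= r s IHs /andP[r0 s0]; case: ifP => _ /=; rewrite ?s0 ?r0 ?IHs //.
by move: k1; clear; case: k => [|[]].
Qed.

Lemma downs_pos b S s : 0 < b -> strip b S s -> all (leq 1) s -> all (leq 1) (downs S s).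
Proof.
elim: S b => //= k S IHS b b0 /strip_cons[kS bk _ _] s0.
by apply: down_pos; [nlia | apply: IHS kS s0; nlia].
Qed.

Lemma size_downs S s : size (downs S s) = size s.
Proof. by elim: S => //= k S IHS; rewrite size_down. Qed.

Lemma downrows_ok b S t : 0 < b -> strip b S t -> all (leq 1) t ->
  let s := downs S t in let y := downrows S t in
  [/\ shape_from s y = t, column_indices s y = S, dirt_path s y & all (gtn (size t)) y].
Proof.
elim: S b => //= k S IHS b b0 kS t0; have [sS bk knS _] := strip_cons kS.
have k0 : 0 < k by nlia.
have [h1 h2 h3 h4] := IHS k k0 sS t0.
have kX := mem_downs_hd b0 kS.
set X := downs S t in h1 h2 h3 kX *; set j := index k X.
have jX : j < size X by rewrite index_mem.
have sj : nth 0 (down k X) j = k.-1 by rewrite nth_down eqxx jX.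
have eX : incr_nth (down k X) j = X.
  apply: (@eq_from_nth _ 0) => [|i]; first by rewrite size_incr_nth size_down jX.
  rewrite size_incr_nth size_down jX => iX; rewrite nth_incr_nth nth_down -/j eq_sym.
  by case: (i =P j) => [->|] //=; rewrite jX add1n prednK // nth_index.
rewrite /column_indices /= -/(column_indices _ _) eX h2 h1 h3 sj prednK // h4 andbT; split=> //.
  apply/dstepP => i ij; rewrite sj prednK //; have iX := ltn_trans ij jX.
  rewrite nth_down -/j (ltn_eqF ij) /=; split; last by nlia.
  by move=> e; have := before_find 0 ij; rewrite /= e eqxx.
by rewrite andbT -(size_downs S t).
Qed.

(** By [dirt_step], [down] finds the row that the path has extended, so the columns and the final
    shape determine the path. *)
Lemma downrows_uniq s y : all (gtn (size s)) y -> dirt_path s y ->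
  downs (column_indices s y) (shape_from s y) = s /\ downrows (column_indices s y) (shape_from s y) = y.
Proof.
elim: y s => //= j y IHy s /andP[js ys] /andP[dj dy].
have [|e1 e2] := IHy (incr_nth s j) _ dy.
  by apply/allP => x /(allP ys); rewrite /= size_incr_nth js.
rewrite /column_indices /= -!/(column_indices _ _) e1 e2.
have ej : index (nth 0 s j).+1 (incr_nth s j) = j.
  have nj : nth 0 (incr_nth s j) j = (nth 0 s j).+1 by rewrite nth_incr_nth eqxx.
  rewrite -nj; apply/eqP; rewrite eqn_leq index_nth ?size_incr_nth ?js //= leqNgt.
  set i := index _ _; apply/negP=> lt; have [] := dstepP _ _ dj _ lt; case.
  have : nth 0 (incr_nth s j) i = nth 0 (incr_nth s j) j.
    by rewrite nth_index // mem_nth // size_incr_nth js.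
  by rewrite nj nth_incr_nth (gtn_eqF lt) add0n.
rewrite ej; split=> //; apply: (@eq_from_nth _ 0) => [|i]; rewrite size_down size_incr_nth js //.
move=> si; rewrite nth_down ej size_incr_nth js si andbT nth_incr_nth.
by rewrite [j == i]eq_sym; case: eqP => [->|].
Qed.

Lemma cols_stays s y j : 0 < nth 0 s j ->
  nth 0 s j \in shape_from s y \/ (nth 0 s j).+1 \in column_indices s y.
Proof.
elim: y s => [|i y IHy] s sj /=.
  by left; apply: mem_nth; rewrite ltnNge; apply/negP=> h; rewrite nth_default in sj.
case: (i =P j) => [-> | ij]; first by right; rewrite /column_indices /= mem_head.
have e : nth 0 (incr_nth s i) j = nth 0 s j by rewrite nth_incr_nth; case: eqP.
have := IHy (incr_nth s i); rewrite e => /(_ sj) [h|h]; first by left.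
by right; rewrite /column_indices /= inE h orbT.
Qed.

Lemma cols_next s y k : k \in column_indices s y -> (k \in shape_from s y) || (k.+1 \in column_indices s y).
Proof.
elim: y s => //= j y IHy s; rewrite /column_indices /= !inE -/(column_indices _ _).
case/orP=> [/eqP -> | /IHy /orP[-> //|->]]; last by rewrite !orbT.
have := @cols_stays (incr_nth s j) y j; rewrite nth_incr_nth eqxx => -[//|->//|->].
by rewrite !orbT.
Qed.

(** A row that reaches length [k] keeps it to the end or is extended later in column [k.+1], as the
    definition of a strip requires. *)
Lemma strip_cols b s y : path ltn b (column_indices s y) -> strip b (column_indices s y) (shape_from s y).
Proof.
move=> p; apply/stripP; split=> [|k ks]; first exact: path_sorted p.
by split; [apply: (allP (order_path_min ltn_trans p)) | apply: cols_next].
Qed.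

(** The bottom row could only be extended in column [c.+1], which the columns already used have
    reached. *)
Lemma no_zero k c s z : c < k -> path ltn k (column_indices (c :: s) z) -> 0 \notin z.
Proof.
elim: z k s => //= -[|j] z IHz k s ck; rewrite /column_indices /= -/(column_indices _ _) => /andP[kc pc].
  by move: kc; rewrite ltnS leqNgt ck.
by rewrite inE /=; apply: IHz pc; apply: ltn_trans kc.
Qed.

Lemma nz_succ z : 0 \notin z -> z = map S (map predn z).
Proof.
move=> z0; rewrite -map_comp -[LHS]map_id; apply/eq_in_map => -[|x] //.
by rewrite (negPf z0).
Qed.

(** By [no_zero], once a row strip leaves the bottom row it never returns to it. *)
Lemma zero_prefix c s z b0 s' : path ltn c (column_indices (c :: s) z) ->
  shape_from (c :: s) z = b0 :: s' -> c <= b0 /\ exists y, z = nseq (b0 - c) 0 ++ map S y.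
Proof.
elim: z c s => [|[|j] z IHz] c s /=.
- by move=> _ [-> _]; split=> //; exists [::]; rewrite subnn.
- rewrite /column_indices /= -/(column_indices _ _) => /andP[_ p] e.
  have [cb [y ->]] := IHz _ _ p e; split; first exact: ltnW.
  by exists y; rewrite -(subnSK cb).
rewrite /column_indices /= -/(column_indices _ _) => /andP[cj p].
have z0 := no_zero cj p; rewrite (nz_succ z0) sh_succ => -[<- _]; split=> //.
by exists (j :: map predn z); rewrite subnn.
Qed.

(* The partial sums of g (including 0) are the positions, counted from 0, at
   which the row strips begin. *)
Definition strip_ok (g cs : seq nat) : bool :=
  (size cs == sumn g) && all (fun e => if e \in 0 :: scanl addn 0 g then nth 0 cs e == 1
                                       else nth 0 cs e.-1 < nth 0 cs e) (iota 0 (sumn g)).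

Lemma scanl_rcons k g a : scanl addn k (rcons g a) = rcons (scanl addn k g) (k + sumn g + a).
Proof. by elim: g k => [|x g IHg] k /=; rewrite ?addn0 // IHg addnA. Qed.

Lemma mem_scanl_le k g e : e \in k :: scanl addn k g -> e <= k + sumn g.
Proof.
elim: g k => [|x g IHg] k /=; first by rewrite inE addn0 => /eqP->.
rewrite inE => /orP[/eqP-> | /IHg]; last by rewrite addnA.
exact: leq_addr.
Qed.

Lemma mem_scanl_last k g : k + sumn g \in k :: scanl addn k g.
Proof.
elim: g k => [|x g IHg] k /=; first by rewrite addn0 mem_head.
by rewrite inE addnA IHg orbT.
Qed.

Lemma strip_ok_rcons g a c1 c2 : 0 < a -> size c1 = sumn g ->
  strip_ok (rcons g a) (c1 ++ c2) =
  [&& strip_ok g c1, size c2 == a, head 0 c2 == 1 & sorted ltn c2].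
Proof.
move=> a0 s1; rewrite /strip_ok scanl_rcons add0n sumn_rcons size_cat s1 eqn_add2l eqxx.
case: (size c2 =P a) => [s2 | _]; last by rewrite andbF.
rewrite iotaD all_cat add0n andTb; congr (_ && _).
  apply: eq_in_all => e; rewrite mem_iota /= => eg.
  rewrite -rcons_cons mem_rcons inE nth_cat s1 eg nth_cat s1 (leq_ltn_trans (leq_pred e) eg).
  by rewrite (_ : (e == _) = false) //; apply/eqP; nlia.
case: c2 s2 => [|x c2] s2; first by rewrite -s2 in a0.
rewrite -s2 /= -rcons_cons nth_cat s1 ltnn subnn mem_rcons inE.
have -> : sumn g \in 0 :: scanl addn 0 g by rewrite -{1}[sumn g]add0n mem_scanl_last.
rewrite orbT; congr (_ && _).
apply/allP/(pathP 0) => [h i i2 | h e].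
  have := h (sumn g + i.+1); rewrite mem_iota !nth_cat s1.
  have -> : (sumn g + i.+1 \in rcons (0 :: scanl addn 0 g) (sumn g + (size c2).+1)) = false.
    rewrite mem_rcons inE eqn_add2l eqSS (ltn_eqF i2) /=; apply/negP=> /mem_scanl_le.
    by rewrite add0n; nlia.
  rewrite addnS /=.
  have -> : (sumn g + i).+1 < sumn g = false by nlia.
  have -> : sumn g + i < sumn g = false by nlia.
  have -> : (sumn g + i).+1 - sumn g = i.+1 by nlia.
  have -> : sumn g + i - sumn g = i by nlia.
  by apply; nlia.
rewrite mem_iota => /andP[ge el]; pose i := e - (sumn g).+1.
have ei : e = (sumn g + i).+1 by rewrite /i; nlia.
have i2 : i < size c2 by nlia.
have := h i i2; rewrite ei !nth_cat s1.
have -> : ((sumn g + i).+1 \in rcons (0 :: scanl addn 0 g) (sumn g + (size c2).+1)) = false.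
  rewrite mem_rcons inE -addnS eqn_add2l eqSS (ltn_eqF i2) /=; apply/negP=> /mem_scanl_le.
  by rewrite add0n; nlia.
have -> : (sumn g + i).+1 < sumn g = false by nlia.
have -> : (sumn g + i).+1.-1 < sumn g = false by nlia.
have -> : (sumn g + i).+1 - sumn g = i.+1 by nlia.
by have -> : (sumn g + i).+1.-1 - sumn g = i by nlia.
Qed.

Arguments strips : simpl never.

(* The entries of the last row strip consist of the whole bottom row followed by
   the boxes removed by Z. *)
Fixpoint dirt_words (al b : seq nat) : seq (seq nat) :=
  if al is a :: al' then
    [seq map succn w ++ nseq (head 0 b) 0 ++ map succn (downrows Z (behead b))
       | Z <- strips b a, w <- dirt_words al' (downs Z (behead b))]
  else if b == [::] then [:: [::]] else [::].

Definition dirt_word (g b v : seq nat) : bool :=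
  [&& shape_from (nseq (size b) 0) v == b, dirt_path (nseq (size b) 0) v
    & strip_ok g (column_indices (nseq (size b) 0) v)].

Lemma size_dwords al b : size (dirt_words al b) = dirt_count al b.
Proof.
elim: al b => [|a al IHal] b /=; first by case: eqP.
by rewrite size_allpairs_dep sumnE big_map; apply: eq_bigr => Z _; apply: IHal.
Qed.

Lemma dcond_size g b v : dirt_word g b v -> size v = sumn g.
Proof. by case/and3P=> _ _ /andP[/eqP <- _]; rewrite size_cols. Qed.

Lemma last_iotaS m n : last m (iota m.+1 n) = m + n.
Proof. by elim: n m => [|n IHn] m /=; rewrite ?addn0 // IHn addSnnS. Qed.

Lemma dcond_cons g a b0 b Z w : 0 < a -> 0 < b0 -> all (leq 1) b -> strip b0 Z b ->
    b0 + size Z = a -> dirt_word g (downs Z b) w ->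
  dirt_word (rcons g a) (b0 :: b) (map succn w ++ nseq b0 0 ++ map succn (downrows Z b)).
Proof.
move=> a0 b00 bp bZ sz dw; have sw := dcond_size dw.
have [h1 h2 h3 h4] := downrows_ok b00 bZ bp.
move: dw; rewrite /dirt_word size_downs => /and3P[/eqP shw pw ow] /=.
have Zb : all (ltn b0) Z by apply/allP=> k kZ; have [_ /(_ _ kZ) []] := stripP _ _ _ bZ.
have sZ : sorted ltn Z by case/stripP: bZ.
rewrite !sh_cat sh_succ shw sh_zero add0n sh_succ h1 eqxx /=.
rewrite !dpath_cat dpath_succ0 pw sh_succ shw dpath_zero sh_zero add0n.
rewrite dpath_succ ?h2 // h3 /= !cols_cat sh_succ shw sh_zero add0n cols_succ cols_zero cols_succ h2.
rewrite strip_ok_rcons // ?size_cols // ow size_cat size_iota sz eqxx.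
case: b0 b00 bZ sz h2 Zb {h1 h3 h4} => // b0 _ _ _ _ Zb.
rewrite sorted_pairwise; last exact: ltn_trans.
rewrite pairwise_cat -!sorted_pairwise; try exact: ltn_trans.
rewrite iota_ltn_sorted sZ !andbT; apply/allrelP => x y; rewrite mem_iota => /andP[_ xb].
by move/(allP Zb); apply: leq_trans.
Qed.

Lemma dcond_rcons g a b0 b v : 0 < a -> 0 < b0 -> all (leq 1) b -> dirt_word (rcons g a) (b0 :: b) v ->
  exists Z w, [/\ strip b0 Z b, b0 + size Z = a, dirt_word g (downs Z b) w &
    v = map succn w ++ nseq b0 0 ++ map succn (downrows Z b)].
Proof.
move=> a0 b00 bp dv; have sv := dcond_size dv; rewrite sumn_rcons in sv.
move: dv; rewrite -(cat_take_drop (sumn g) v) /dirt_word; set w1 := take _ _; set z := drop _ _.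
have sw1 : size w1 = sumn g by rewrite size_takel // sv leq_addr.
rewrite [nseq _ _]/= dpath_cat sh_cat cols_cat strip_ok_rcons ?size_cols //.
case/and3P=> /eqP shv /andP[p1 p2] /and4P[ok1 /eqP sz hz sortz].
have [_ lew1] := size_sh (0 :: nseq (size b) 0) w1.
case es1 : (shape_from (0 :: nseq (size b) 0) w1) lew1 shv p2 hz sortz => [|c s'] // lew1 shv p2 hz sortz.
(* The last strip starts in column 1, that is, in an empty row. By [dirt_step] all rows below are
   then empty too, so the whole bottom row belongs to this strip. *)
have c0 : c = 0.
  case: z sz hz p2 {shv sortz} => [|j z'] sz hz p2; first by rewrite -sz in a0.
  move: hz; rewrite /= eqSS => /eqP hz; case/andP: p2 => /dstepP dj _.
  case: j hz dj {sz} => [|j] // hz dj; by have [//|_ /(_ hz)] := dj 0.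
have z1 : 0 \notin w1.
  have := nth_sh (0 :: nseq (size b) 0) w1 0; rewrite es1 c0 /= add0n => e.
  by apply/count_memPn.
move: es1 p1 ok1; rewrite c0 (nz_succ z1); set w := map predn w1.
rewrite sh_succ dpath_succ0 cols_succ => -[es] p1 ok1; rewrite c0 -{s'}es in shv p2 hz sortz lew1.
set s := shape_from _ w in shv p2 hz sortz lew1.
have pz : path ltn 0 (column_indices (0 :: s) z).
  by case: (column_indices _ z) hz sortz => //= k cz /eqP ->.
have [_ [y]] := zero_prefix pz shv; rewrite subn0 => ez.
move: shv p2 pz; rewrite ez sh_cat sh_zero sh_succ add0n => -[shy].
rewrite dpath_cat sh_zero add0n => /andP[_ p2].
rewrite cols_cat cols_zero sh_zero add0n cols_succ cat_path => /andP[_].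
rewrite last_iotaS add0n => pc; have cb : all (ltn b0) (column_indices s y) by apply: order_path_min pc; apply: ltn_trans.
rewrite dpath_succ // in p2.
have bZ := strip_cols pc; rewrite shy in bZ.
have [ally lesy] := size_sh s y; rewrite shy in ally lesy.
have ss : size s = size b by apply/eqP; rewrite eqn_leq lesy; move: lew1; rewrite /= size_nseq ltnS.
have [|e1 e2] := downrows_uniq _ p2; first by rewrite ss.
rewrite shy in e1 e2; exists (column_indices s y), w; rewrite e1 e2 -(nz_succ z1); split=> //.
  by rewrite -sz ez size_cat size_nseq size_map size_cols.
by rewrite ss -/s eqxx p1.
Qed.

(** [dirt_words] peels off the last row strip first, so the strip lengths appear in reverse
    order. *)
Lemma mem_dwords al b v : all (leq 1) al -> all (leq 1) b ->
  (v \in dirt_words al b) = dirt_word (rev al) b v.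
Proof.
elim: al b v => [|a al IHal] b v.
  move=> _ b0; rewrite /dirt_word /= /strip_ok /= size_cols andbT.
  case: v => [|j v]; last by rewrite !andbF; case: eqP.
  by case: b b0 => //= x b /andP[]; case: x.
move=> /= /andP[a0 al0] bp; rewrite rev_cons; case: b bp => [|b0 b] /=.
  move=> _; apply/esym/negP=> dv; have := dcond_size dv; rewrite sumn_rcons.
  by case/and3P: dv => /eqP/(congr1 sumn) + _ _; rewrite sumn_sh /= add0n => -> /esym/eqP; rewrite addn_eq0 (gtn_eqF a0) andbF.
move=> /andP[b00 bp]; apply/allpairsPdep/idP => [[Z [w []]]|dv].
  rewrite mem_strips => /andP[bZ /eqP sz]; rewrite IHal //; last exact: downs_pos bZ bp.
  by move=> dw ->; apply: dcond_cons.
have [Z [w [bZ sz dw ->]]] := dcond_rcons a0 b00 bp dv; exists Z, w.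
by rewrite mem_strips bZ sz eqxx IHal // (downs_pos b00 bZ bp).
Qed.

Lemma dwords_uniq al b : all (leq 1) al -> all (leq 1) b -> uniq (dirt_words al b).
Proof.
elim: al b => [|a al IHal] b; first by case: b.
move=> /= /andP[a0 al0]; case: b => [|b0 b] //= /andP[b00 bp].
apply: allpairs_uniq_dep; first exact: strips_uniq.
  by move=> Z; rewrite mem_strips => /andP[bZ _]; apply: IHal => //; apply: downs_pos bZ bp.
move=> _ _ /allpairsPdep[Z [w [+ + ->]]] /allpairsPdep[Z' [w' [+ + ->]]] /=.
rewrite !mem_strips => /andP[bZ _] wZ /andP[bZ' _] wZ'.
rewrite !mem_dwords // in wZ wZ'; [|exact: downs_pos bZ' bp|exact: downs_pos bZ bp].
have sw := dcond_size wZ; have sw' := dcond_size wZ'.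
move/eqP; rewrite eqseq_cat ?size_map ?sw ?sw' // => /andP[/eqP/(inj_map succn_inj) ew].
rewrite eqseq_cat // => /andP[_ /eqP/(inj_map succn_inj) ey].
have [_ h2 _ _] := downrows_ok b00 bZ bp; have [_ h2' _ _] := downrows_ok b00 bZ' bp.
have es : downs Z b = downs Z' b.
  case/and3P: wZ => /eqP <- _ _; case/and3P: wZ' => /eqP <- _ _.
  by rewrite !size_downs ew.
by rewrite ew -h2 -h2' es ey.
Qed.

(** * Row strips *)

Lemma dpathP s v : reflect (forall t, t < size v -> dirt_step (shape_from s (take t v)) (nth 0 v t)) (dirt_path s v).
Proof.
elim: v s => [|j v IHv] s /=; first exact: ReflectT.
apply: (iffP andP) => [[js /IHv h] [|t] //| h]; first exact: h.
by split; [exact: (h 0) | apply/IHv => t tv; exact: (h t.+1)].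
Qed.

Lemma nth_sh0 n v j : nth 0 (shape_from (nseq n 0) v) j = count_mem j v.
Proof. by rewrite nth_sh nth_nseq if_same. Qed.

Lemma nth_cols0 n v t : t < size v -> nth 0 (column_indices (nseq n 0) v) t = (earlier v t).+1.
Proof.
by move=> tv; rewrite /column_indices (nth_map (0, 0)) ?size_boxes // nth_boxes //= nth_nseq if_same.
Qed.

Lemma content_sh0 b v : content b v = (shape_from (nseq (size b) 0) v == b).
Proof.
apply/idP/eqP => [/contentP[h1 h2] | e].
  apply: (@eq_from_nth _ 0) => [|j _]; last by rewrite nth_sh0.
  apply/eqP; rewrite eqn_leq; apply/andP; split.
    by apply: size_sh_le; rewrite ?size_nseq //; apply/(all_nthP 0).
  by have [_] := size_sh (nseq (size b) 0) v; rewrite size_nseq.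
apply/contentP; split=> [t tv | j]; last by rewrite -(nth_sh0 (size b)) e.
by have [/all_nthP h _] := size_sh (nseq (size b) 0) v; rewrite -[in ltnRHS]e; apply: h.
Qed.

(** At the time of entry [t.+1] a row has as many boxes as its letter has occurrences before
    position [t]. For an entry in column [k], the recording condition thus says that a lower row of
    length at least [k] has length at least [k.+1]: the length [k] is excluded. *)
Lemma dirt_dpath b v : content b v -> all (leq 1) b ->
  column1_decreasing (fill (size b) v) && recording_condition (fill (size b) v) =
  dirt_path (nseq (size b) 0) v.
Proof.
move=> bv b0; have [h1 h2] := contentP _ _ bv.
rewrite /column1_decreasing (column1_fill bv b0) /recording_condition (shape_fill bv).
rewrite (all_diagram bv).
have gt_box t k i : t < size v ->
  ((k.+1, i.+1) \in diagram b) && (entry (fill (size b) v) (k.+1, i.+1) < t.+1) =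
  (k < count_mem i (take t v)).
  move=> tv; apply/andP/idP => [[/(diagram_bx bv)[s sv e]] | /occ_before - /(_ (ltnW tv))].
    by rewrite e entry_bx // ltnS => st; case: e => -> ->; apply: occ_take_lt.
  case=> s st [<- <-]; have sv := ltn_trans st tv.
  by rewrite -[(_, _)]/(box_at v s) bx_diagram // entry_bx.
apply/andP/dpathP => [[c1 /allP rc] t tv | h].
  apply/dstepP => i ij; rewrite !nth_sh0; split.
    move/allP: (rc t ltac:(by rewrite mem_iota)) => /(_ i.+1).
    rewrite mem_iota !entry_bx // !gt_box // -/(earlier v t) => /(_ _)/implyP H.
    by move=> e; have := H ltac:(by rewrite /= add1n ltnS ij); rewrite e ltnSn ltnn => /(_ isT).
  rewrite -/(earlier v t) => o0; apply/count_memPn; rewrite in_take_leq; last exact: ltnW.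
  rewrite -leqNgt; have ti : t <= index (nth 0 v t) v.
    by rewrite leqNgt -in_take_leq ?(ltnW tv) //; apply/count_memPn.
  have tr : transitive gtn by move=> x y z xy yz; apply: ltn_trans yz xy.
  have := sorted_ltn_nth tr 0 c1; move=> /(_ i (nth 0 v t)); rewrite !inE size_map size_iota.
  have jb := h1 _ tv; have ib := ltn_trans ij jb; move=> /(_ ib jb ij).
  by rewrite !(nth_map 0) ?size_iota // !nth_iota // !add0n /= ltnS; nlia.
split.
  apply/(sortedP 0) => j; rewrite size_map size_iota => jb; have jb' := ltnW jb.
  rewrite !(nth_map 0) ?size_iota // !nth_iota // !add0n /= ltnS.
  have jv : j.+1 \in v by rewrite (mem_content bv).
  have iv : index j.+1 v < size v by rewrite index_mem.
  have [_] := dstepP _ _ (h _ iv) j ltac:(by rewrite nth_index).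
  rewrite !nth_sh0 nth_index //.
  have -> : count_mem j.+1 (take (index j.+1 v) v) = 0.
    by apply/count_memPn; rewrite in_take_leq ?ltnn // ltnW.
  move=> /(_ erefl)/count_memPn; rewrite in_take_leq; last exact: ltnW.
  rewrite -leqNgt leq_eqVlt => /orP[/eqP e|//].
  have : nth 0 v (index j.+1 v) = nth 0 v (index j v) by rewrite e.
  by rewrite !nth_index ?(mem_content bv) // => /eqP; rewrite gtn_eqF.
apply/allP => t; rewrite mem_iota => tv; apply/allP => -[|i]; rewrite mem_iota // add1n ltnS /= => ij.
rewrite !entry_bx // !gt_box //; apply/implyP => ot; rewrite ltn_neqAle ot andbT.
have [h3 _] := dstepP _ _ (h t tv) i ij.
by apply/eqP => e; apply: h3; rewrite !nth_sh0 -e.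
Qed.

Section Segments.

Definition segments (k : nat) (s : seq nat) : seq (nat * nat) := pairmap (fun p q => (p.+1, q)) k s.

Lemma mem_segs k s a b : path ltn k s -> ((a, b) \in segments k s) =
  [&& 0 < a, a.-1 \in k :: s, b \in s, a <= b & all (fun x => ~~ (a <= x < b)) s].
Proof.
elim: s k => [|x s IHs] k /=; first by rewrite !andbF.
move=> /andP[kx xs]; rewrite inE (IHs _ xs) xpair_eqE.
have xlt y : y \in s -> x < y := allP (order_path_min ltn_trans xs) y.
apply/orP/and5P => [[/andP[/eqP-> /eqP->]|/and5P[a0 ax bs ab h]]|[a0 ax bs ab /andP[hx h]]].
- rewrite !inE !eqxx ltnn andbF; split=> //=; apply/allP => y /xlt xy.
  by rewrite negb_and -!leqNgt (ltnW xy) orbT.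
- split=> //; first by rewrite inE ax orbT.
    by rewrite inE bs orbT.
  rewrite h andbT; move: ax; rewrite inE => /orP[/eqP|/xlt]; nlia.
move: ax; rewrite inE => /orP[/eqP ak | ax]; [left | right].
  have -> : a = k.+1 by nlia.
  rewrite eqxx /=; move: bs; rewrite inE => /orP[// | /xlt xb].
  by move: hx; nlia.
apply/and5P; split=> //; move: bs; rewrite inE => /orP[/eqP box_at|//].
by exfalso; move: ax; rewrite inE => /orP[/eqP e|/xlt e]; nlia.
Qed.

Lemma segs_sorted k s : path ltn k s -> sorted lt_c (segments k s).
Proof.
case: s => //= x s /andP[kx]; elim: s k x kx => //= y s IHs k x kx /andP[xy ys].
by rewrite (IHs x y xy ys) andbT /lt_c /= ltnS kx.
Qed.

Lemma segs_fst k s : map fst (segments k s) = map succn (belast k s).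
Proof. by elim: s k => //= x s IHs k; rewrite IHs. Qed.

Lemma segs_shape k g : all (leq 1) g ->
  [seq (s.2 - s.1).+1 | s <- segments k (scanl addn k g)] = g.
Proof.
elim: g k => //= x g IHg k /andP[x0 g0]; rewrite IHg //; congr (_ :: _); nlia.
Qed.

Lemma scanl_path k g : all (leq 1) g -> path ltn k (scanl addn k g).
Proof. by elim: g k => //= x g IHg k /andP[x0 g0]; rewrite IHg // andbT; nlia. Qed.

Lemma last_scanl k g : last k (scanl addn k g) = k + sumn g.
Proof. by elim: g k => [|x g IHg] k /=; rewrite ?addn0 // IHg addnA. Qed.

Lemma exists_cuts n (P : pred nat) : exists g, [/\ all (leq 1) g, sumn g = n &
  forall e, 0 < e < n -> (e \in scanl addn 0 g) = P e].
Proof.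
have sh1 k x g : scanl addn (x + k) g = map (addn x) (scanl addn k g).
  by elim: g k => //= y g IHg k; rewrite -addnA IHg.
elim: n P => [|[|n] IHn] P; first by exists [::]; split=> // -[].
  by exists [:: 1]; split=> // -[|[]].
have [[|x g] [//= /andP[x0 g0] gn h]] := IHn (fun e => P e.+1).
case: (boolP (P 1)) => P1.
  exists [:: 1, x & g]; rewrite /= x0 g0 gn; split=> // -[|[|e]] //= en.
  rewrite !inE -(h e.+1) // inE !add0n add1n eqSS -[x.+1]add1n sh1.
  by rewrite -[e.+2]add1n (mem_map (@addnI 1)).
exists (x.+1 :: g); rewrite /= g0 addSn gn; split=> // -[|[|e]] //= en.
  rewrite inE add0n eqSS (ltn_eqF x0) /= -[x.+1]add1n sh1 (negPf P1).
  rewrite -[1]/(1 + 0) (mem_map (@addnI 1)); apply/negP => h0.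
  by have := allP (order_path_min ltn_trans (scanl_path x g0)) 0 h0.
by rewrite -(h e.+1) // !inE !add0n eqSS -[x.+1]add1n sh1 -[e.+2]add1n (mem_map (@addnI 1)).
Qed.

End Segments.

(** Both lists increase lexicographically, so comparing members is enough. Runs are the intervals
    without a partial sum [x] such that [a <= x < b]; maximality forces [b] to be a partial sum, and
    [a.-1] to be one or 0. *)
Lemma row_strips_segs Q g : all (leq 1) g -> sumn g = sumn (shape Q) ->
    (forall e, 0 < e < sumn g ->
       ((box_of Q e).1 < (box_of Q e.+1).1) = (e \notin scanl addn 0 g)) ->
  row_strips Q = segments 0 (scanl addn 0 g).
Proof.
move=> g0 gQ asc; have pg := scanl_path 0 g0; have trc : transitive lt_c.
  by move=> x y z; rewrite /lt_c; nlia.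
have irc : irreflexive lt_c by move=> x; rewrite /lt_c !ltnn andbF.
apply: (irr_sorted_eq trc irc).
- rewrite /row_strips; apply: sorted_filter => //; rewrite sorted_pairwise //.
  set n := sumn _; have -> : [seq (a, b) | a <- iota 1 n, b <- iota 1 n] =
      flatten [seq column_boxes (nseq n n) i | i <- iota 1 n].
    congr flatten; apply/eq_in_map => i; rewrite mem_iota add1n ltnS => /andP[_ ni].
    rewrite /column_boxes (all_filterP _) ?size_nseq; last first.
      by apply/allP => j; rewrite mem_iota nth_nseq => /andP[_ ->].
    by rewrite (iotaDl 1 0) -map_comp.
  apply: cols_sorted; [exact: trc | | | exact: iota_ltn_sorted].
    by move=> i j k _ jk; rewrite /lt_c /= eqxx jk orbT.
  by move=> i i' j k _ _ ii'; rewrite /lt_c /= ii'.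
- exact: segs_sorted.
have run a b : row_run Q a b = [&& 1 <= a, a <= b, b <= sumn g &
    all (fun x => ~~ (a <= x < b)) (scanl addn 0 g)].
  rewrite /row_run -gQ; case: (posnP a) => //= a0; case: (leqP a b) => //= ab.
  case: (leqP b (sumn g)) => //= bg; apply/allP/allP => h x.
    move=> xs; apply/negP=> /andP[ax xb]; have := h x.
    rewrite mem_iota ax subnKC // xb => /(_ isT); rewrite asc ?xs //.
    by apply/andP; split; nlia.
  rewrite mem_iota subnKC // => axb; rewrite asc; last by move: axb; nlia.
  by apply/negP=> /h; rewrite axb.
have ng : sumn g \in 0 :: scanl addn 0 g by rewrite -{1}[sumn g]add0n mem_scanl_last.
have le0 x : x \in scanl addn 0 g -> x <= sumn g.
  by move=> xs; have := @mem_scanl_le 0 g x; rewrite inE xs orbT add0n => ->.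
case=> a b; rewrite mem_segs // mem_filter /= /is_row_strip !run.
apply/andP/and5P => [[/and3P[/and4P[a0 ab bg h] na nb] _]|[a0 ax bs ab h]].
  split=> //.
    rewrite inE; case: (a.-1 =P 0) => //= a1; apply/negPn/negP => an.
    move: na; rewrite bg /=; have -> : 0 < a.-1 by nlia.
    have -> /= : a.-1 <= b by nlia.
    case/allP => x xs; move: (allP h x xs); case: (x =P a.-1) => [e|ne]; first by rewrite -e xs in an.
    by nlia.
  case: (leqP (sumn g) b) => gb.
    have -> : b = sumn g by apply/eqP; rewrite eqn_leq bg gb.
    by move: ng; rewrite inE => /orP[/eqP e|//]; move: a0 ab bg; nlia.
  apply/negPn/negP => bn; move: nb; rewrite a0 gb (leqW ab) /=.
  case/allP => x xs; move: (allP h x xs); case: (x =P b) => [e|ne]; first by rewrite -e xs in bn.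
  by nlia.
have bg := le0 b bs; split; last first.
  by apply/allpairsP; exists (a, b); rewrite !mem_iota -gQ; split=> //=; nlia.
rewrite a0 ab bg h /=; apply/andP; split.
  rewrite inE in ax; case/orP: ax => [/eqP -> // | ax].
  by apply/negP => /and3P[a1 _ /allP /(_ _ ax)]; nlia.
by apply/negP => /and3P[_ _ /allP /(_ _ bs)]; nlia.
Qed.

Lemma strips_strip_ok g b v : content b v -> all (leq 1) g -> sumn g = size v ->
  strips_start_in_column1 (fill (size b) v) && (row_strip_shape (fill (size b) v) == g) =
  strip_ok g (column_indices (nseq (size b) 0) v).
Proof.
move=> bv g0 gv; set Q := fill _ _; set cs := column_indices _ _.
have shQ : sumn (shape Q) = size v by rewrite shape_fill // (size_content bv).
have csz : size cs = size v by rewrite size_cols.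
have col e : e < size v -> (box_of Q e.+1).1 = nth 0 cs e.
  by move=> ev; rewrite box_of_fill // nth_cols0.
have asc e : 0 < e < size v ->
    ((box_of Q e).1 < (box_of Q e.+1).1) = (nth 0 cs e.-1 < nth 0 cs e).
  move=> /andP[e0 ev]; rewrite col // -{1}(prednK e0) col //; exact: leq_ltn_trans (leq_pred e) ev.
have shapeE h : all (leq 1) h -> row_strips Q = segments 0 (scanl addn 0 h) ->
    row_strip_shape Q = h.
  by move=> h0 e; rewrite /row_strip_shape e segs_shape.
have startE h : all (leq 1) h -> row_strips Q = segments 0 (scanl addn 0 h) -> sumn h = size v ->
    strips_start_in_column1 Q = all (fun e => (e \in 0 :: scanl addn 0 h) ==> (nth 0 cs e == 1))
                                    (iota 0 (size v)).
  move=> h0 eh hv; rewrite /strips_start_in_column1 eh.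
  have -> : all (fun s => (box_of Q s.1).1 == 1) (segments 0 (scanl addn 0 h)) =
            all (fun e => (box_of Q e.+1).1 == 1) (belast 0 (scanl addn 0 h)).
    by rewrite -(all_map fst (fun e => (box_of Q e).1 == 1)) segs_fst all_map.
  have lastE : last 0 (scanl addn 0 h) = size v by rewrite last_scanl hv.
  have memE e : (e \in 0 :: scanl addn 0 h) = (e == size v) || (e \in belast 0 (scanl addn 0 h)).
    by rewrite lastI lastE mem_rcons inE.
  have ltE e : e \in belast 0 (scanl addn 0 h) -> e < size v.
    move=> eb; have := scanl_path 0 h0; rewrite -[path _ _ _]/(sorted ltn (0 :: scanl addn 0 h)).
    rewrite lastI lastE sorted_pairwise; last exact: ltn_trans.
    by rewrite -cats1 pairwise_cat allrel1r => /and3P[/allP /(_ _ eb)].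
  apply/allP/allP => hh e.
    rewrite mem_iota => ev; apply/implyP; rewrite memE (ltn_eqF ev) => /hh.
    by rewrite col.
  move=> eb; have ev := ltE e eb; rewrite col //.
  by apply: (implyP (hh e _)); rewrite ?mem_iota // memE eb orbT.
rewrite /strip_ok csz gv eqxx andTb.
apply/andP/allP => [[st /eqP sh_g] e | h].
  (* The strips are first cut out by some composition [h]; since the row strip shape is [g], it
     follows that [h = g]. *)
  have [h [h0 hv cut]] := exists_cuts (size v) (fun e => ~~ (nth 0 cs e.-1 < nth 0 cs e)).
  have seg : row_strips Q = segments 0 (scanl addn 0 h).
    by apply: row_strips_segs; rewrite ?shQ // hv => e' ev; rewrite asc // cut // negbK.
  have hg : h = g by rewrite -sh_g (shapeE h).
  rewrite {h}hg in h0 hv cut seg; rewrite (startE g) // in st.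
  rewrite mem_iota => ev; have := allP st e; rewrite mem_iota => /(_ ev).
  have ev' : e < size v by [].
  case: ifP => // eg _; have := cut e; rewrite ev' andbT.
  case: (posnP e) eg => [-> | e0 eg /(_ isT)]; first by rewrite mem_head.
  by move: eg; rewrite inE => /norP[_ /negbTE ->] /esym/negbT; rewrite negbK.
have cut e : 0 < e < sumn g -> ((box_of Q e).1 < (box_of Q e.+1).1) = (e \notin scanl addn 0 g).
  rewrite gv => /andP[e0 ev]; rewrite asc ?e0 //; have := h e; rewrite mem_iota => /(_ ev).
  rewrite inE gtn_eqF //=; case: ifP => [_ /eqP -> | _ -> //].
  have e'v := leq_ltn_trans (leq_pred e) ev.
  by rewrite nth_cols0 // ltnS.
have seg : row_strips Q = segments 0 (scanl addn 0 g).
  by apply: row_strips_segs; rewrite ?shQ.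
rewrite (shapeE g) // eqxx; split=> //; rewrite (startE g) //.
by apply/allP => e /h; case: ifP.
Qed.

Lemma mem_DIRT g b v : content b v -> all (leq 1) b -> all (leq 1) g -> sumn g = sumn b ->
  (fill (size b) v \in DIRT b g) = dirt_word g b v.
Proof.
move=> bv b0 g0 gb; rewrite mem_filter fill_fillings // andbT /is_DIRT fill_rows andTb.
rewrite /dirt_word -content_sh0 bv andTb -dirt_dpath // -strips_strip_ok ?(size_content bv) //.
by rewrite -!andbA; do !bool_congr.
Qed.

Lemma size_DIRT al b : all (leq 1) al -> all (leq 1) b -> sumn al = sumn b ->
  size (DIRT b (rev al)) = dirt_count al b.
Proof.
move=> al0 b0 ab; have rev0 : all (leq 1) (rev al) by rewrite all_rev.
have revb : sumn (rev al) = sumn b by rewrite sumn_rev.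
have cont v : dirt_word (rev al) b v -> content b v by rewrite content_sh0 => /and3P[].
rewrite -size_dwords -(size_map (fill (size b))); apply: perm_size; apply: uniq_perm.
- by rewrite filter_uniq // fillings_uniq.
- rewrite map_inj_in_uniq ?dwords_uniq // => v w; rewrite !mem_dwords // => /cont bv /cont bw.
  exact: fill_inj.
move=> T; apply/idP/mapP => [TD | [v]].
  have [v bv eT] : exists2 v, content b v & T = fill (size b) v.
    by move: TD; rewrite mem_filter => /andP[/andP[/and4P[rT _ _ _] _] /fill_surj/(_ rT)].
  by exists v; rewrite // mem_dwords // -mem_DIRT // -eT.
by rewrite mem_dwords // => dv ->; rewrite mem_DIRT // cont.
Qed.

(* The expansion of the quasisymmetric Schur Q-functions *)
Close Scope nat_scope.
Unset Implicit Arguments.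

Theorem theorem4p5 (n : nat) (alpha : seq nat)
    (alpha_comp : is_composition n alpha) (alpha_peak : is_peak alpha) :
  forall m : monomial,
    quasi_schur_Q alpha m =
    (\sum_(beta <- compositions n | is_peak beta)
        (size (DIRT beta (rev alpha)))%:R * peak_Young_quasi_schur beta m)%R.
Proof.
move=> m; have [a0 an] := andP alpha_comp; move/eqP: an => an.
pose F D := peak_function (set_comp n (peaks D)) m.
have pk_nil (s u : seq nat) : peak_columns s u -> is_peak (add_columns s u).
  by elim: u s => [|l u IHu] s /=; [rewrite andbT | case/andP=> _ /IHu].
transitivity (\sum_(v <- sit_words alpha)
    (if peak_rows [::] v then F (descent_list (descent_bits ltn v)) else 0))%R.
  (* The column reading is replaced by the row reading, whose descent bits have the same
     distribution on peak words by [des_c_r]. *)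
  rewrite /quasi_schur_Q an (SPIT_sum F a0) -big_mkcond -big_filter.
  rewrite -(big_map (fun v => descent_bits (fun x y => ~~ le_c x y) (boxes [::] v)) xpredT
              (fun D => F (descent_list D))).
  by rewrite (perm_big _ (des_c_r alpha)) big_map.
rewrite (@sits_upaths alpha (fun k D => if k then F (descent_list D) else 0)%R) // an.
rewrite [RHS]big_mkcond; apply: eq_big_seq => b; rewrite mem_compositions => /andP[b0 /eqP bn].
rewrite -big_mkcond -big_filter size_DIRT ?an //; case: ifP => pb.
  by rewrite /peak_Young_quasi_schur bn (SPYCT_sum F b0).
(* If [b] is not peak, no column word ending at [b] satisfies the peak condition, so its term is
   0. *)
rewrite [X in (_ * X)%R]big1_seq ?mulr0 // => u /andP[_].
by rewrite mem_filter mem_upaths => /and3P[/pk_nil pu _ /eqP ub]; rewrite ub pb in pu.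
Qed.
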